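(* Let $\psi:\mathbb{R}\to\mathbb{R}$ be a strictly increasing function (not necessarily continuous) and let $F=\{(x,\psi(x)):x\in\mathbb{R}\}\subset\mathbb{R}^2$ be its graph. Then every compact set $K\subset\Phi(F)\subset\mathbb{T}^2$ satisfies $|\nu|(K)=0$ for every $\nu\in RP(\mathbb{T}^2)$. In particular, no non-zero RP-measure on $\mathbb{T}^2$ has support contained in $\Phi(F)$.
   Context: $\Phi:\mathbb{R}^2\to\mathbb{T}^2$, $\Phi(x_1,x_2)=(e^{ix_1},e^{ix_2})$. $RP(\mathbb{T}^2)$ is the set of real Borel measures $\mu$ of bounded variation on $\mathbb{T}^2$ whose Poisson integral $P[d\mu](z)=\int_{\mathbb{T}^2}\prod_{j=1}^2\frac{1-|z_j|^2}{|\zeta_j-z_j|^2}\,d\mu(\zeta)$ is the real part of a holomorphic function on $\mathbb{D}^2$ (RP-measures). *)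

(* Defs.v *)
From HB Require Import structures.
From mathcomp Require Import all_boot all_order all_algebra.
From mathcomp Require Import all_classical all_reals all_analysis.
From mathcomp Require Import complex.
Set Implicit Arguments. Unset Strict Implicit. Unset Printing Implicit Defensive.
Import Order.TTheory GRing.Theory Num.Theory.
Import numFieldNormedType.Exports.
Local Open Scope classical_set_scope.
Local Open Scope ring_scope.

(* The torus T^2 is realised as the subset
   {((c1,s1),(c2,s2)) | c1^2+s1^2 = 1, c2^2+s2^2 = 1} of R^4 = (R*R)*(R*R),
   the point ((c1,s1),(c2,s2)) standing for (c1 + i s1, c2 + i s2) in C^2.
   A real Borel measure of bounded variation on T^2 is represented as a
   difference mu1 - mu2 of two finite Borel measures on R^4 concentrated on
   T^2 (Jordan decomposition); every such measure arises this way. *)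
Notation R4 R := ((R * R) * (R * R))%type.

Definition torus2 {R : realType} : set (R4 R) :=
  [set p | p.1.1 ^+ 2 + p.1.2 ^+ 2 = 1 /\ p.2.1 ^+ 2 + p.2.2 ^+ 2 = 1].

Definition Phi {R : realType} (x : R * R) : R4 R :=
  ((cos x.1, sin x.1), (cos x.2, sin x.2)).

Definition PhiGraph {R : realType} (psi : R -> R) : set (R4 R) :=
  Phi @` [set x : R * R | x.2 = psi x.1].

Definition on_torus {R : realType} (mu1 mu2 : {finite_measure set (R4 R) -> \bar R}) :=
  mu1 (~` torus2) = 0%E /\ mu2 (~` torus2) = 0%E.

Definition sqmod {R : realType} (z : R[i]) : R :=
  complex.Re z ^+ 2 + complex.Im z ^+ 2.

Definition bidisc {R : realType} (z : R[i] * R[i]) : Prop :=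
  sqmod z.1 < 1 /\ sqmod z.2 < 1.

Definition poisson_kernel {R : realType} (z : R[i] * R[i]) (p : R4 R) : R :=
  (1 - sqmod z.1) / ((p.1.1 - complex.Re z.1) ^+ 2 + (p.1.2 - complex.Im z.1) ^+ 2)
  * ((1 - sqmod z.2) / ((p.2.1 - complex.Re z.2) ^+ 2 + (p.2.2 - complex.Im z.2) ^+ 2)).

Definition poisson_int {R : realType} (mu1 mu2 : {finite_measure set (R4 R) -> \bar R})
  (z : R[i] * R[i]) : R :=
  Rintegral mu1 torus2 (poisson_kernel z) - Rintegral mu2 torus2 (poisson_kernel z).

(* holomorphic on D^2: complex (Frechet, C-linear) differentiable at every point *)
Definition holomorphic_bidisc {R : realType} (g : R[i]^o * R[i]^o -> R[i]^o) : Prop :=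
  forall z : R[i]^o * R[i]^o, bidisc z -> differentiable g z.

Definition RP {R : realType} (mu1 mu2 : {finite_measure set (R4 R) -> \bar R}) : Prop :=
  exists g : R[i]^o * R[i]^o -> R[i]^o, holomorphic_bidisc g /\
    forall z : R[i] * R[i], bidisc z -> complex.Re (g z) = poisson_int mu1 mu2 z.

Definition totvar {R : realType} (mu1 mu2 : {finite_measure set (R4 R) -> \bar R})
  (A : set (R4 R)) : \bar R :=
  ereal_sup [set s | exists (n : nat) (B : 'I_n -> set (R4 R)),
    (forall i, measurable (B i)) /\ (forall i, B i `<=` A) /\
    (forall i j, i != j -> B i `&` B j = set0) /\
    s = (\sum_(i < n) `| mu1 (B i) - mu2 (B i) |)%E].

Definition support_in {R : realType} (mu1 mu2 : {finite_measure set (R4 R) -> \bar R})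
  (S : set (R4 R)) : Prop :=
  forall p, torus2 p -> ~ S p ->
    exists U : set (R4 R), open U /\ U p /\ totvar mu1 mu2 U = 0%E.

(* Main.v *)
Require Import Defs.
From HB Require Import structures.
From mathcomp Require Import all_boot all_order all_algebra.
From mathcomp Require Import all_classical all_reals all_analysis.
From mathcomp Require Import measurable_realfun complex.
From mathcomp Require Import ring lra.
Set Implicit Arguments. Unset Strict Implicit. Unset Printing Implicit Defensive.
Import Order.TTheory GRing.Theory Num.Theory.
Import numFieldNormedType.Exports.
Local Open Scope classical_set_scope.
Local Open Scope ring_scope.

(** Write mu = mu1 - mu2 and let zeta1, zeta2 be the coordinates of the torus. Comparing the
    Poisson integral with g shows that the moments of mu against
    1 / ((zeta1 - z) * conj (zeta2 - w)) vanish for nonzero z, w in the disc (that is, the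
    Fourier coefficients of mu with indices of opposite signs vanish). Combinations of such
    kernels that peak near chosen points yield two principles for graphs in the angles X, Y:
    - as in the F. and M. Riesz theorem, mu vanishes on a graph Y = psi(X) over a
      Lebesgue-null set of X, and likewise with the roles of X and Y exchanged;
    - for psi increasing and bi-Lipschitz, with small oscillation, on a compact set P, a mu which is
      positive on the graph over P vanishes there: the product of a peak kernel in zeta1 and
      a conjugate one in zeta2 has nonnegative real part along an increasing graph, so a sum of
      such products over a fine net of P is bounded below on the graph, tends to 0 off it, and
      yet has zero integral.
    A strictly increasing psi is locally bi-Lipschitz outside a null set of X and a null set
    of Y (Vitali covering for psi and for its generalised inverse), and the Hahn
    decomposition with inner regularity reduces the second principle to positive pieces. So
    mu vanishes on every branch of the graph. The second claim follows because the
    complement of the graph in the torus is covered by countably many boxes of zero variation. *)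

(** The direction of monotonicity is essential: Lebesgue measure on the decreasing graph y = -x has
    Fourier coefficients only at indices (m, m), and its Poisson integral is a multiple of the real
    part of (1 + z w) / (1 - z w), so it is an RP-measure. The order enters where two angle
    differences of equal sign give sin a sin b >= 0. The sums of peaks are only bounded below on the
    graph, with no limit identified there, so the argument needs mu of one sign. Both Lipschitz
    bounds are used: the upper one keeps the second peak of the home cell away from 0, the lower one
    spreads the centres on the second circle so that the sum stays bounded. Where the upper bound
    fails X lies in a null set, where the lower one fails Y does; hence the Riesz principle in both
    coordinates. As psi may jump, the graph need not be closed. It is Borel because psi is monotone,
    and its Borel subsets are preimages of Borel sets of angles, since x determines (x, psi x). This
    brings regularity down to the line, where compact sets are at hand. *)

Notation cRe := complex.Re.
Notation cIm := complex.Im.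
Notation nc := Normc.normc.

(** * Complex modulus *)

Section Modulus.
Variable R : realType.
Implicit Types z w : R[i].

Lemma ncE z : nc z = Num.sqrt (cRe z ^+ 2 + cIm z ^+ 2).
Proof. by case: z. Qed.

Lemma normC_nc z : `|z| = (nc z)%:C%C.
Proof. by rewrite normc_def ncE. Qed.

Lemma sqr_nc z : nc z ^+ 2 = sqmod z.
Proof. by rewrite ncE sqr_sqrtr// addr_ge0// sqr_ge0. Qed.

Lemma nc_ge0 z : 0 <= nc z.
Proof. by rewrite ncE sqrtr_ge0. Qed.

Lemma ncM z w : nc (z * w) = nc z * nc w.
Proof. exact: Normc.normcM. Qed.

Lemma ncV z : nc z^-1 = (nc z)^-1.
Proof. exact: Normc.normcV. Qed.

Lemma nc0 : nc (0 : R[i]) = 0.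
Proof. exact: Normc.normc0. Qed.

Lemma nc1 : nc (1 : R[i]) = 1.
Proof. exact: Normc.normc1. Qed.

Lemma ncN z : nc (- z) = nc z.
Proof. exact: normcN. Qed.

Lemma ncB z w : nc (z - w) = nc (w - z).
Proof. by rewrite -ncN opprB. Qed.

Lemma ler_ncD z w : nc (z + w) <= nc z + nc w.
Proof. exact: le_normcD. Qed.

Lemma ler_ncB z w : nc (z - w) <= nc z + nc w.
Proof. by rewrite -(ncN w) ler_ncD. Qed.

Lemma ler_nc_dist z w : nc z - nc w <= nc (z - w).
Proof. by rewrite lerBlDr -{1}(subrK w z) ler_ncD. Qed.

Lemma nc_eq0 z : (nc z == 0) = (z == 0).
Proof.
apply/eqP/eqP => [/Normc.eq0_normc //|->]; exact: nc0.
Qed.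

Lemma nc_gt0 z : (0 < nc z) = (z != 0).
Proof. by rewrite lt0r nc_eq0 nc_ge0 andbT. Qed.

Lemma ncX z n : nc (z ^+ n) = nc z ^+ n.
Proof. by elim: n => [|n ih]; rewrite ?expr0 ?nc1// !exprS ncM ih. Qed.

Lemma nc_real (x : R) : nc (x%:C%C) = `|x|.
Proof. by rewrite ncE /= expr0n /= addr0 sqrtr_sqr. Qed.

Lemma le_Re_nc z : `|cRe z| <= nc z.
Proof. by rewrite ncE -sqrtr_sqr ler_wsqrtr// lerDl sqr_ge0. Qed.

Lemma le_Im_nc z : `|cIm z| <= nc z.
Proof. by rewrite ncE -sqrtr_sqr ler_wsqrtr// lerDr sqr_ge0. Qed.

Lemma nc_le z : nc z <= `|cRe z| + `|cIm z|.
Proof.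
have -> : z = (cRe z)%:C%C + 'i%C * (cIm z)%:C%C.
  by rewrite -complexE; case: z.
rewrite (le_trans (ler_ncD _ _))// ncM !nc_real.
have -> : nc ('i%C : R[i]) = 1 by rewrite ncE /= expr0n /= add0r expr1n sqrtr1.
rewrite mul1r; case: z => a b /=.
by rewrite mul0r !mulr0 !subr0 !mul1r !add0r addr0.
Qed.

Lemma nc_conj z : nc (z^*)%C = nc z.
Proof. by case: z => a b /=; rewrite sqrrN. Qed.

Lemma nc_sum (I : Type) (s : seq I) (P : pred I) (F : I -> R[i]) :
  nc (\sum_(i <- s | P i) F i) <= \sum_(i <- s | P i) nc (F i).
Proof.
apply: (big_ind2 (fun a b => nc a <= b)); rewrite ?nc0//.
by move=> a b c e h1 h2; rewrite (le_trans (ler_ncD _ _))// lerD.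
Qed.

Lemma ReE z w : cRe (z * w) = cRe z * cRe w - cIm z * cIm w.
Proof. by case: z; case: w. Qed.
Lemma ImE z w : cIm (z * w) = cRe z * cIm w + cIm z * cRe w.
Proof. by case: z; case: w. Qed.
Lemma ReD z w : cRe (z + w) = cRe z + cRe w.
Proof. by case: z; case: w. Qed.
Lemma ImD z w : cIm (z + w) = cIm z + cIm w.
Proof. by case: z; case: w. Qed.
Lemma ReN z : cRe (- z) = - cRe z. Proof. by case: z. Qed.
Lemma ImN z : cIm (- z) = - cIm z. Proof. by case: z. Qed.
Lemma Re_sum (I : Type) (s : seq I) (P : pred I) (F : I -> R[i]) :
  cRe (\sum_(i <- s | P i) F i) = \sum_(i <- s | P i) cRe (F i).
Proof. exact: (big_morph _ ReD). Qed.
Lemma Re_inv z : cRe (z^-1) = cRe z / sqmod z.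
Proof. by case: z. Qed.
Lemma Im_inv z : cIm (z^-1) = - cIm z / sqmod z.
Proof. by case: z => a b; rewrite /sqmod /= mulNr. Qed.
Lemma eq_ReIm z w : cRe z = cRe w -> cIm z = cIm w -> z = w.
Proof. by case: z; case: w => a b c d /= -> ->. Qed.

End Modulus.

(** * Integration against a difference of finite measures *)

Section SignedIntegral.
Context d (T : measurableType d) (R : realType).
Variables (mu1 mu2 : {finite_measure set T -> \bar R}) (D : set T).
Hypothesis mD : measurable D.

(** Bounded measurable functions are integrable for every finite measure and closed under products,
    so the algebra of [Jint] carries no integrability conditions. *)
Definition bmf (f : T -> R) :=
  measurable_fun D f /\ exists M : R, forall x, D x -> `|f x| <= M.

Definition Jint (f : T -> R) : R := Rintegral mu1 D f - Rintegral mu2 D f.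

Lemma bmf_integrable (mu : {finite_measure set T -> \bar R}) f :
  bmf f -> mu.-integrable D (EFin \o f).
Proof.
move=> [mf [M hM]]; apply: measurable_bounded_integrable => //.
  by rewrite ltey_eq fin_num_measure.
exists M; split; first exact: num_real.
by move=> x Mx y Dy; exact: (le_trans (hM _ Dy) (ltW Mx)).
Qed.

Lemma bmf_cst c : bmf (fun=> c).
Proof. by split; [exact: measurable_cst|exists `|c|]. Qed.

Lemma bmfD f g : bmf f -> bmf g -> bmf (fun x => f x + g x).
Proof.
move=> [mf [M hM]] [mg [N hN]]; split; first exact: measurable_funD.
by exists (M + N) => x Dx; rewrite (le_trans (ler_normD _ _))// lerD ?hM ?hN.
Qed.

Lemma bmfM f g : bmf f -> bmf g -> bmf (fun x => f x * g x).
Proof.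
move=> [mf [M hM]] [mg [N hN]]; split; first exact: measurable_funM.
by exists (M * N) => x Dx; rewrite normrM ler_pM ?hM ?hN.
Qed.

Lemma bmfN f : bmf f -> bmf (fun x => - f x).
Proof.
move=> /(bmfM (bmf_cst (-1))); congr bmf; apply/funext => x; exact: mulN1r.
Qed.

Lemma bmf_indic (A : set T) : measurable A -> bmf (\1_A : T -> R).
Proof.
move=> mA; split; first by apply: measurable_indic.
by exists 1 => x _; rewrite indicE; case: (_ \in _); rewrite ?normr0 ?normr1.
Qed.

Lemma JintD f g : bmf f -> bmf g ->
  Jint (fun x => f x + g x) = Jint f + Jint g.
Proof.
move=> hf hg; rewrite /Jint !RintegralD//; try exact: bmf_integrable.
by ring.
Qed.

Lemma JintZ c f : bmf f -> Jint (fun x => c * f x) = c * Jint f.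
Proof.
move=> hf; rewrite /Jint !RintegralZl//; try exact: bmf_integrable.
by ring.
Qed.

Lemma JintN f : bmf f -> Jint (fun x => - f x) = - Jint f.
Proof.
move=> hf; rewrite -mulN1r -JintZ//; congr Jint.
by apply/funext => x; rewrite mulN1r.
Qed.

Lemma eq_Jint f g : (forall x, D x -> f x = g x) -> Jint f = Jint g.
Proof.
move=> h; rewrite /Jint; congr (_ - _); apply: eq_Rintegral => x /set_mem; exact: h.
Qed.

Definition mass : R := fine (mu1 D) + fine (mu2 D).

Lemma mass_ge0 : 0 <= mass.
Proof. by rewrite addr_ge0// fine_ge0. Qed.

Lemma le_Rintegral_bound (mu : {finite_measure set T -> \bar R}) f M :
  bmf f -> (forall x, D x -> `|f x| <= M) ->
  `|Rintegral mu D f| <= M * fine (mu D).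
Proof.
move=> hf hM; rewrite (le_trans (le_normr_Rintegral mD (bmf_integrable mu hf)))//.
rewrite -Rintegral_cst//; apply: le_Rintegral => //.
- apply: bmf_integrable; split; first exact: measurableT_comp hf.1.
  by exists M => x Dx; rewrite normr_id hM.
- exact: bmf_integrable (bmf_cst M).
Qed.

Lemma le_Jint f M : bmf f -> (forall x, D x -> `|f x| <= M) ->
  `|Jint f| <= M * mass.
Proof.
move=> hf hM; rewrite /Jint (le_trans (ler_normB _ _))// /mass mulrDr.
by rewrite lerD// le_Rintegral_bound.
Qed.

Lemma bmf_cvg (f_ : nat -> T -> R) (f : T -> R) (M : R) :
  (forall n, measurable_fun D (f_ n)) ->
  (forall n x, D x -> `|f_ n x| <= M) ->
  (forall x, D x -> f_ n x @[n --> \oo] --> f x) -> bmf f.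
Proof.
move=> mf hM cf; split; first exact: (measurable_fun_cvg mf).
exists M => x Dx.
have h : `|f_ n x| @[n --> \oo] --> `|f x| by apply: cvg_norm; exact: cf.
by apply: (ler_cvg_to h (cvg_cst M)); apply: nearW => n; exact: hM.
Qed.

Lemma Rintegral_cvg (mu : {finite_measure set T -> \bar R}) (f_ : nat -> T -> R) (f : T -> R) (M : R) :
  (forall n, measurable_fun D (f_ n)) ->
  (forall n x, D x -> `|f_ n x| <= M) ->
  (forall x, D x -> f_ n x @[n --> \oo] --> f x) ->
  Rintegral mu D (f_ n) @[n --> \oo] --> Rintegral mu D f.
Proof.
move=> mf hM cf.
have bf := bmf_cvg mf hM cf.
have [|||||_ _ /= H] := @dominated_convergence _ _ _ mu D mD
  (fun n => EFin \o f_ n) (EFin \o f) (cst M%:E).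
- by move=> n; apply/measurable_EFinP; exact: mf.
- by apply/measurable_EFinP; exact: bf.1.
- by apply: aeW => x Dx; apply/cvg_EFin; [exact: nearW|exact: cf].
- exact: bmf_integrable (bmf_cst M).
- by apply: aeW => x n Dx /=; rewrite lee_fin hM.
apply: (fine_cvg (f := fun n => (\int[mu]_(x in D) (f_ n x)%:E)%E)).
rewrite /Rintegral fineK//; last first.
  by apply: integrable_fin_num => //; exact: bmf_integrable.
Qed.

Lemma Jint_cvg (f_ : nat -> T -> R) (f : T -> R) (M : R) :
  (forall n, measurable_fun D (f_ n)) ->
  (forall n x, D x -> `|f_ n x| <= M) ->
  (forall x, D x -> f_ n x @[n --> \oo] --> f x) ->
  Jint (f_ n) @[n --> \oo] --> Jint f.
Proof. by move=> mf hM cf; apply: cvgB; apply: Rintegral_cvg mf hM cf. Qed.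

Definition cbm (f : T -> R[i]) := bmf (fun x => cRe (f x)) /\ bmf (fun x => cIm (f x)).

Definition IC (f : T -> R[i]) : R[i] :=
  Complex (Jint (fun x => cRe (f x))) (Jint (fun x => cIm (f x))).

Lemma cbm_bound f : cbm f -> exists2 M, 0 <= M & forall x, D x -> nc (f x) <= M.
Proof.
move=> [[_ [M hM]] [_ [N hN]]]; exists (`|M| + `|N|) => [|x Dx]; first by rewrite addr_ge0.
rewrite (le_trans (nc_le _))// lerD//.
  by rewrite (le_trans (hM x Dx))// ler_norm.
by rewrite (le_trans (hN x Dx))// ler_norm.
Qed.

Lemma cbm_cst c : cbm (fun=> c).
Proof. by split; exact: bmf_cst. Qed.

Lemma cbmD f g : cbm f -> cbm g -> cbm (fun x => f x + g x).
Proof.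
move=> [f1 f2] [g1 g2]; split.
  by have := bmfD f1 g1; congr bmf; apply/funext => x; rewrite ReD.
by have := bmfD f2 g2; congr bmf; apply/funext => x; rewrite ImD.
Qed.

Lemma cbmM f g : cbm f -> cbm g -> cbm (fun x => f x * g x).
Proof.
move=> [f1 f2] [g1 g2]; split.
  have := bmfD (bmfM f1 g1) (bmfN (bmfM f2 g2)).
  by congr bmf; apply/funext => x; rewrite ReE.
have := bmfD (bmfM f1 g2) (bmfM f2 g1).
by congr bmf; apply/funext => x; rewrite ImE.
Qed.

Lemma cbmN f : cbm f -> cbm (fun x => - f x).
Proof.
move=> /(cbmM (cbm_cst (-1))); congr cbm; apply/funext => x; exact: mulN1r.
Qed.

Lemma cbmB f g : cbm f -> cbm g -> cbm (fun x => f x - g x).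
Proof. by move=> hf hg; apply: cbmD => //; exact: cbmN. Qed.

Lemma cbm_real f : bmf f -> cbm (fun x => (f x)%:C%C).
Proof. by move=> hf; split => //=; exact: bmf_cst. Qed.

Lemma cbm_conj f : cbm f -> cbm (fun x => (f x)^*%C).
Proof.
move=> [f1 f2]; split.
  by move: f1; congr bmf; apply/funext => x; case: (f x).
by have := bmfN f2; congr bmf; apply/funext => x; case: (f x).
Qed.

Lemma bmfV f c : 0 < c -> bmf f -> (forall x, D x -> c <= f x) -> bmf (fun x => (f x)^-1).
Proof.
move=> c0 [mf _] hc; split.
  (* Measurability is taken from the real power with exponent -1, which agrees with the inverse
     where [f] is nonnegative. *)
  apply: (eq_measurable_fun (fun x => f x `^ (-1))).
    move=> x /set_mem Dx; rewrite powR_inv1//.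
    by rewrite (le_trans (ltW c0))// hc.
  exact: (measurableT_comp (measurable_powR _) mf).
exists c^-1 => x Dx; have fx0 : 0 < f x by rewrite (lt_le_trans c0)// hc.
by rewrite gtr0_norm ?invr_gt0// lef_pV2 ?hc.
Qed.

Lemma cbmV f c : 0 < c -> cbm f -> (forall x, D x -> c <= nc (f x)) ->
  cbm (fun x => (f x)^-1).
Proof.
move=> c0 [f1 f2] hc.
have h : bmf (fun x => (sqmod (f x))^-1).
  apply: (@bmfV _ (c ^+ 2)) => //; first by rewrite exprn_gt0.
    by apply: bmfD; [have := bmfM f1 f1|have := bmfM f2 f2]; congr bmf;
      apply/funext => x; rewrite expr2.
  by move=> x Dx; rewrite -sqr_nc lerXn2r ?nnegrE ?nc_ge0 ?hc// ltW.
split.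
  by have := bmfM f1 h; congr bmf; apply/funext => x; rewrite Re_inv.
by have := bmfM (bmfN f2) h; congr bmf; apply/funext => x; rewrite Im_inv.
Qed.

Lemma cbm_sum (I : Type) (s : seq I) (P : pred I) (F : I -> T -> R[i]) :
  (forall i, P i -> cbm (F i)) -> cbm (fun x => \sum_(i <- s | P i) F i x).
Proof.
move=> h; elim: s => [|i s ih].
  have -> : (fun x => \sum_(i <- [::] | P i) F i x) = fun=> 0.
    by apply/funext => x; rewrite big_nil.
  exact: cbm_cst.
have -> : (fun x => \sum_(j <- (i :: s) | P j) F j x) =
    (fun x => (if P i then F i x else 0) + \sum_(j <- s | P j) F j x).
  by apply/funext => x; rewrite big_cons; case: ifPn; rewrite ?add0r.
by apply: cbmD => //; case: (P i) (h i) => [/(_ isT)//|_]; exact: cbm_cst.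
Qed.

Lemma cbm_prod (I : Type) (s : seq I) (P : pred I) (F : I -> T -> R[i]) :
  (forall i, P i -> cbm (F i)) -> cbm (fun x => \prod_(i <- s | P i) F i x).
Proof.
move=> h; elim: s => [|i s ih].
  have -> : (fun x => \prod_(i <- [::] | P i) F i x) = fun=> 1.
    by apply/funext => x; rewrite big_nil.
  exact: cbm_cst.
have -> : (fun x => \prod_(j <- (i :: s) | P j) F j x) =
    (fun x => (if P i then F i x else 1) * \prod_(j <- s | P j) F j x).
  by apply/funext => x; rewrite big_cons; case: ifPn; rewrite ?mul1r.
by apply: cbmM => //; case: (P i) (h i) => [/(_ isT)//|_]; exact: cbm_cst.
Qed.

Lemma ICD f g : cbm f -> cbm g -> IC (fun x => f x + g x) = IC f + IC g.
Proof.
move=> [f1 f2] [g1 g2]; rewrite /IC.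
have -> : (fun x => cRe (f x + g x)) = (fun x => cRe (f x) + cRe (g x)).
  by apply/funext => x; rewrite ReD.
have -> : (fun x => cIm (f x + g x)) = (fun x => cIm (f x) + cIm (g x)).
  by apply/funext => x; rewrite ImD.
by rewrite !JintD.
Qed.

Lemma ICZ c f : cbm f -> IC (fun x => c * f x) = c * IC f.
Proof.
move=> [f1 f2]; rewrite /IC.
have -> : (fun x => cRe (c * f x)) = (fun x => cRe c * cRe (f x) + (- cIm c) * cIm (f x)).
  by apply/funext => x; rewrite ReE mulNr.
have -> : (fun x => cIm (c * f x)) = (fun x => cRe c * cIm (f x) + cIm c * cRe (f x)).
  by apply/funext => x; rewrite ImE.
have h a g : bmf g -> bmf (fun x => a * g x) by move=> ?; apply: bmfM => //; exact: bmf_cst.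
rewrite !JintD ?JintZ//; try exact: h.
by apply: eq_ReIm; rewrite ?ReE ?ImE /= ?mulNr.
Qed.

Lemma ICN f : cbm f -> IC (fun x => - f x) = - IC f.
Proof.
move=> hf; rewrite -mulN1r -ICZ//; congr IC; apply/funext => x; by rewrite mulN1r.
Qed.

Lemma ICB f g : cbm f -> cbm g -> IC (fun x => f x - g x) = IC f - IC g.
Proof. by move=> hf hg; rewrite ICD ?ICN//; exact: cbmN. Qed.

Lemma eq_IC f g : (forall x, D x -> f x = g x) -> IC f = IC g.
Proof.
by move=> h; rewrite /IC; congr Complex; apply: eq_Jint => x Dx; rewrite h.
Qed.

Lemma eq_cbm f g : (forall x, D x -> f x = g x) -> cbm f -> cbm g.
Proof.
move=> h [[m1 [M1 h1]] [m2 [M2 h2]]]; split; split.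
- by apply: (eq_measurable_fun _ _ m1) => x /set_mem Dx; rewrite h.
- by exists M1 => x Dx; rewrite -h// h1.
- by apply: (eq_measurable_fun _ _ m2) => x /set_mem Dx; rewrite h.
- by exists M2 => x Dx; rewrite -h// h2.
Qed.

Lemma IC0 : IC (fun=> 0) = 0.
Proof.
have : IC (fun=> 0) = 0 * IC (fun=> 0).
  rewrite -ICZ; last exact: cbm_cst.
  by apply: eq_IC => x _; rewrite mul0r.
by rewrite mul0r.
Qed.

Lemma IC_sum (I : Type) (s : seq I) (P : pred I) (F : I -> T -> R[i]) :
  (forall i, P i -> cbm (F i)) ->
  IC (fun x => \sum_(i <- s | P i) F i x) = \sum_(i <- s | P i) IC (F i).
Proof.
move=> h; elim: s => [|i s ih].
  by rewrite big_nil -[RHS]IC0; apply: eq_IC => x _; rewrite big_nil.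
rewrite big_cons -ih; case: ifPn => Pi; last first.
  by apply: eq_IC => x _; rewrite big_cons (negbTE Pi).
rewrite -ICD; [|exact: h|exact: cbm_sum].
by apply: eq_IC => x _; rewrite big_cons Pi.
Qed.

Lemma IC_conj f : cbm f -> IC (fun x => (f x)^*%C) = (IC f)^*%C.
Proof.
move=> [f1 f2]; rewrite /IC /=; congr Complex.
  by apply: eq_Jint => x _; case: (f x).
by rewrite -JintN//; apply: eq_Jint => x _; case: (f x).
Qed.

(** Real and imaginary parts are bounded separately, whence the factor 2. *)
Lemma le_IC f M : cbm f -> (forall x, D x -> nc (f x) <= M) ->
  nc (IC f) <= M * mass *+ 2.
Proof.
move=> [f1 f2] hM; rewrite (le_trans (nc_le _))// mulr2n lerD//= le_Jint//.
  by move=> x Dx; rewrite (le_trans (le_Re_nc _))// hM.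
by move=> x Dx; rewrite (le_trans (le_Im_nc _))// hM.
Qed.

Lemma nc_cvg_Re (f_ : nat -> R[i]) l : nc (f_ n - l) @[n --> \oo] --> 0 ->
  cRe (f_ n) @[n --> \oo] --> cRe l.
Proof.
move=> h; apply/cvgrPdist_le => e e0.
have /cvgrPdist_le/(_ e e0) := h; apply: filterS => n; rewrite sub0r normrN => hn.
rewrite distrC -ReN -ReD (le_trans (le_Re_nc _))// (le_trans _ hn)//; exact: ler_norm.
Qed.

Lemma nc_cvg_Im (f_ : nat -> R[i]) l : nc (f_ n - l) @[n --> \oo] --> 0 ->
  cIm (f_ n) @[n --> \oo] --> cIm l.
Proof.
move=> h; apply/cvgrPdist_le => e e0.
have /cvgrPdist_le/(_ e e0) := h; apply: filterS => n; rewrite sub0r normrN => hn.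
rewrite distrC -ImN -ImD (le_trans (le_Im_nc _))// (le_trans _ hn)//; exact: ler_norm.
Qed.

(** Dominated convergence in the form used for kernels: zero moments survive bounded pointwise
    limits. Convergence is measured by the real modulus [nc], so no topology on [R[i]] is
    involved. *)
Lemma IC_lim0 (f_ : nat -> T -> R[i]) (f : T -> R[i]) (M : R) :
  (forall n, cbm (f_ n)) ->
  (forall n x, D x -> nc (f_ n x) <= M) ->
  (forall x, D x -> nc (f_ n x - f x) @[n --> \oo] --> 0) ->
  (forall n, IC (f_ n) = 0) -> cbm f /\ IC f = 0.
Proof.
move=> mf hM cf h0.
have m1 n : measurable_fun D (fun x => cRe (f_ n x)) by exact: (mf n).1.1.
have m2 n : measurable_fun D (fun x => cIm (f_ n x)) by exact: (mf n).2.1.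
have b1 n x : D x -> `|cRe (f_ n x)| <= M.
  by move=> Dx; rewrite (le_trans (le_Re_nc _))// hM.
have b2 n x : D x -> `|cIm (f_ n x)| <= M.
  by move=> Dx; rewrite (le_trans (le_Im_nc _))// hM.
have c1 x : D x -> cRe (f_ n x) @[n --> \oo] --> cRe (f x).
  by move=> Dx; apply: nc_cvg_Re; exact: cf.
have c2 x : D x -> cIm (f_ n x) @[n --> \oo] --> cIm (f x).
  by move=> Dx; apply: nc_cvg_Im; exact: cf.
split; first by split; [exact: bmf_cvg m1 b1 c1|exact: bmf_cvg m2 b2 c2].
rewrite /IC; have z1 n : Jint (fun x => cRe (f_ n x)) = 0 by have /(congr1 (@complex.Re R)) := h0 n.
have z2 n : Jint (fun x => cIm (f_ n x)) = 0 by have /(congr1 (@complex.Im R)) := h0 n.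
have k1 := Jint_cvg m1 b1 c1; have k2 := Jint_cvg m2 b2 c2.
rewrite (_ : (fun n => Jint _) = fun=> 0) in k1; last exact/funext.
rewrite (_ : (fun n => Jint _) = fun=> 0) in k2; last exact/funext.
apply: eq_ReIm => /=; [move: k1|move: k2] => /(cvg_lim (@Rhausdorff R)) <-;
  by rewrite lim_cst.
Qed.

End SignedIntegral.

(** * Complex derivatives on the disc *)

Section ComplexDerivative.
Variable R : realType.
Implicit Types (f g : R[i] -> R[i]) (z l : R[i]).

(** Complex differentiability phrased with the real-valued modulus, so that radii and errors are
    real numbers. *)
Definition has_cderiv f z l := forall e : R, 0 < e ->
  exists2 d : R, 0 < d & forall h, nc h < d -> nc (f (z + h) - f z - l * h) <= e * nc h.

Lemma has_cderivD f g z l m : has_cderiv f z l -> has_cderiv g z m ->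
  has_cderiv (fun x => f x + g x) z (l + m).
Proof.
move=> hf hg e e0.
have e2 : 0 < e / 2 by rewrite divr_gt0.
have [d d0 hd] := hf _ e2; have [d' d0' hd'] := hg _ e2.
exists (Num.min d d') => [|h]; first by rewrite lt_min d0.
rewrite lt_min => /andP[h1 h2].
have -> : f (z + h) + g (z + h) - (f z + g z) - (l + m) * h =
  (f (z + h) - f z - l * h) + (g (z + h) - g z - m * h) by ring.
rewrite (le_trans (ler_ncD _ _))// (le_trans (lerD (hd _ h1) (hd' _ h2)))//.
by rewrite -mulrDl -splitr.
Qed.

Lemma has_cderivZ f z l c : has_cderiv f z l -> has_cderiv (fun x => c * f x) z (c * l).
Proof.
move=> hf e e0.
have c1 : 0 < nc c + 1 by rewrite ltr_wpDl// nc_ge0.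
have [d d0 hd] := hf (e / (nc c + 1)) (divr_gt0 e0 c1).
exists d => // h /hd {}hd.
have -> : c * f (z + h) - c * f z - c * l * h = c * (f (z + h) - f z - l * h) by ring.
rewrite ncM (le_trans (ler_wpM2l (nc_ge0 _) hd))// mulrA ler_wpM2r ?nc_ge0//.
by rewrite mulrCA ler_piMr ?(ltW e0)// ler_pdivrMr// mul1r lerDl.
Qed.

Lemma has_cderivN f z l : has_cderiv f z l -> has_cderiv (fun x => - f x) z (- l).
Proof.
move=> hf e e0; have [d d0 hd] := hf e e0; exists d => // h /hd {}hd.
by rewrite (_ : _ - _ = - (f (z + h) - f z - l * h)) ?ncN//; ring.
Qed.

Lemma has_cderivB f g z l m : has_cderiv f z l -> has_cderiv g z m ->
  has_cderiv (fun x => f x - g x) z (l - m).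
Proof. by move=> hf hg; apply: has_cderivD => //; exact: has_cderivN. Qed.

Lemma has_cderiv_cst c z : has_cderiv (fun=> c) z 0.
Proof.
move=> e e0; exists 1 => // h _; rewrite subrr mul0r subr0 nc0 mulr_ge0 ?nc_ge0//.
exact: ltW.
Qed.

Lemma has_cderiv_quadratic f z l (C d : R) : 0 < d ->
  (forall h, nc h < d -> nc (f (z + h) - f z - l * h) <= C * nc h ^+ 2) ->
  has_cderiv f z l.
Proof.
move=> d0 hC e e0.
have C1 : 0 < `|C| + 1 by rewrite ltr_wpDl.
exists (Num.min d (e / (`|C| + 1))) => [|h]; first by rewrite lt_min d0 divr_gt0.
rewrite lt_min ltr_pdivlMr// => /andP[/hC h1 h2]; rewrite (le_trans h1)//.
rewrite expr2 mulrA ler_wpM2r ?nc_ge0// (le_trans _ (ltW h2))// mulrC.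
by rewrite ler_wpM2l ?nc_ge0// (le_trans (ler_norm _))// lerDl.
Qed.

Lemma derivative0_cst (u : R -> R) (x y : R) :
  (forall t e : R, 0 < e -> exists2 d : R, 0 < d &
    forall s, `|s - t| < d -> `|u s - u t| <= e * `|s - t|) ->
  u x = u y.
Proof.
move=> hu; apply: is_derive_0_is_cst => t.
have H : (fun h => h^-1 *: ((u \o shift t) (h *: (1 : R)) - u t)) @ (0 : R)^' --> (0 : R).
  apply/cvgrPdist_le => e e0; have [d d0 hd] := hu t e e0.
  exists d => //= h; rewrite sub0r normrN => hd' h0.
  rewrite /= sub0r normrN in hd'.
  rewrite normrZ normfV ler_pdivrMl ?normr_gt0// mulrC.
  by have := hd (h *: (1 : R) + t); rewrite addrK /GRing.scale/= mulr1; apply.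
by apply: DeriveDef; [apply: (cvgP _ H)|exact: (cvg_lim (@Rhausdorff R) H)].
Qed.

Let small (d b : R) : 0 < d -> 0 < b -> exists2 t : R, 0 < t & t < d /\ t < b.
Proof.
move=> d0 b0; have m0 : 0 < Num.min d b by rewrite lt_min d0.
exists (Num.min d b / 2); first by rewrite divr_gt0.
have : Num.min d b / 2 < Num.min d b by lra.
by move=> h; split; rewrite (lt_le_trans h)// ge_min lexx ?orbT.
Qed.

(** The increments [h = t] and [h = i t] have Re (l h) equal to t Re l and - t Im l, and both must
    be o(t). *)
Lemma has_cderiv_Re0 f z l (b : R) : 0 < b ->
  (forall h, nc h < b -> cRe (f (z + h)) = 0) -> has_cderiv f z l -> l = 0.
Proof.
move=> b0 hb hf.
have bnd e : 0 < e -> `|cRe l| <= e /\ `|cIm l| <= e.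
  move=> e0; have [d d0 hd] := hf e e0.
  have [t t0 [td tb]] := small d0 b0.
  have fz0 : cRe (f z) = 0 by have := hb 0; rewrite addr0 nc0; apply.
  have key h : nc h = t -> `|cRe (l * h)| <= e * t.
    move=> ht; have := hd h; rewrite ht => /(_ td); apply: le_trans.
    rewrite (le_trans _ (le_Re_nc _))// !(ReD, ReN) hb ?ht// fz0.
    by rewrite subrr add0r normrN.
  have nt : nc (t%:C%C) = t by rewrite nc_real gtr0_norm.
  split; rewrite -(ler_pM2r t0).
    have := key _ nt; rewrite ReE /= mulr0 subr0 normrM (gtr0_norm t0); exact.
  have ni : nc (Complex 0 t) = t.
    by rewrite ncE /= expr0n /= add0r sqrtr_sqr gtr0_norm.
  have := key _ ni; rewrite ReE /= mulr0 add0r normrN normrM (gtr0_norm t0); exact.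
have z0 (a : R) : (forall e, 0 < e -> `|a| <= e) -> a = 0.
  move=> h; apply/eqP; rewrite -normr_le0 leNgt; apply/negP => a0.
  have /h : 0 < `|a| / 2 by rewrite divr_gt0.
  by move: a0; lra.
by apply: eq_ReIm; apply: z0 => e /bnd [].
Qed.

Lemma Re0_cst f : (forall z, nc z < 1 -> exists l, has_cderiv f z l) ->
  (forall z, nc z < 1 -> cRe (f z) = 0) -> forall z, nc z < 1 -> f z = f 0.
Proof.
move=> hd hr z z1.
have d0 w : nc w < 1 -> has_cderiv f w 0.
  move=> w1; have [l hl] := hd w w1; rewrite -(@has_cderiv_Re0 f w l (1 - nc w))//.
    by rewrite subr_gt0.
  move=> h hw; apply: hr; rewrite (le_lt_trans (ler_ncD _ _))//.
  by rewrite addrC -ltrBrDr.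
apply: eq_ReIm; first by rewrite !hr// nc0.
(* [derivative0_cst] needs a function on the whole line; the clamp is 1-Lipschitz and keeps
   [z * cl t] on the segment from 0 to [z], inside the disc. *)
pose cl (t : R) := Num.max 0 (Num.min 1 t).
have clb t : 0 <= cl t <= 1.
  by rewrite /cl le_max lexx /= ge_max ler01 ge_min lexx.
have clL s t : `|cl s - cl t| <= `|s - t|.
  have maxL (a b : R) : `|Num.max 0 a - Num.max 0 b| <= `|a - b|.
    have h1 := ler_norm (a - b); have h2 := ler_norm (b - a); rewrite distrC in h2.
    by rewrite ler_norml; case: (lerP 0 a) => ?; case: (lerP 0 b) => ?; lra.
  have minL (a b : R) : `|Num.min 1 a - Num.min 1 b| <= `|a - b|.
    have h1 := ler_norm (a - b); have h2 := ler_norm (b - a); rewrite distrC in h2.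
    by rewrite ler_norml; case: (lerP 1 a) => ?; case: (lerP 1 b) => ?; lra.
  exact: le_trans (maxL _ _) (minL _ _).
have ncl t : nc (z * (cl t)%:C%C) < 1.
  rewrite ncM nc_real; have /andP[c0 c1] := clb t.
  by rewrite ger0_norm// (le_lt_trans _ z1)// ler_piMr ?nc_ge0.
suff: (fun t => cIm (f (z * (cl t)%:C%C))) 1 = (fun t => cIm (f (z * (cl t)%:C%C))) 0.
  rewrite /cl minxx min_r// maxxx max_r// mulr1 => ->.
  by rewrite mulr0.
apply: (@derivative0_cst (fun t => cIm (f (z * (cl t)%:C%C)))) => t e e0.
have [d dp hdd] := d0 _ (ncl t) e e0.
exists d => // s st.
have nh : nc (z * (cl s - cl t)%:C%C) <= `|s - t|.
  by rewrite ncM nc_real (le_trans _ (clL s t))// ler_piMl// ltW.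
have := hdd _ (le_lt_trans nh st).
rewrite mul0r subr0 -mulrDr -rmorphD addrCA subrr addr0 -ImN -ImD.
move=> h; rewrite (le_trans (le_Im_nc _))// (le_trans h)// ler_wpM2l//.
exact: ltW.
Qed.

End ComplexDerivative.

(** * The moments of an RP-measure *)

Section PoissonMoments.
Context d (T : measurableType d) (R : realType).
Variables (mu1 mu2 : {finite_measure set T -> \bar R}) (D : set T).
Hypothesis mD : measurable D.
Local Notation IC := (IC mu1 mu2 D).
Local Notation cbm := (cbm D).

Lemma has_cderiv_ext (f g : R[i] -> R[i]) z l : nc z < 1 ->
  (forall w, nc w < 1 -> f w = g w) -> has_cderiv f z l -> has_cderiv g z l.
Proof.
move=> z1 fg hf e e0; have [b b0 hb] := hf e e0.
exists (Num.min b (1 - nc z)) => [|h]; first by rewrite lt_min b0 subr_gt0.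
rewrite lt_min => /andP[/hb hh h1]; rewrite -!fg//.
by rewrite (le_lt_trans (ler_ncD _ _))// addrC -ltrBrDr.
Qed.

Section OneVariable.
Variable zeta : T -> R[i].
Hypothesis czeta : cbm zeta.
Hypothesis uzeta : forall x, D x -> nc (zeta x) = 1.

Lemma ker_lower z x : D x -> 1 - nc z <= nc (zeta x - z).
Proof. by move=> Dx; rewrite -(uzeta Dx) ler_nc_dist. Qed.

Lemma ker_neq0 z x : nc z < 1 -> D x -> zeta x - z != 0.
Proof.
move=> z1 Dx; rewrite -nc_gt0 (lt_le_trans _ (ker_lower z Dx))//.
by rewrite subr_gt0.
Qed.

Lemma cbm_ker z : nc z < 1 -> cbm (fun x => (zeta x - z)^-1).
Proof.
move=> z1; apply: (@cbmV _ _ _ _ _ (1 - nc z)); first by rewrite subr_gt0.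
  by apply: cbmB => //; exact: cbm_cst.
by move=> x Dx; exact: ker_lower.
Qed.

(** The remainder is exactly h^2 times the integral of k / ((zeta - z - h) (zeta - z)^2), and this
    integrand is bounded uniformly for |h| < (1 - |z|) / 2. *)
Lemma has_cderiv_ker (k : T -> R[i]) z : cbm k -> nc z < 1 ->
  has_cderiv (fun z => IC (fun x => k x * (zeta x - z)^-1)) z
    (IC (fun x => k x * (zeta x - z)^-1 ^+ 2)).
Proof.
move=> ck z1; have [M M0 hM] := cbm_bound ck.
pose b := 1 - nc z; have b0 : 0 < b by rewrite subr_gt0.
have b2 : 0 < b / 2 by rewrite divr_gt0.
apply: (@has_cderiv_quadratic _ _ _ _ (M * ((b / 2)^-1 * b^-1 ^+ 2) * mass mu1 mu2 D *+ 2) (b / 2)) => //.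
move=> h hb; have zh1 : nc (z + h) < 1.
  rewrite (le_lt_trans (ler_ncD _ _))//; move: hb b0; rewrite /b; lra.
have c1 := cbm_ker z1; have c2 := cbm_ker zh1.
have c12 : cbm (fun x => k x * (zeta x - z)^-1 ^+ 2) by do 2 apply: cbmM => //.
have -> : IC (fun x => k x * (zeta x - (z + h))^-1) - IC (fun x => k x * (zeta x - z)^-1)
   - IC (fun x => k x * (zeta x - z)^-1 ^+ 2) * h =
   h ^+ 2 * IC (fun x => k x * ((zeta x - (z + h))^-1 * (zeta x - z)^-1 ^+ 2)).
  rewrite [_ * h]mulrC -!ICZ//; last by do 3 apply: cbmM => //.
  rewrite -!ICB//; try by repeat (apply: cbmM => //; try exact: cbm_cst).
    apply: eq_IC => x Dx.
    have n1 := ker_neq0 z1 Dx; have n2 := ker_neq0 zh1 Dx.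
    by field; rewrite n2 n1.
  by apply: cbmB; repeat (apply: cbmM => //; try exact: cbm_cst).
rewrite ncM ncX mulrC ler_wpM2r ?exprn_ge0 ?nc_ge0//.
apply: le_IC => //; first by do 3 apply: cbmM => //.
move=> x Dx; rewrite !ncM; apply: ler_pM => //; rewrite ?mulr_ge0 ?nc_ge0 ?hM//.
have l1 : b <= nc (zeta x - z) by exact: ker_lower.
have l2 : b / 2 <= nc (zeta x - (z + h)).
  apply: le_trans (ker_lower _ Dx); move: (ler_ncD z h) hb; rewrite /b; lra.
rewrite !ncV !expr2.
have i1 : (nc (zeta x - z))^-1 <= b^-1 by rewrite lef_pV2 ?posrE// (lt_le_trans b0).
have i2 : (nc (zeta x - (z + h)))^-1 <= (b / 2)^-1.
  by rewrite lef_pV2 ?posrE// (lt_le_trans b2).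
by apply: ler_pM => //; rewrite ?mulr_ge0 ?invr_ge0 ?nc_ge0//; apply: ler_pM => //;
  rewrite ?invr_ge0 ?nc_ge0.
Qed.

(** Since z / (zeta - z) = zeta / (zeta - z) - 1, this is [has_cderiv_ker] for the weight k zeta, up
    to a constant. *)
Lemma has_cderiv_moebius (k : T -> R[i]) z : cbm k -> nc z < 1 ->
  exists l, has_cderiv (fun z => IC (fun x => k x * (z / (zeta x - z)))) z l.
Proof.
move=> ck z1; exists (IC (fun x => k x * zeta x * (zeta x - z)^-1 ^+ 2) - 0).
apply: (@has_cderiv_ext
   (fun z => IC (fun x => k x * zeta x * (zeta x - z)^-1) - IC k)) => //.
  move=> w w1; rewrite -ICB//; last by repeat apply: cbmM => //; exact: cbm_ker.
  apply: eq_IC => x Dx; have n1 := ker_neq0 w1 Dx.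
  by field.
apply: has_cderivB; last exact: has_cderiv_cst.
by apply: has_cderiv_ker => //; exact: cbmM.
Qed.

Definition poisson1 (z : R[i]) (x : T) : R :=
  (1 - sqmod z) / ((cRe (zeta x) - cRe z) ^+ 2 + (cIm (zeta x) - cIm z) ^+ 2).

(** The Poisson kernel is the real part of (zeta + z) / (zeta - z) = 1 + 2 z / (zeta - z). *)
Lemma poisson1E z x : nc z < 1 -> D x ->
  (poisson1 z x)%:C%C = 1 + z / (zeta x - z) + (z / (zeta x - z))^*%C.
Proof.
move=> z1 Dx; have := ker_neq0 z1 Dx; have := uzeta Dx; rewrite /poisson1.
case: (zeta x) => a b; case: z z1 => u v _ h1 h2.
have h3 : a ^+ 2 + b ^+ 2 = 1 by have := sqr_nc (Complex a b); rewrite h1 expr1n /sqmod /=.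
have h4 : (a - u) ^+ 2 + (b - v) ^+ 2 != 0.
  have := h2; rewrite -nc_eq0 -sqrf_eq0 sqr_nc /sqmod /=; exact.
rewrite /sqmod /=.
apply: eq_ReIm; rewrite ?(ReD, ImD) /=; last by field.
have -> : 1 - (u ^+ 2 + v ^+ 2) = a ^+ 2 + b ^+ 2 - (u ^+ 2 + v ^+ 2) by rewrite h3.
by field.
Qed.

End OneVariable.

Section TwoVariables.
Variables (zeta1 zeta2 : T -> R[i]).
Hypothesis czeta1 : cbm zeta1.
Hypothesis czeta2 : cbm zeta2.
Hypothesis uzeta1 : forall x, D x -> nc (zeta1 x) = 1.
Hypothesis uzeta2 : forall x, D x -> nc (zeta2 x) = 1.

(* Fix w. The functions g(., w) and [IC ((zeta1 + .) / (zeta1 - .) * P_w(zeta2))] have the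
   same real part, so they differ by a constant; hence the moment Q is holomorphic in w
   as well as antiholomorphic, so it is constant, and Q vanishes at w = 0. *)
Lemma pluriharmonic_moment (g : R[i] -> R[i] -> R[i]) :
  (forall z w, nc z < 1 -> nc w < 1 -> exists l, has_cderiv (g ^~ w) z l) ->
  (forall z w, nc z < 1 -> nc w < 1 -> exists l, has_cderiv (g z) w l) ->
  (forall z w, nc z < 1 -> nc w < 1 ->
    cRe (g z w) = Jint mu1 mu2 D (fun x => poisson1 zeta1 z x * poisson1 zeta2 w x)) ->
  forall z w, nc z < 1 -> nc w < 1 ->
    IC (fun x => z / (zeta1 x - z) * (w / (zeta2 x - w))^*%C) = 0.
Proof.
move=> hg1 hg2 hRe z w z1 w1.
pose E z x := z / (zeta1 x - z); pose F w x := w / (zeta2 x - w).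
pose p w x := (poisson1 zeta2 w x)%:C%C.
have nz0 : nc (0 : R[i]) < 1 by rewrite nc0.
have cE v : nc v < 1 -> cbm (E v).
  by move=> v1; apply: cbmM; [exact: cbm_cst|exact: cbm_ker].
have cF v : nc v < 1 -> cbm (F v).
  by move=> v1; apply: cbmM; [exact: cbm_cst|exact: cbm_ker].
have pE v x : nc v < 1 -> D x -> p v x = 1 + F v x + (F v x)^*%C.
  by move=> v1 Dx; rewrite /p poisson1E.
have cp v : nc v < 1 -> cbm (p v).
  move=> v1; apply: (@eq_cbm _ _ _ _ (fun x => 1 + F v x + (F v x)^*%C)).
    by move=> x Dx; rewrite pE.
  apply: cbmD; last by apply: cbm_conj; exact: cF.
  by apply: cbmD; [exact: cbm_cst|exact: cF].
have stepa v u : nc v < 1 -> nc u < 1 ->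
    g u v - g 0 v = 2 * IC (fun x => p v x * E u x).
  move=> v1 u1.
  have cpE t : nc t < 1 -> cbm (fun x => p v x * E t x).
    by move=> t1; apply: cbmM; [exact: cp|exact: cE].
  pose f t := g t v - (IC (p v) + 2 * IC (fun x => p v x * E t x)).
  have IE0 : IC (fun x => p v x * E 0 x) = 0.
    by rewrite -[RHS](IC0 mu1 mu2 mD); apply: eq_IC => x _; rewrite /E mul0r mulr0.
  suff : f u = f 0.
    by rewrite /f IE0 mulr0 addr0 opprD addrA => /(congr1 (fun q => q - g 0 v
      + (IC (p v) + 2 * IC (fun x => p v x * E u x)))) h;
      apply: etrans (etrans h _); ring.
  apply: (@Re0_cst _ f) => // t t1.
    have [l hl] := hg1 t v t1 v1.
    have [m hm] := has_cderiv_moebius czeta1 uzeta1 (cp _ v1) t1.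
    exists (l - (0 + 2 * m)); apply: has_cderivB => //.
    by apply: has_cderivD; [exact: has_cderiv_cst|exact: has_cderivZ].
  rewrite /f -ICZ//; last exact: cpE.
  rewrite -ICD//; [|exact: cp|apply: cbmM; [exact: cbm_cst|exact: cpE]].
  rewrite ReD ReN hRe// /IC /=; apply/eqP; rewrite subr_eq0; apply/eqP.
  apply: eq_Jint => x Dx; have := poisson1E uzeta1 t1 Dx.
  move=> /(congr1 (fun q => cRe (p v x * q))).
  rewrite ![in LHS]ReE /p /= mul0r subr0 mulrC => ->.
  rewrite -/(E t x); case: (E t x) => a b.
  by rewrite !(ReD, ReE, ImE) /=; ring.
pose Q v := IC (fun x => E z x * (F v x)^*%C).
have cQ v : nc v < 1 -> cbm (fun x => E z x * (F v x)^*%C).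
  by move=> v1; apply: cbmM; [exact: cE|apply: cbm_conj; exact: cF].
(* Inserting p = 1 + F + conj F into [stepa] isolates [Q]; all other terms on the right are
   holomorphic in [v]. *)
have QE v : nc v < 1 -> Q v = 2^-1 * (g z v - g 0 v) - (IC (E z) + IC (fun x => E z x * F v x)).
  move=> v1; rewrite stepa// mulKf ?pnatr_eq0//.
  have c1 := cE _ z1; have c2 : cbm (fun x => E z x * F v x) by apply: cbmM => //; exact: cF.
  rewrite -ICD// -ICB//; last by apply: cbmD.
    by apply: eq_IC => x Dx; rewrite pE//; ring.
  by apply: cbmM => //; exact: cp.
have dQ v : nc v < 1 -> exists l, has_cderiv Q v l.
  move=> v1.
  have [l1 hl1] := hg2 z v z1 v1; have [l2 hl2] := hg2 0 v nz0 v1.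
  have [m hm] := has_cderiv_moebius czeta2 uzeta2 (cE _ z1) v1.
  exists (2^-1 * (l1 - l2) - (0 + m)).
  apply: (has_cderiv_ext v1 (fun u u1 => esym (QE u u1))).
  apply: has_cderivB; first by apply: has_cderivZ; exact: has_cderivB.
  by apply: has_cderivD => //; exact: has_cderiv_cst.
(* The conjugate of [Q v] is the integral of conj E times F v, a moment of the type treated in
   [has_cderiv_moebius]. *)
have dQ' v : nc v < 1 -> exists l, has_cderiv (fun v => (Q v)^*%C) v l.
  move=> v1; have cc : cbm (fun x => (E z x)^*%C) by apply: cbm_conj; exact: cE.
  have [m hm] := has_cderiv_moebius czeta2 uzeta2 cc v1.
  exists m; apply: (has_cderiv_ext v1 _ hm) => u u1.
  rewrite /Q -IC_conj//; last exact: cQ.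
  apply: eq_IC => x Dx; rewrite -/(F u x).
  by case: (E z x) => a b; case: (F u x) => e f; apply: eq_ReIm; rewrite /=; ring.
have Q0 : Q 0 = 0.
  rewrite -[RHS](IC0 mu1 mu2 mD); apply: eq_IC => x _; rewrite /F mul0r.
  by apply: eq_ReIm; rewrite ?(ReE, ImE) /=; ring.
(* Both i (Q + conj Q) and Q - conj Q are holomorphic with zero real part, hence constant, and they
   vanish at 0; together they give Q = 0. *)
have hA : 'i%C * (Q w + (Q w)^*%C) = 0.
  have := @Re0_cst _ (fun v => 'i%C * (Q v + (Q v)^*%C)) _ _ w w1.
  rewrite Q0 (_ : 'i%C * (0 + _) = 0); last by apply: eq_ReIm; rewrite /=; ring.
  apply => v v1; last by case: (Q v) => a b; rewrite /=; ring.
  have [l hl] := dQ v v1; have [m hm] := dQ' v v1.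
  by exists ('i%C * (l + m)); apply: has_cderivZ; exact: has_cderivD.
have hB : Q w - (Q w)^*%C = 0.
  have := @Re0_cst _ (fun v => Q v - (Q v)^*%C) _ _ w w1.
  rewrite Q0 (_ : 0 - _ = 0); last by apply: eq_ReIm; rewrite /=; ring.
  apply => v v1; last by case: (Q v) => a b; rewrite /=; ring.
  have [l hl] := dQ v v1; have [m hm] := dQ' v v1.
  by exists (l - m); exact: has_cderivB.
rewrite -/(Q w); move: hA hB; case: (Q w) => a b [h1 h2] [h3 h4].
by apply: eq_ReIm => /=; [move: h1 h2|move: h3 h4]; rewrite /=; lra.
Qed.

(** The moment of [pluriharmonic_moment] contains the constant factor z conj w; dividing it out is
    what excludes the origin. *)
Lemma kernel_moment (g : R[i] -> R[i] -> R[i]) :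
  (forall z w, nc z < 1 -> nc w < 1 -> exists l, has_cderiv (g ^~ w) z l) ->
  (forall z w, nc z < 1 -> nc w < 1 -> exists l, has_cderiv (g z) w l) ->
  (forall z w, nc z < 1 -> nc w < 1 ->
    cRe (g z w) = Jint mu1 mu2 D (fun x => poisson1 zeta1 z x * poisson1 zeta2 w x)) ->
  forall z w, 0 < nc z < 1 -> 0 < nc w < 1 ->
    IC (fun x => (zeta1 x - z)^-1 * ((zeta2 x - w)^-1)^*%C) = 0.
Proof.
move=> h1 h2 h3 z w /andP[z0 z1] /andP[w0 w1].
have := pluriharmonic_moment h1 h2 h3 z1 w1.
have c : cbm (fun x => (zeta1 x - z)^-1 * ((zeta2 x - w)^-1)^*%C).
  by apply: cbmM; [|apply: cbm_conj]; exact: cbm_ker.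
have -> : IC (fun x => z / (zeta1 x - z) * (w / (zeta2 x - w))^*%C) =
  (z * w^*%C) * IC (fun x => (zeta1 x - z)^-1 * ((zeta2 x - w)^-1)^*%C).
  rewrite -ICZ//; apply: eq_IC => x _.
  rewrite -!mulrA; congr (z * _); rewrite mulrCA; congr (_ * _).
  by case: w {w0 w1 c} => ? ?; case: (zeta2 x - _)^-1 => ? ?; apply: eq_ReIm; rewrite /=; ring.
have zw : z * w^*%C != 0 by rewrite -nc_gt0 ncM nc_conj mulr_gt0.
by move=> /eqP; rewrite mulf_eq0 (negbTE zw) => /eqP.
Qed.

End TwoVariables.
End PoissonMoments.

(** * The torus coordinates and the vanishing moments of an RP-measure *)

Section Torus.
Variable R : realType.
Local Notation X := (R4 R).

Definition zc1 (p : X) : R[i] := Complex p.1.1 p.1.2.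
Definition zc2 (p : X) : R[i] := Complex p.2.1 p.2.2.

Lemma measurable_c11 (E : set X) : measurable_fun E (fun p : X => p.1.1).
Proof. exact: measurable_funS (measurableT_comp measurable_fst measurable_fst). Qed.
Lemma measurable_c12 (E : set X) : measurable_fun E (fun p : X => p.1.2).
Proof. exact: measurable_funS (measurableT_comp measurable_snd measurable_fst). Qed.
Lemma measurable_c21 (E : set X) : measurable_fun E (fun p : X => p.2.1).
Proof. exact: measurable_funS (measurableT_comp measurable_fst measurable_snd). Qed.
Lemma measurable_c22 (E : set X) : measurable_fun E (fun p : X => p.2.2).
Proof. exact: measurable_funS (measurableT_comp measurable_snd measurable_snd). Qed.

Lemma measurable_torus2 : measurable (@torus2 R).
Proof.
have sq (f : X -> R) : measurable_fun setT f -> measurable_fun setT (fun p => f p ^+ 2).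
  by move=> mf; apply: measurable_funX.
have h (f g : X -> R) : measurable_fun setT f -> measurable_fun setT g ->
    measurable [set p | f p ^+ 2 + g p ^+ 2 = 1].
  move=> mf mg; have mh : measurable_fun setT (fun p => f p ^+ 2 + g p ^+ 2).
    by apply: measurable_funD; exact: sq.
  by rewrite -[X in measurable X]setTI; apply: (mh measurableT [set 1]); exact: measurable_set1.
by apply: measurableI; apply: h; [exact: measurable_c11|exact: measurable_c12|
  exact: measurable_c21|exact: measurable_c22].
Qed.

Lemma zc1_unit p : torus2 p -> nc (zc1 p) = 1.
Proof. by case=> h _; rewrite ncE /= h sqrtr1. Qed.
Lemma zc2_unit p : torus2 p -> nc (zc2 p) = 1.
Proof. by case=> _ h; rewrite ncE /= h sqrtr1. Qed.

Lemma cbm_unit (f : X -> R[i]) : measurable_fun torus2 (fun p => cRe (f p)) ->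
  measurable_fun torus2 (fun p => cIm (f p)) -> (forall p, torus2 p -> nc (f p) = 1) ->
  cbm torus2 f.
Proof.
move=> m1 m2 h; split; split=> //; exists 1 => p /h <-; [exact: le_Re_nc|exact: le_Im_nc].
Qed.

Lemma cbm_zc1 : cbm torus2 zc1.
Proof.
by apply: cbm_unit; [exact: measurable_c11|exact: measurable_c12|exact: zc1_unit].
Qed.
Lemma cbm_zc2 : cbm torus2 zc2.
Proof.
by apply: cbm_unit; [exact: measurable_c21|exact: measurable_c22|exact: zc2_unit].
Qed.

Lemma nc_lt1 (z : R[i]) : (nc z < 1) = (sqmod z < 1).
Proof. by rewrite -sqr_nc expr_lt1// nc_ge0. Qed.

(** Bridge from Frechet differentiability, whose norms take values in [R[i]], to the estimates of
    [has_cderiv]; the directions (1, 0) and (0, 1) will give holomorphy in each variable. *)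
Lemma differentiable_dir (g : R[i]^o * R[i]^o -> R[i]^o) (x v : R[i]^o * R[i]^o) :
  differentiable g x -> `|v| <= 1 ->
  forall e : R, 0 < e -> exists2 d : R, 0 < d & forall t : R[i], nc t < d ->
    nc (g (x + t *: v) - g x - ('d g x v : R[i]) * t) <= e * nc t.
Proof.
move=> dg v1 e e0.
have lin t : 'd g x (t *: v) = t *: 'd g x v by rewrite linearZ.
have [_ /eqaddoP H] := (diff_locallyP x g).1 dg.
have e0' : (0 : R[i]) < e%:C%C by rewrite ltcR.
have /nbhs_ballP [r /= r0 hr] := H _ e0'.
(* The radius is an element of [R[i]]; being positive it has zero imaginary part. *)
have rr : r = (cRe r)%:C%C by move: r0; case: (r) => a b; rewrite ltcE /= => /andP[/eqP -> _].
have r0' : 0 < cRe r by move: r0; rewrite rr ltcR.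
exists (cRe r) => // t tr.
have nt : `|t *: v| <= (nc t)%:C%C.
  by rewrite normrZ -normC_nc ler_piMr.
have bt : ball (0 : R[i]^o * R[i]^o) r (t *: v).
  rewrite -ball_normE /ball_ /= sub0r normrN (le_lt_trans nt)//.
  by rewrite rr ltcR.
have := hr _ bt; rewrite /= normC_nc => /le_trans/(_ (ler_wpM2l (ltW e0') nt)).
rewrite -rmorphM lecR; apply: le_trans.
rewrite le_eqVlt; apply/orP; left; apply/eqP; congr nc.
rewrite !fctE /= lin.
by rewrite (addrC (t *: v)) opprD addrA; congr (_ - _); exact: mulrC.
Qed.

Lemma RP_kernel_moment (mu1 mu2 : {finite_measure set X -> \bar R}) :
  RP mu1 mu2 -> forall z w, 0 < nc z < 1 -> 0 < nc w < 1 ->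
  IC mu1 mu2 torus2 (fun p => (zc1 p - z)^-1 * ((zc2 p - w)^-1)^*%C) = 0.
Proof.
move=> [g [hg hRe]]; apply: (kernel_moment measurable_torus2 cbm_zc1 cbm_zc2
  zc1_unit zc2_unit (g := fun z w => g (z, w))).
- move=> z w z1 w1; pose x : R[i]^o * R[i]^o := (z, w).
  have dg : differentiable g x by apply: hg; split; rewrite /= -nc_lt1.
  have v1 : `|((1, 0) : R[i]^o * R[i]^o)| <= 1.
    by rewrite prod_normE /= normr1 normr0 max_l ?ler01.
  exists ('d g x (1, 0)) => e e0.
  have [d d0 hd] := differentiable_dir dg v1 e0; exists d => // h /hd.
  have -> : ((z, w) : R[i]^o * R[i]^o) + h *: ((1, 0) : R[i]^o * R[i]^o) = (z + h, w).
    by rewrite -[LHS]/(z + h * 1, w + h * 0) mulr1 mulr0 addr0.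
  exact.
- move=> z w z1 w1; pose x : R[i]^o * R[i]^o := (z, w).
  have dg : differentiable g x by apply: hg; split; rewrite /= -nc_lt1.
  have v1 : `|((0, 1) : R[i]^o * R[i]^o)| <= 1.
    by rewrite prod_normE /= normr1 normr0 max_r ?ler01.
  exists ('d g x (0, 1)) => e e0.
  have [d d0 hd] := differentiable_dir dg v1 e0; exists d => // h /hd.
  have -> : ((z, w) : R[i]^o * R[i]^o) + h *: ((0, 1) : R[i]^o * R[i]^o) = (z, w + h).
    by rewrite -[LHS]/(z + h * 0, w + h * 1) mulr1 mulr0 addr0.
  exact.
- move=> z w z1 w1; rewrite hRe; last by split; rewrite /= -nc_lt1.
  (* By conversion, [poisson_kernel] is the product of the two [poisson1] factors and [poisson_int]
     is [Jint]. *)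
  by [].
Qed.

End Torus.

(** * Regularity of finite measures on the line *)

Section Regularity.
Variable R : realType.
Variable m : {measure set R -> \bar R}.
Hypothesis mfin : (m setT < +oo)%E.

Let small_tail (B : nat -> set R) (e : \bar R) : (forall n, measurable (B n)) ->
  nonincreasing_seq B -> (m (\bigcap_n B n) < e)%E -> exists n, (m (B n) < e)%E.
Proof.
move=> mB nB he.
have := @nonincreasing_cvg_mu _ _ _ m B _ mB (bigcapT_measurable mB) nB.
have B0 : (m (B 0%N) < +oo)%E by apply: le_lt_trans mfin; apply: le_measure; rewrite ?inE.
move=> /(_ B0) H.
have [N _ /(_ N (leqnn _)) hN] := H _ (open_nbhs_nbhs (conj (@open_ereal_lt_ereal R e) he)).
by exists N.
Qed.

Definition regular_set (A : set R) := measurable A /\ forall e : R, 0 < e ->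
  exists F U : set R, [/\ closed F, open U, F `<=` A, A `<=` U & (m (U `\` F) < e%:E)%E].

Let regular_open_itv (x y : R) : regular_set `]x, y[%classic.
Proof.
split=> // e e0.
pose F n := `[x + n.+1%:R^-1, y - n.+1%:R^-1]%classic : set R.
have [|||n hn] := @small_tail (fun n => `]x, y[%classic `\` F n) e%:E.
- by move=> n; apply: measurableD; exact: measurable_itv.
- move=> n k nk; apply/subsetPset; apply: setDS => t; rewrite /F /= !in_itv/=.
  have : (k.+1%:R^-1 : R) <= n.+1%:R^-1 by rewrite lef_pV2 ?posrE// ler_nat ltnS.
  move: (n.+1%:R^-1) (k.+1%:R^-1) => a b ab /andP[? ?]; apply/andP; split; lra.
- rewrite (_ : \bigcap_n _ = set0) ?measure0 ?lte_fin//.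
  apply/seteqP; split => // t /= ht.
  have [] := ht 0%N I; rewrite /= in_itv/= => /andP[xt ty] _.
  have d0 : 0 < Num.min (t - x) (y - t) by rewrite lt_min !subr_gt0 xt.
  have [k _ hk] := near_infty_natSinv_lt (PosNum d0).
  have := hk k (leqnn k); rewrite /= lt_min => /andP[h1 h2].
  have [_] := ht k I; apply; rewrite /F /= in_itv/=.
  by move: h1 h2; move: (k.+1%:R^-1) => a h1 h2; apply/andP; split; lra.
- exists (F n), `]x, y[%classic; split => //.
  + exact: interval_closed.
  + move=> t; rewrite /F /= !in_itv/=; have : 0 < (n.+1%:R^-1 : R) by rewrite invr_gt0.
    by move: (n.+1%:R^-1) => a a0 /andP[? ?]; apply/andP; split; lra.
Qed.

(** The regular sets form a sigma-algebra that contains the open intervals, and these generate the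
    Borel sets. *)
Lemma regular_measurable (A : set R) : measurable A -> regular_set A.
Proof.
move=> mA; have : (@RGenOpens.G R).-sigma.-measurable A by rewrite -RGenOpens.measurableE.
move: A {mA}; apply: smallest_sub; last first.
  by move=> _ [x [y ->]]; exact: regular_open_itv.
split.
- split=> // e e0; exists set0, set0; split => //; try exact: closed0.
  by rewrite setD0 measure0 lte_fin.
- move=> B [mB hB]; rewrite setTD; split; first exact: measurableC.
  move=> e /hB [F [U [cF oU FB BU UF]]]; exists (~` U), (~` F); split.
  + exact: open_closedC.
  + exact: closed_openC.
  + exact: subsetC.
  + exact: subsetC.
  + by rewrite setDE setCK setIC -setDE.
- move=> B hB; split; first by apply: bigcupT_measurable => i; exact: (hB i).1.
  move=> e e0.
  have e2 : 0 < e / 2 by rewrite divr_gt0.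
  have /choice [F] : forall n, exists F : set R, exists U : set R,
      [/\ closed F, open U, F `<=` B n, B n `<=` U & (m (U `\` F) <= (e / 2 / (2 ^ n.+1)%:R)%:E)%E].
    move=> n; have [|F [U [cF oU FB BU UF]]] := (hB n).2 (e / 2 / (2 ^ n.+1)%:R).
      by rewrite divr_gt0// ltr0n expn_gt0.
    by exists F, U; split => //; exact: ltW.
  move=> /choice [U hFU].
  have mF n : measurable (F n) by apply: closed_measurable; have [] := hFU n.
  have mU n : measurable (U n) by apply: open_measurable; have [] := hFU n.
  pose V := \bigcup_n U n.
  have mV : measurable V by apply: bigcupT_measurable.
  (* The union of all [F n] need not be closed. Since [m] is finite, continuity from above along
     this decreasing sequence shows that finitely many of them suffice. *)
  have h1 : (m (\bigcap_n (V `\` \big[setU/set0]_(i < n) F i)) < e%:E)%E.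
    apply: (@le_lt_trans _ _ (m (\bigcup_n (U n `\` F n)))).
      apply: le_measure; rewrite ?inE.
      - by apply: bigcapT_measurable => n; apply: measurableD => //; exact: bigsetU_measurable.
      - by apply: bigcupT_measurable => n; exact: measurableD.
      - move=> t ht; have [[n _ Unt] _] := ht 0%N I.
        exists n => //; split=> // Fnt; have [_] := ht n.+1 I; apply.
        by rewrite big_ord_recr /=; right.
    apply: (@le_lt_trans _ _ (\sum_(n <oo) m (U n `\` F n))%E).
      apply: measure_sigma_subadditive => //.
      - by move=> n; exact: measurableD.
      - by apply: bigcupT_measurable => n; exact: measurableD.
    apply: (@le_lt_trans _ _ (\sum_(n <oo) (0 + (e / 2 / (2 ^ n.+1)%:R)%:E))%E).
      by apply: lee_nneseries => // n _; rewrite add0e; have [] := hFU n.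
    apply: (le_lt_trans (epsilon_trick xpredT (fun=> lexx _) (ltW e2))).
    rewrite eseries0// add0e lte_fin; lra.
  have [|n k nk|n hn] := small_tail _ _ h1.
  + by move=> n; apply: measurableD => //; exact: bigsetU_measurable.
  + apply/subsetPset; apply: setDS => t; rewrite -!bigcup_mkord => -[i /= ik Fi].
    by exists i => //=; exact: leq_trans ik nk.
  + exists (\big[setU/set0]_(i < n) F i), V; split => //.
    * by apply: closed_bigsetU => i _; have [] := hFU i.
    * by apply: bigcup_open => i _; have [] := hFU i.
    * by rewrite -bigcup_mkord => t [i _ Fi]; exists i => //; have [_ _ + _ _] := hFU i; apply.
    * by move=> t [i _ Bi]; exists i => //; have [_ _ _ + _] := hFU i; apply.
Qed.

End Regularity.

(** The image measure of [mu] under [X] is a finite Borel measure on the line, so regularity on the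
    line suffices for an abstract space [T]. *)
Lemma regular_preimage d (T : measurableType d) (R : realType)
    (mu : {finite_measure set T -> \bar R}) (X : T -> R) (A : set R) (e : R) :
  measurable_fun setT X -> measurable A -> 0 < e ->
  exists F : set R, [/\ closed F, F `<=` A & (mu (X @^-1` (A `\` F)) < e%:E)%E].
Proof.
move=> mX mA e0.
have mp (B : set R) : measurable B -> measurable (X @^-1` B).
  by move=> mB; rewrite -[X in measurable X]setTI; exact: mX.
pose m0 (B : set R) := mu (X @^-1` B).
have h0 : m0 set0 = 0%E by rewrite /m0 preimage_set0 measure0.
have hge B : (0 <= m0 B)%E by exact: measure_ge0.
have hs : semi_sigma_additive m0.
  move=> F mF tF mUF; rewrite /m0 preimage_bigcup.
  apply: measure_semi_sigma_additive.
  - by move=> n; exact: mp.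
  - apply/trivIsetP => /= i j _ _ ij; rewrite -preimage_setI.
    by move/trivIsetP : tF => /(_ _ _ _ _ ij) ->//; rewrite preimage_set0.
  - by rewrite -preimage_bigcup; exact: mp.
pose pm := isMeasure.Build _ _ R m0 h0 hge hs.
pose m : {measure set R -> \bar R} := HB.pack m0 pm.
have mfin : (m setT < +oo)%E by rewrite /= /m0 preimage_setT ltey_eq fin_num_measure.
have [_ /(_ e e0) [F [U [cF oU FA AU UF]]]] := regular_measurable mfin mA.
exists F; split => //; apply: le_lt_trans UF.
apply: (le_measure m); rewrite ?inE.
- by apply: measurableD => //; exact: closed_measurable.
- by apply: measurableD; [exact: open_measurable|exact: closed_measurable].
- exact: setSD.
Qed.

(** * Points with infinite derivative of a monotone function *)

Section SteepPoints.
Variable R : realType.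
Local Notation lambda := (@lebesgue_measure R).
Variable f : R -> R.
Hypothesis ndf : forall x y, x <= y -> f x <= f y.

Lemma lebesgue_itvoo (u v : R) : u <= v -> lambda `]u, v[%classic = (v - u)%:E.
Proof.
rewrite le_eqVlt => /predU1P[->|uv].
  by rewrite set_itvoo0// measure0 subrr.
by rewrite lebesgue_measure_itv/= lte_fin uv -EFinD.
Qed.

(** A monotone [f] turns the disjoint balls into disjoint, possibly empty, open intervals inside ]f
    A, f B[, and the increments are their Lebesgue measures. Continuity of [f] does not enter. *)
Lemma sum_disjoint_increments (E : seq R) (r : R -> R) (A B : R) : uniq E ->
  (forall i, i \in E -> [/\ 0 < r i, A <= i - r i & i + r i <= B]) -> A <= B ->
  trivIset [set` E] (fun i => ball i (r i)) ->
  \sum_(i <- E) (f (i + r i) - f (i - r i)) <= f B - f A.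
Proof.
move=> uE hE AB tE.
pose J i := `]f (i - r i), f (i + r i)[%classic : set R.
have tJ : trivIset [set` E] J.
  apply/trivIsetP => i j /= iE jE ij; apply/seteqP; split => // t [].
  rewrite /J /= !in_itv/= => /andP[h1 h2] /andP[h3 h4].
  have [ri _ _] := hE i iE; have [rj _ _] := hE j jE.
  have l1 : i - r i < j + r j.
    by rewrite ltNge; apply/negP => /ndf; rewrite leNgt (lt_trans h1 h4).
  have l2 : j - r j < i + r i.
    by rewrite ltNge; apply/negP => /ndf; rewrite leNgt (lt_trans h3 h2).
  have /trivIsetP/(_ i j iE jE ij) /seteqP[+ _] := tE.
  pose lo := Num.max (i - r i) (j - r j); pose hi := Num.min (i + r i) (j + r j).
  have lohi : lo < hi.
    rewrite /lo /hi gt_max !lt_min l1 l2 !andbT.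
    by apply/and3P; split => //; lra.
  have a1 : i - r i <= lo by rewrite le_max lexx.
  have a2 : j - r j <= lo by rewrite le_max lexx orbT.
  have a3 : hi <= i + r i by rewrite ge_min lexx.
  have a4 : hi <= j + r j by rewrite ge_min lexx orbT.
  by move=> /(_ ((lo + hi) / 2)); apply; rewrite /ball /= !ltr_distlC;
    split; apply/andP; split; lra.
rewrite -lee_fin -sumEFin big_seq.
rewrite (eq_bigr (fun i => lambda (J i))); last first.
  move=> i iE; have [ri _ _] := hE i iE.
  by rewrite /J lebesgue_itvoo// ndf//; lra.
rewrite -big_seq fsbig_seq// -measure_fin_bigcup//; last first.
  by move=> i _; exact: measurable_itv.
rewrite -lebesgue_itvoo ?ndf//; apply: le_measure; rewrite ?inE.
- by apply: fin_bigcup_measurable => // i _; exact: measurable_itv.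
- exact: measurable_itv.
- move=> t [i /= iE]; have [ri h1 h2] := hE i iE.
  rewrite /J /= !in_itv/= => /andP[h3 h4]; apply/andP; split.
    by apply: le_lt_trans h3; exact: ndf.
  by apply: (lt_le_trans h4); exact: ndf.
Qed.

(** Vitali covering: a compact subset of the union of the steep balls is covered by the triples, of
    length 6 r, of finitely many disjoint ones. There r is below the increment divided by M, and
    disjoint increments add up to at most f (b + 1) - f (a - 1) because the radii are below 1. *)
Lemma steep_set_measure (a b M : R) : a <= b -> 0 < M ->
  exists U : set R, [/\ measurable U,
    (lambda U <= (6 / M * (f (b + 1) - f (a - 1)))%:E)%E &
    forall x r, a <= x <= b -> 0 < r < 1 -> M * r < f (x + r) - f (x - r) -> U x].
Proof.
move=> ab M0.
pose S : set R := [set x | a <= x <= b /\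
  exists r, 0 < r < 1 /\ M * r < f (x + r) - f (x - r)].
have /choice [r hr] : forall x, exists r, 0 < r < 1 /\
    (S x -> M * r < f (x + r) - f (x - r)).
  move=> x; case: (pselect (S x)) => [[_ [r [r1 hr]]]|nS]; first by exists r.
  (* Filler value: outside [S] only [0 < r x < 1] matters. *)
  by exists (1 / 2); split => //; apply/andP; split; lra.
have r0 x : 0 < r x by have [/andP[]] := hr x.
pose B (x : R) : set R := ball x (r x).
pose U := \bigcup_(x in S) B x.
have oU : open U by apply: bigcup_open => x _; exact: ball_open.
exists U; split; first exact: open_measurable.
- rewrite lebesgue_regularity_inner_sup; last exact: open_measurable.
  apply: ge_ereal_sup => /= _ [K [cK KU <-]].
  have [D Dsub KD] : finite_subset_cover S B K.
    move: cK; rewrite compact_cover; apply; last exact: KU.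
    by move=> x _; exact: ball_open.
  have is_ballB i : is_ball (B i) by exact: is_ball_ball.
  have Bset0 i : B i !=set0 by exists i; exact: ballxx.
  have [E [uE ED tEB DE]] := @vitali_lemma_finite_cover R R B is_ballB Bset0 (finmap.enum_fset D).
  have KE : K `<=` cover [set` E] (scale_ball 3%:R \o B).
    by apply: subset_trans DE; apply: (subset_trans KD) => x [i Di Bi]; exists i.
  have ES i : i \in E -> S i by move=> /ED /Dsub; rewrite inE.
  apply: (@le_trans _ _ (\sum_(i <- E) (6 * r i)%:E)%E).
    apply: (le_trans (@content_subadditive _ _ _ lambda K
      (fun i => 3 *` B (nth 0%R E i)) (size E) _ _ _)) => //.
    + by move=> k ?; rewrite scale_ballE//; exact: measurable_ball.
    + by apply: compact_measurable.
    + apply: (subset_trans KE); rewrite /cover bigcup_seq.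
      by rewrite (big_nth 0%R)//= big_mkord.
    + rewrite (big_nth 0%R) big_mkord; apply: lee_sum => i _.
      have h3 : 0 <= 3 * r E`_i by rewrite mulr_ge0// ltW.
      have hb := lebesgue_measure_ball E`_i h3.
      rewrite /B scale_ballE//.
      apply: (@le_trans _ _ ((3 * r E`_i) *+ 2)%:E); first by rewrite -hb.
      by rewrite lee_fin -mulr_natr; lra.
  rewrite sumEFin lee_fin.
  apply: (@le_trans _ _ (6 / M * \sum_(i <- E) (f (i + r i) - f (i - r i)))).
    rewrite mulr_sumr big_seq [leRHS]big_seq; apply: ler_sum => i /ES Si.
    have [_ /(_ Si) h] := hr i.
    by rewrite -mulrA ler_pM2l// ler_pdivlMl// ltW.
  rewrite ler_wpM2l ?divr_ge0 ?(ltW M0)//.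
  apply: sum_disjoint_increments => //; last by lra.
  move=> i /ES [/andP[h1 h2] _]; have [/andP[h3 h4] _] := hr i.
  by split; lra.
- move=> x s xab s1 hs; exists x; last exact: ballxx.
  by split=> //; exists s.
Qed.

(** By monotonicity the symmetric increment of radius |s - x| dominates |f s - f x|. So a point with
    unbounded difference quotients lies, for every M, in a set of measure O(1 / M). *)
Lemma steep_points_null (a b : R) : a <= b ->
  exists N : set R, [/\ measurable N, lambda N = 0%E & forall x, a <= x <= b ->
    (forall M d : R, 0 < M -> 0 < d ->
      exists2 s, 0 < `|s - x| < d & M * `|s - x| < `|f s - f x|) -> N x].
Proof.
move=> ab.
have /choice [U hU] : forall n : nat, exists U : set R, [/\ measurable U,
    (lambda U <= (6 / n.+1%:R * (f (b + 1) - f (a - 1)))%:E)%E &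
    forall x r, a <= x <= b -> 0 < r < 1 ->
      n.+1%:R * r < f (x + r) - f (x - r) -> U x].
  by move=> n; apply: steep_set_measure.
exists (\bigcap_n U n); split.
- by apply: bigcapT_measurable => n; have [] := hU n.
- apply/eqP; rewrite eq_le measure_ge0 andbT.
  apply/lee_addgt0Pr => e e0; rewrite add0e.
  pose V := f (b + 1) - f (a - 1).
  have V0 : 0 <= V by rewrite subr_ge0 ndf//; lra.
  pose n := Num.truncn (e^-1 * (6 * V)).
  apply: (@le_trans _ _ (lambda (U n))).
    apply: le_measure; rewrite ?inE; last by move=> x; apply.
    - by apply: bigcapT_measurable => k; have [] := hU k.
    - by have [] := hU n.
  have [_ h _] := hU n; apply: (le_trans h); rewrite lee_fin -/V.
  rewrite mulrAC ler_pdivrMr ?ltr0n// ltW// -ltr_pdivrMl//.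
  exact: truncnS_gt.
- move=> x xab hx n _; have [_ _ H] := hU n.
  have n0 : 0 < n.+1%:R :> R by rewrite ltr0n.
  have [s /andP[s0 s1] hs] := hx n.+1%:R 1 n0 ltr01.
  apply: (H x `|s - x|) => //; first by rewrite s0.
  apply: (lt_le_trans hs).
  case/orP: (le_total x s) => xs.
    have -> : `|s - x| = s - x by rewrite ger0_norm// subr_ge0.
    have -> : `|f s - f x| = f s - f x by rewrite ger0_norm// subr_ge0 ndf.
    rewrite (_ : x + (s - x) = s); last by lra.
    by rewrite lerB// ndf//; lra.
  have -> : `|s - x| = x - s by rewrite distrC ger0_norm// subr_ge0.
  have -> : `|f s - f x| = f x - f s by rewrite distrC ger0_norm// subr_ge0 ndf.
  rewrite (_ : x - (x - s) = s); last by lra.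
  by rewrite lerB// ndf//; lra.
Qed.

End SteepPoints.

(** * Peaking kernels on the circle *)

Section Circle.
Variable R : realType.
Implicit Types (x y t r : R) (z w : R[i]).

Definition cis x : R[i] := Complex (cos x) (sin x).

Lemma nc_cis x : nc (cis x) = 1.
Proof. by rewrite ncE /= cos2Dsin2 sqrtr1. Qed.

Lemma sin_MVT t : 0 < t -> exists2 c, 0 < c < t & sin t = cos c * t.
Proof.
move=> t0; have cs : {within `[0, t], continuous (@sin R)}.
  by apply: continuous_subspaceT; exact: continuous_sin.
have [c] := MVT t0 (fun x _ => is_derive_sin x) cs.
by rewrite in_itv/= => ct; rewrite sin0 !subr0 => h; exists c.
Qed.

Lemma sin_le_id t : 0 <= t -> sin t <= t.
Proof.
rewrite le_eqVlt => /predU1P[<-|t0]; first by rewrite sin0.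
by have [c _ ->] := sin_MVT t0; rewrite ler_piMl ?(ltW t0)// cos_le1.
Qed.

Lemma abs_sin_le t : `|sin t| <= `|t|.
Proof.
case/orP: (le_total 0 t) => t0.
  rewrite (ger0_norm t0); case: (lerP t 1) => t1.
    rewrite ger0_norm ?sin_le_id// sin_ge0_pi// t0/= (le_trans t1)//.
    by rewrite (le_trans _ (pi_ge2 R))// ler1n.
  by rewrite (le_trans (sin_max t))// ltW.
rewrite -normrN -sinN -(normrN t); have : 0 <= - t by rewrite oppr_ge0.
move: (- t) => u u0; rewrite (ger0_norm u0); case: (lerP u 1) => u1.
  rewrite ger0_norm ?sin_le_id// sin_ge0_pi// u0/= (le_trans u1)//.
  by rewrite (le_trans _ (pi_ge2 R))// ler1n.
by rewrite (le_trans (sin_max u))// ltW.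
Qed.

Lemma cos_half t : cos t = 1 - 2 * sin (t / 2) ^+ 2.
Proof.
have {1}-> : t = (t / 2) *+ 2 by rewrite -mulr_natr mulfVK.
rewrite cos_mulr2n; have := cos2Dsin2 (t / 2); lra.
Qed.

Lemma cos_ge_half t : `|t| <= 1 -> 1 / 2 <= cos t.
Proof.
move=> t1; rewrite cos_half.
have h : `|sin (t / 2)| <= 1 / 2.
  rewrite (le_trans (abs_sin_le _))// normrM (ger0_norm (_ : 0 <= 2^-1))//; lra.
have : sin (t / 2) ^+ 2 <= (1 / 2) ^+ 2 by rewrite -real_normK ?num_real// lerXn2r// nnegrE.
lra.
Qed.

Lemma sin_ge_half t : 0 <= t <= 1 -> t / 2 <= sin t.
Proof.
move=> /andP[]; rewrite le_eqVlt => /predU1P[<- _|t0 t1].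
  by rewrite sin0 mul0r.
have [c /andP[c0 ct] ->] := sin_MVT t0.
have : 1 / 2 <= cos c by apply: cos_ge_half; rewrite gtr0_norm//; lra.
by move=> h; rewrite mulrC ler_wpM2r ?(ltW t0)//; lra.
Qed.

Lemma sqr_chord x y : nc (cis x - cis y) ^+ 2 = 4 * sin ((x - y) / 2) ^+ 2.
Proof.
rewrite sqr_nc /sqmod /=.
have := cos_half (x - y); rewrite cosB.
have := cos2Dsin2 x; have := cos2Dsin2 y; lra.
Qed.

Lemma chord_le x y : nc (cis x - cis y) <= `|x - y|.
Proof.
rewrite -(@ler_pXn2r _ 2)// ?nnegrE ?nc_ge0// sqr_chord.
have h := abs_sin_le ((x - y) / 2).
have : sin ((x - y) / 2) ^+ 2 <= `|(x - y) / 2| ^+ 2.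
  by rewrite -real_normK ?num_real// lerXn2r// nnegrE.
rewrite normrM (ger0_norm (_ : 0 <= 2^-1))// exprMn; lra.
Qed.

Lemma chord_ge x y : `|x - y| <= 1 -> `|x - y| / 2 <= nc (cis x - cis y).
Proof.
move=> h1; have n0 := normr_ge0 (x - y); rewrite -(@ler_pXn2r _ 2)// ?nnegrE ?nc_ge0 ?divr_ge0// sqr_chord.
have hs : `|x - y| / 4 <= `|sin ((x - y) / 2)|.
  have -> : `|sin ((x - y) / 2)| = `|sin (`|x - y| / 2)|.
    case/orP: (le_total 0 (x - y)) => h; first by rewrite (ger0_norm h).
    by rewrite (ler0_norm h) mulNr sinN normrN.
  rewrite (le_trans _ (ler_norm _))//.
  rewrite (le_trans _ (sin_ge_half _))//; last by apply/andP; split; lra.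
  lra.
have : (`|x - y| / 4) ^+ 2 <= sin ((x - y) / 2) ^+ 2.
  by rewrite -[leRHS]real_normK ?num_real// lerXn2r// nnegrE// divr_ge0.
rewrite !exprMn; lra.
Qed.

Lemma cis_inj x y : - pi < x <= pi -> - pi < y <= pi -> cis x = cis y -> x = y.
Proof.
wlog xy : x y / x <= y.
  by move=> H hx hy h; case/orP: (le_total x y) => ?; [exact: H|apply/esym/H].
move=> /andP[x1 x2] /andP[y1 y2] h.
have := sqr_chord x y; rewrite h subrr nc0 expr0n /= => /esym/eqP.
rewrite mulf_eq0 pnatr_eq0/= sqrf_eq0 => /eqP s0.
move: xy; rewrite le_eqVlt => /predU1P[//|xy].
have : 0 < sin ((y - x) / 2) by apply: sin_gt0_pi; apply/andP; split; lra.
by rewrite (_ : (y - x) / 2 = - ((x - y) / 2)) ?sinN ?s0 ?oppr0 ?ltxx//; lra.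
Qed.

(* The normalised kernel with a simple pole at [(1 - r) * w]; it equals [1] at
   [w] and is concentrated at scale [r] around [w] on the unit circle. *)
Definition peak r w z : R[i] := r%:C%C * w / (z - (1 - r)%:C%C * w).

(** Every estimate on [peak] rests on this identity: the distance to the pole is at least r, and
    comparable to |z - w| when that is larger. *)
Lemma pole_norm r w z : nc z = 1 -> nc w = 1 ->
  nc (z - (1 - r)%:C%C * w) ^+ 2 = r ^+ 2 + (1 - r) * nc (z - w) ^+ 2.
Proof.
move=> z1 w1; have := sqr_nc z; have := sqr_nc w.
rewrite z1 w1 expr1n !sqr_nc /sqmod; case: z {z1} => a b; case: w {w1} => e f /=.
rewrite !(mul0r, subr0, addr0) => h1 h2.
have -> : (a - (1 - r) * e) ^+ 2 + (b - (1 - r) * f) ^+ 2 =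
  (a ^+ 2 + b ^+ 2) * r + (e ^+ 2 + f ^+ 2) * (r ^+ 2 - r) +
  (1 - r) * ((a - e) ^+ 2 + (b - f) ^+ 2) by ring.
rewrite -h1 -h2; ring.
Qed.

Lemma pole_ge r w z : 0 < r < 1 -> nc z = 1 -> nc w = 1 ->
  r <= nc (z - (1 - r)%:C%C * w).
Proof.
move=> /andP[r0 r1] z1 w1; rewrite -(@ler_pXn2r _ 2)// ?nnegrE ?nc_ge0 ?(ltW r0)//.
by rewrite pole_norm// lerDl mulr_ge0 ?sqr_ge0// subr_ge0 ltW.
Qed.

Lemma pole_neq0 r w z : 0 < r < 1 -> nc z = 1 -> nc w = 1 ->
  z - (1 - r)%:C%C * w != 0.
Proof.
move=> r01 z1 w1; rewrite -nc_gt0 (lt_le_trans _ (pole_ge r01 z1 w1))//.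
by case/andP: r01.
Qed.

Lemma pole_in_disc r w : 0 < r < 1 -> nc w = 1 -> 0 < nc ((1 - r)%:C%C * w) < 1.
Proof.
move=> /andP[r0 r1] w1; rewrite ncM nc_real w1 mulr1.
by rewrite ger0_norm; [apply/andP; split; lra|lra].
Qed.

Lemma nc_peak r w z : 0 < r -> nc w = 1 ->
  nc (peak r w z) = r / nc (z - (1 - r)%:C%C * w).
Proof. by move=> r0 w1; rewrite /peak !ncM nc_real w1 mulr1 gtr0_norm// ncV. Qed.

Lemma peak_le1 r w z : 0 < r < 1 -> nc z = 1 -> nc w = 1 -> nc (peak r w z) <= 1.
Proof.
move=> r01 z1 w1; have h := pole_ge r01 z1 w1; case/andP: r01 => r0 r1.
by rewrite nc_peak// ler_pdivrMr ?mul1r// (lt_le_trans r0).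
Qed.

Lemma peak_far r w z (b : R) : 0 < r <= 1 / 2 -> nc z = 1 -> nc w = 1 ->
  0 < b -> b <= nc (z - w) -> nc (peak r w z) ^+ 2 <= 2 * r ^+ 2 / b ^+ 2.
Proof.
move=> /andP[r0 r2] z1 w1 b0 bd.
have r01 : 0 < r < 1 by apply/andP; split; lra.
have h := pole_ge r01 z1 w1.
have n0 : 0 < nc (z - (1 - r)%:C%C * w) by exact: lt_le_trans h.
rewrite nc_peak// expr_div_n ler_pdivlMr ?exprn_gt0// mulrAC.
rewrite ler_pdivrMr ?exprn_gt0// mulrC pole_norm//.
have hb : b ^+ 2 <= nc (z - w) ^+ 2 by rewrite lerXn2r ?nnegrE ?nc_ge0// ltW.
have key : b ^+ 2 <= 2 * (r ^+ 2 + (1 - r) * nc (z - w) ^+ 2).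
  have k : 1 / 2 * nc (z - w) ^+ 2 <= (1 - r) * nc (z - w) ^+ 2.
    by rewrite ler_wpM2r ?sqr_ge0//; lra.
  have := sqr_ge0 r; lra.
by have := ler_wpM2l (sqr_ge0 r) key; lra.
Qed.

Lemma peak_near r w z : 0 < r < 1 -> nc z = 1 -> nc w = 1 ->
  nc (peak r w z - 1) <= nc (z - w) / r.
Proof.
move=> r01 z1 w1; have n0 := pole_neq0 r01 z1 w1; have h := pole_ge r01 z1 w1.
have -> : peak r w z - 1 = (w - z) / (z - (1 - r)%:C%C * w).
  rewrite /peak; apply: (canRL (mulfK n0)); rewrite mulrBl mulfVK// mul1r.
  by rewrite rmorphB rmorph1; ring.
case/andP: r01 => r0 r1.
rewrite ncM ncV ncB; apply: ler_wpM2l; first exact: nc_ge0.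
by rewrite lef_pV2 ?posrE// (lt_le_trans r0).
Qed.

(** The bound is multiplied over many arcs in [peak_null_approx]: with 1 + r the product stays below
    the exponential of the sum of the scales, whereas a cruder constant would blow up. *)
Lemma sub1_peak_le r w z : 0 < r <= 1 / 2 -> nc z = 1 -> nc w = 1 ->
  nc (1 - peak r w z) <= 1 + r.
Proof.
move=> /andP[r0 r2] z1 w1.
have r01 : 0 < r < 1 by apply/andP; split; lra.
have n0 := pole_neq0 r01 z1 w1; have h := pole_ge r01 z1 w1.
have -> : 1 - peak r w z = (z - w) / (z - (1 - r)%:C%C * w).
  rewrite /peak; apply: (canRL (mulfK n0)); rewrite mulrBl mulfVK// mul1r.
  by rewrite rmorphB rmorph1; ring.
have n1 : 0 < nc (z - (1 - r)%:C%C * w) by exact: lt_le_trans h.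
rewrite ncM ncV ler_pdivrMr// -(@ler_pXn2r _ 2)// ?nnegrE ?mulr_ge0 ?nc_ge0//; last by lra.
rewrite exprMn pole_norm//.
have k : 1 <= (1 + r) ^+ 2 * (1 - r).
  have k1 : 0 <= r * (1 - r - r ^+ 2).
    by rewrite mulr_ge0 ?(ltW r0)//; have := ler_pM (ltW r0) (ltW r0) r2 r2; lra.
  lra.
rewrite mulrDr mulrA.
have k2 := ler_wpM2r (sqr_ge0 (nc (z - w))) k.
rewrite mul1r in k2; apply: (le_trans k2).
by rewrite -[X in X <= _]mulrA lerDr mulr_ge0 ?(ltW r0)// mulr_ge0 ?sqr_ge0 ?(ltW r0).
Qed.

End Circle.

(** * Grid cells of angles and square sums of separated peaks *)

Section Cells.
Variable R : realType.
Implicit Types (r s t : R) (P : set R).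

Let succE (n : nat) : n.+1%:R = n%:R + 1 :> R.
Proof. by rewrite natr1. Qed.

(** Truncation is a floor only on nonnegative numbers, hence the shift: as 4 > pi, every principal
    angle lies in [-4, 4]. *)
Definition cell r s : nat := Num.truncn ((s + 4) / r).
Definition ncells r : nat := (Num.truncn (8 / r)).+1.
Definition occupied P r (k : nat) : bool := `[< exists2 s, P s & cell r s = k >].

Lemma cell_itv r s : 0 < r -> -4 <= s ->
  (cell r s)%:R * r <= s + 4 < (cell r s).+1%:R * r.
Proof.
move=> r0 s4; rewrite -ler_pdivlMr// -ltr_pdivrMr//.
by apply: truncn_itv; rewrite divr_ge0 ?(ltW r0)//; lra.
Qed.

Lemma cell_lt r s : 0 < r -> -4 <= s <= 4 -> (cell r s < ncells r)%N.
Proof.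
move=> r0 /andP[s1 s2]; rewrite ltnS; apply: le_truncn.
by rewrite ler_wpM2r ?invr_ge0 ?(ltW r0)//; lra.
Qed.

Lemma ncells_le r : 0 < r -> (ncells r)%:R * r <= 8 + r.
Proof.
move=> r0; have /andP[h _] : (Num.truncn (8 / r))%:R <= 8 / r < (ncells r)%:R.
  by apply: truncn_itv; rewrite divr_ge0// ltW.
by rewrite /ncells succE mulrDl mul1r lerD2r -ler_pdivlMr.
Qed.

Lemma cell_near r s t : 0 < r -> -4 <= s -> -4 <= t -> cell r s = cell r t -> `|s - t| < r.
Proof.
move=> r0 /(cell_itv r0)/andP[+ +] /(cell_itv r0)/andP[+ +] st.
rewrite -st (succE (cell r s)) mulrDl mul1r => h1 h2 h3 h4.
by rewrite ltr_norml; apply/andP; split; lra.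
Qed.

Lemma cell_far r s t : 0 < r -> -4 <= s -> -4 <= t ->
  (`|(cell r s)%:R - (cell r t)%:R| - 1) * r <= `|s - t|.
Proof.
move=> r0 /(cell_itv r0)/andP[+ +] /(cell_itv r0)/andP[+ +].
rewrite (succE (cell r s)) (succE (cell r t)) !mulrDl !mul1r => h1 h2 h3 h4.
case/orP: (le_total 0 ((cell r s)%:R - (cell r t)%:R : R)) => h.
  by rewrite (ger0_norm h) mulrBl (le_trans _ (ler_norm _))//; lra.
by rewrite (ler0_norm h) mulNr mulrBl distrC (le_trans _ (ler_norm _))//; lra.
Qed.

Lemma occupied_pick P r : exists p : nat -> R, forall k, occupied P r k ->
  P (p k) /\ cell r (p k) = k.
Proof.
have /choice [p hp] : forall k, exists s, occupied P r k -> P s /\ cell r s = k.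
  move=> k; case: (boolP (occupied P r k)) => [/asboolP[s Ps sk]|_]; first by exists s.
  by exists 0.
by exists p.
Qed.

Lemma sum_inv_sqr N : \sum_(j < N) ((j%:R + 1) ^+ 2)^-1 <= 2 :> R.
Proof.
(* The bound is strengthened so that the induction telescopes, by 1 / (n + 2)^2 <= 1 / (n + 1) - 1 /
   (n + 2). *)
suff H : forall n, \sum_(j < n.+1) ((j%:R + 1) ^+ 2)^-1 <= 2 - (n.+1%:R)^-1 :> R.
  case: N => [|n]; first by rewrite big_ord0.
  by rewrite (le_trans (H n))// gerBl invr_ge0.
elim=> [|n ih]; first by rewrite big_ord1 add0r expr1n invr1; lra.
rewrite big_ord_recr /= (le_trans (lerD ih (lexx _)))//.
have n1 : 0 < n.+1%:R :> R by rewrite ltr0n.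
have n2 : 0 < n.+2%:R :> R by rewrite ltr0n.
rewrite natr1 -addrA lerD2l -lerBrDl opprK addrC.
have e : n.+2%:R = n.+1%:R + 1 :> R by rewrite natr1.
have -> : (n.+2%:R ^+ 2)^-1 = n.+2%:R^-1 * n.+2%:R^-1 :> R by rewrite expr2 invfM.
have -> : n.+1%:R^-1 - n.+2%:R^-1 = n.+1%:R^-1 * n.+2%:R^-1 :> R.
  by rewrite e in n2 *; move: n1 n2; move: (n.+1%:R) => a a0 a1; field; rewrite !gt_eqF.
rewrite ler_wpM2r ?invr_ge0 ?(ltW n2)// lef_pV2 ?posrE//.
by rewrite ler_nat.
Qed.

Lemma sum_inv_sqr_centered N (k0 : nat) :
  \sum_(k < N) ((`|k%:R - k0%:R| + 1) ^+ 2)^-1 <= 4 :> R.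
Proof.
pose g (j : nat) : R := ((j%:R + 1) ^+ 2)^-1.
have g0 j : 0 <= g j by rewrite invr_ge0 sqr_ge0.
have hg (k : nat) : ((`|k%:R - k0%:R| + 1) ^+ 2)^-1 <=
    (if (k0 <= k)%N then g (k - k0)%N else 0) + (if (k < k0)%N then g (k0 - k)%N else 0).
  case: leqP => h; first by rewrite addr0 /g natrB// ger0_norm// subr_ge0 ler_nat.
  by rewrite add0r /g natrB ?(ltnW h)// distrC ger0_norm// subr_ge0 ler_nat ltnW.
apply: (@le_trans _ _ (\sum_(k < N) ((if (k0 <= k)%N then g (k - k0)%N else 0) +
    (if (k < k0)%N then g (k0 - k)%N else 0)))).
  by apply: ler_sum => k _; exact: hg.
rewrite big_split /= (_ : 4 = 2 + 2); last by lra.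
apply: lerD.
  apply: le_trans (sum_inv_sqr (N - k0)); rewrite le_eqVlt; apply/orP; left; apply/eqP.
  rewrite -[RHS]/(\sum_(j < N - k0) g j); elim: N => [|n ih]; first by rewrite !big_ord0.
  rewrite big_ord_recr ih /=; case: leqP => h; first by rewrite subSn// big_ord_recr.
  have -> : (n.+1 - k0 = 0)%N by apply/eqP.
  have -> : (n - k0 = 0)%N by apply/eqP; rewrite subn_eq0 ltnW.
  by rewrite !big_ord0 addr0.
apply: le_trans (sum_inv_sqr k0.+1).
elim: N k0 {hg} => [|n ih] k0; first by rewrite big_ord0 sumr_ge0.
case: k0 => [|k0]; first by rewrite big1 ?sumr_ge0.
rewrite big_ord_recl /= subn0 [leRHS]big_ord_recr /= addrC.
by apply: lerD => //; exact: ih.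
Qed.

(** Compare with the centre [k0] nearest to [z]: any other centre is at least half as far from [z]
    as from that one, hence at least (j - 1) r / (4 L) away with j = |k - k0|. Then [peak_far] gives
    32 L^2 / (j - 1)^2, which is at most 288 L^2 / (j + 1)^2 for j >= 2, and 1152 = 4 * 288. For j
    <= 1 the trivial bound 1 is enough. *)
Lemma sum_peak_bound (A : pred nat) (N : nat) (y : nat -> R) (L r : R) (z : R[i]) :
  1 <= L -> 0 < r <= 1 / 2 -> nc z = 1 ->
  (forall k l, A k -> A l -> `|y k - y l| <= 1) ->
  (forall k l, A k -> A l -> (`|k%:R - l%:R| - 1) * r <= L * `|y k - y l|) ->
  \sum_(k < N | A k) nc (peak r (cis (y k)) z) ^+ 2 <= 1152 * L ^+ 2.
Proof.
move=> L1 r2 z1 hy1 hy2; have /andP[r0 _] := r2.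
have r01 : 0 < r < 1 by case/andP: r2 => ? ?; apply/andP; split; lra.
have L0 : 0 < L by lra.
case: (pickP (fun k : 'I_N => A k)) => [i0 Ai0|nA]; last first.
  rewrite big1; first by have := sqr_ge0 L; lra.
  by move=> i; rewrite nA.
have [k0 Ak0 hk0] := @Order.TotalTheory.arg_minP _ _ 'I_N i0 (fun k : 'I_N => A k)
   (fun k : 'I_N => nc (z - cis (y k))) Ai0.
apply: (@le_trans _ _ (288 * L ^+ 2 * \sum_(k < N) ((`|k%:R - k0%:R| + 1) ^+ 2)^-1)).
  rewrite mulr_sumr big_mkcond /=; apply: ler_sum => k _.
  have j0 := normr_ge0 (k%:R - k0%:R : R).
  set j := `|k%:R - k0%:R| in j0 *.
  have LL : 1 <= L ^+ 2 by rewrite exprn_ege1.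
  have jp : 0 < (j + 1) ^+ 2 by rewrite exprn_gt0//; lra.
  case: ifPn => Ak; rewrite ler_pdivlMr//; last by rewrite mul0r; have := sqr_ge0 L; lra.
  case: (lerP j 1) => j1.
    have b1 := peak_le1 r01 z1 (nc_cis (y k)).
    have : nc (peak r (cis (y k)) z) ^+ 2 * (j + 1) ^+ 2 <= 1 * (1 + 1) ^+ 2.
      apply: ler_pM; rewrite ?sqr_ge0 ?exprn_ile1 ?nc_ge0//.
      by rewrite lerXn2r ?nnegrE//; lra.
    by move/le_trans; apply; lra.
  have j2 : 2 <= j.
    move: j1; rewrite /j; case: (leqP k0 k) => kk.
      by rewrite -natrB// ger0_norm ?ler0n// (ltr_nat _ 1) (ler_nat _ 2).
    by rewrite distrC -natrB ?(ltnW kk)// ger0_norm ?ler0n// (ltr_nat _ 1) (ler_nat _ 2).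
  have hd : (j - 1) * r / (4 * L) <= nc (z - cis (y k)).
    rewrite ler_pdivrMr ?mulr_gt0//.
    have h1 := hy2 _ _ Ak Ak0; have h2 := chord_ge (hy1 _ _ Ak Ak0).
    have h3 : nc (cis (y k) - cis (y k0)) <= 2 * nc (z - cis (y k)).
      have -> : cis (y k) - cis (y k0) = (z - cis (y k0)) - (z - cis (y k)) by ring.
      by rewrite (le_trans (ler_ncB _ _))//; have := hk0 k Ak; lra.
    rewrite -/j in h1; apply: (le_trans h1).
    have : L * `|y k - y k0| <= L * (4 * nc (z - cis (y k))).
      by rewrite ler_wpM2l ?(ltW L0)//; lra.
    by move/le_trans; apply; rewrite le_eqVlt; apply/orP; left; apply/eqP; ring.
  have dp : 0 < (j - 1) * r / (4 * L) by rewrite divr_gt0 ?mulr_gt0//; lra.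
  have := peak_far r2 z1 (nc_cis (y k)) dp hd.
  have -> : 2 * r ^+ 2 / ((j - 1) * r / (4 * L)) ^+ 2 = 32 * L ^+ 2 / (j - 1) ^+ 2.
    by field; rewrite !gt_eqF//; lra.
  have jm : 0 < (j - 1) ^+ 2 by rewrite exprn_gt0//; lra.
  move=> /(ler_wpM2r (ltW jp))/le_trans; apply.
  rewrite mulrAC ler_pdivrMr//.
  have : (j + 1) ^+ 2 <= (3 * (j - 1)) ^+ 2 by rewrite lerXn2r ?nnegrE//; lra.
  move=> /(ler_wpM2l (sqr_ge0 L)); lra.
have h := sum_inv_sqr_centered N k0.
by have := ler_wpM2l (sqr_ge0 L) h; lra.
Qed.

End Cells.

(** * Vanishing on graphs over Lebesgue-null sets *)

Section PartialFractions.
Variable R : realType.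

(** A new factor is absorbed through 1 / ((z - q) (z - p)) = (1 / (z - q) - 1 / (z - p)) / (q - p),
    which is why the poles must be distinct. *)
Lemma prod_partial_fractions (s : seq (R[i] * R[i])) : uniq (map fst s) ->
  exists a : R[i] -> R[i], forall z, (forall p, p \in s -> z - p.1 != 0) ->
    \prod_(p <- s) (1 - p.2 / (z - p.1)) = 1 + \sum_(p <- s) a p.1 / (z - p.1).
Proof.
elim: s => [_|[q c] s ih]; first by exists (fun=> 0) => z _; rewrite !big_nil addr0.
rewrite /= => /andP[qs us]; have [a ha] := ih us.
exists (fun y => if y == q then - c - \sum_(p <- s) c * a p.1 / (q - p.1)
                 else a y + c * a y / (q - y)) => z hz.
rewrite !big_cons /= eqxx ha; last by move=> p ps; apply: hz; rewrite inE ps orbT.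
have zq : z - q != 0 by apply: (hz (q, c)); rewrite inE eqxx.
have -> : \sum_(p <- s) (if p.1 == q then - c - \sum_(p <- s) c * a p.1 / (q - p.1)
     else a p.1 + c * a p.1 / (q - p.1)) / (z - p.1) =
  \sum_(p <- s) a p.1 / (z - p.1) + \sum_(p <- s) c * a p.1 / (q - p.1) / (z - p.1).
  rewrite -big_split /= big_seq [RHS]big_seq; apply: eq_bigr => p ps.
  have -> : (p.1 == q) = false.
    by apply/eqP => e; move/negP: qs; apply; rewrite -e; exact: map_f.
  by rewrite mulrDl.
set S := \sum_(p <- s) a p.1 / (z - p.1).
have hS : c / (z - q) * S = \sum_(p <- s) c * a p.1 / (q - p.1) / (z - q) -
   \sum_(p <- s) c * a p.1 / (q - p.1) / (z - p.1).
  rewrite -sumrB mulr_sumr big_seq [RHS]big_seq; apply: eq_bigr => p ps.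
  have zp : z - p.1 != 0 by apply: hz; rewrite inE ps orbT.
  have qp : q - p.1 != 0.
    rewrite subr_eq0; apply/eqP => e; move/negP: qs; apply; rewrite e; exact: map_f.
  by field; rewrite zp qp zq.
rewrite mulrBl mul1r mulrDr mulr1 hS -mulr_suml; ring.
Qed.

Lemma nc_prod_sub1 (I : Type) (s : seq I) (P : pred I) (a : I -> R[i]) :
  nc (\prod_(i <- s | P i) (1 - a i) - 1) <= \prod_(i <- s | P i) (1 + nc (a i)) - 1.
Proof.
elim: s => [|i s ih]; first by rewrite !big_nil subrr nc0 subrr.
rewrite !big_cons; case: ifP => // _.
set p := \prod_(j <- s | P j) (1 - a j) in ih *; set q := \prod_(j <- s | P j) _ in ih *.
have -> : (1 - a i) * p - 1 = (p - 1) - a i * (p - 1) - a i by ring.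
rewrite (le_trans (ler_ncB _ _))//.
have h1 := ler_ncB (p - 1) (a i * (p - 1)); rewrite ncM in h1.
have := ler_wpM2l (nc_ge0 (a i)) ih; lra.
Qed.

Lemma prod_1D_le_expR (I : Type) (s : seq I) (P : pred I) (a : I -> R) :
  (forall i, P i -> 0 <= a i) ->
  \prod_(i <- s | P i) (1 + a i) <= expR (\sum_(i <- s | P i) a i).
Proof.
move=> ha; elim: s => [|i s ih]; first by rewrite !big_nil expR0.
rewrite !big_cons; case: ifP => // Pi; rewrite expRD.
apply: ler_pM => //; last exact: expR_ge1Dx.
  by rewrite addr_ge0// ha.
by apply: prodr_ge0 => j Pj; rewrite addr_ge0// ha.
Qed.

Lemma nc_prod (I : Type) (s : seq I) (P : pred I) (a : I -> R[i]) :
  nc (\prod_(i <- s | P i) a i) = \prod_(i <- s | P i) nc (a i).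
Proof. by apply: (big_morph _ (@ncM R) (@nc1 R)). Qed.

Lemma compact_lebesgue_number (P U : set R) : compact P -> open U -> P `<=` U ->
  exists2 e : R, 0 < e & forall s, P s -> ball s e `<=` U.
Proof.
move=> cP oU PU.
have /compact_near_coveringP H := cP.
have hP : forall x, P x -> \forall x' \near x & i \near (0 : R)^'+, ball x' i `<=` U.
  move=> x Px; have /nbhs_ballP[e /= e0 he] : nbhs x U by apply: open_nbhs_nbhs; split => //; exact: PU.
  have e2 : 0 < e / 2 by rewrite divr_gt0.
  exists (ball x (e / 2), [set i : R | i < e / 2]); first split => /=.
  - exact: nbhsx_ballx.
  - exact: nbhs_right_lt.
  - move=> [x' i] /= [xx' ie] t x't; apply: he; rewrite [e]splitr.
    by apply: (ball_triangle xx'); apply: le_ball x't; exact: ltW.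
have := H R ((0 : R)^'+) (fun e s => ball s e `<=` U) _ hP.
move=> h; near ((0 : R)^'+) => e; exists e => //.
by near: e; exact: h.
Unshelve. all: by end_near. Qed.

End PartialFractions.

Section NullSets.
Context d (T : measurableType d) (R : realType).
Variables (mu1 mu2 : {finite_measure set T -> \bar R}) (D : set T).
Hypothesis mD : measurable D.
Local Notation IC := (IC mu1 mu2 D).
Local Notation cbm := (cbm D).
Local Notation lambda := (@lebesgue_measure R).
Variables (zeta k : T -> R[i]).
Hypothesis czeta : cbm zeta.
Hypothesis uzeta : forall x, D x -> nc (zeta x) = 1.
Hypothesis ck : cbm k.
Hypothesis kernel0 : forall z, 0 < nc z < 1 -> IC (fun x => (zeta x - z)^-1 * k x) = 0.

(** Subtracting the product from 1 cancels the constant term of the expansion; the constant function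
    is not among the kernels with zero moment. *)
Lemma prod_kernel_moment (s : seq (R[i] * R[i])) : uniq (map fst s) ->
  (forall p, p \in s -> 0 < nc p.1 < 1) ->
  IC (fun x => (1 - \prod_(p <- s) (1 - p.2 / (zeta x - p.1))) * k x) = 0.
Proof.
move=> us hs; have [a ha] := prod_partial_fractions us.
have -> : IC (fun x => (1 - \prod_(p <- s) (1 - p.2 / (zeta x - p.1))) * k x) =
    IC (fun x => \sum_(p <- s | p \in s) (- a p.1) * ((zeta x - p.1)^-1 * k x)).
  apply: eq_IC => x Dx; rewrite ha; last first.
    by move=> p /hs /andP[_ p1]; exact: (ker_neq0 uzeta p1 Dx).
  rewrite -big_seq opprD addrA subrr add0r mulNr mulr_suml -sumrN.
  by apply: eq_bigr => p _; rewrite mulNr mulrA.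
have cp p : p \in s -> cbm (fun x => (zeta x - p.1)^-1 * k x).
  by move=> /hs /andP[_ p1]; apply: cbmM => //; exact: (cbm_ker czeta uzeta p1).
rewrite IC_sum//; last first.
  by move=> p ps; apply: cbmM; [exact: cbm_cst|exact: cp].
rewrite big1// => p ps; rewrite ICZ//; last exact: cp.
by rewrite kernel0 ?mulr0//; exact: hs.
Qed.

(* Cover P by N arcs of length r with N r <= e^2 and put peaks of scale L = r / e at points w_k
   of P in these arcs. Then f = 1 - prod (1 - peak L w_k) is close to 1 on P because r is much
   smaller than L, and close to 0 away from P because N L <= e. Expanding the product in
   partial fractions makes f a combination of the kernels, which have zero moment. *)
Lemma peak_null_approx (P : set R) (n : nat) : compact P ->
  (forall s, P s -> - pi < s <= pi) -> (forall s, P s -> -4 <= s <= 4) ->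
  lambda P = 0%E ->
  exists f : T -> R[i], [/\ cbm f, IC (fun x => f x * k x) = 0,
    (forall x, D x -> nc (f x) <= 1 + expR 1),
    (forall x s, D x -> P s -> zeta x = cis s -> nc (f x - 1) <= expR 1 / n.+2%:R) &
    (forall x (b : R), D x -> 0 < b -> (forall s, P s -> b <= nc (zeta x - cis s)) ->
       nc (f x) <= expR (2 / b / n.+2%:R) - 1)].
Proof.
move=> cP Ppi P4 P0.
pose e : R := n.+2%:R^-1.
have e0 : 0 < e by rewrite invr_gt0.
have e2 : e <= 1 / 2 by rewrite div1r lef_pV2 ?posrE// ler_nat.
have ee : 0 < e ^+ 2 by rewrite exprn_gt0.
have mP : measurable P := compact_measurable cP.
have [U [oU PU UP]] : exists U : set R, [/\ open U , P `<=` U & (lambda (U `\` P) < (e ^+ 2)%:E)%E].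
  by apply: lebesgue_regularity_outer => //; rewrite [X in (X < _)%E]P0.
have mU : measurable U by exact: open_measurable.
have lU : (lambda U < (e ^+ 2)%:E)%E.
  rewrite -(setDUK PU) measureU//; last by rewrite setDIK.
    by rewrite [X in (X + _)%E]P0 add0e.
  exact: measurableD.
have [b b0 hb] := compact_lebesgue_number cP oU PU.
(* [r <= b] puts every cell that meets [P] inside [U], so their total length is at most e^2;
   [r <= e^2 / 2] makes L = r / e at most e / 2. *)
pose r := Num.min b (e / 2 * e).
have r0 : 0 < r by rewrite lt_min b0 !mulr_gt0// invr_gt0.
have rb : r <= b by rewrite ge_min lexx.
have re : r <= e / 2 * e by rewrite ge_min lexx orbT.
pose N := ncells r; pose A := occupied P r.
have [p hp] := occupied_pick P r.
have pP j : A j -> P (p j) by move=> /hp [].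
have pc j : A j -> cell r (p j) = j by move=> /hp [].
have p4 j : A j -> -4 <= p j by move=> /pP /P4 /andP[].
pose J (j : nat) : set R := `[j%:R * r - 4, j.+1%:R * r - 4[%classic.
have lJ j : lambda (J j) = r%:E.
  rewrite /J lebesgue_measure_itv/= lte_fin ltrD2r ltr_pM2r// ltr_nat ltnSn.
  rewrite -EFinD; congr EFin; rewrite -(natr1 j); ring.
have JU j : A j -> J j `<=` U.
  move=> Aj t; rewrite /J /= in_itv/= => /andP[t1 t2]; apply: (hb _ (pP _ Aj)).
  have := cell_itv r0 (p4 _ Aj); rewrite pc// => /andP[h1 h2].
  apply: (le_ball rb); rewrite /ball/= ltr_distl; move: h1 h2 t1 t2.
  by rewrite -(natr1 j) mulrDl mul1r => h1 h2 t1 t2; apply/andP; split; lra.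
have tJ : trivIset [set j : 'I_N | A j] (fun j : 'I_N => J j).
  apply/trivIsetP => i j _ _ ij; apply/seteqP; split => // t [].
  rewrite /J /= !in_itv/= => /andP[h1 h2] /andP[h3 h4].
  have l1 : (i%:R * r < j.+1%:R * r) by lra.
  have l2 : (j%:R * r < i.+1%:R * r) by lra.
  move: l1 l2; rewrite !ltr_pM2r// !ltr_nat !ltnS => l1 l2.
  by move/negP: ij; apply; apply/eqP/val_inj/eqP; rewrite eqn_leq l1.
have sumr : \sum_(j < N | A j) r <= e ^+ 2.
  rewrite -lee_fin; apply: le_trans (ltW lU).
  rewrite -sumEFin (eq_bigr (fun j : 'I_N => lambda (J j)))//.
  rewrite -measure_bigsetU_ord_cond//; last by move=> i _; exact: measurable_itv.
  apply: le_measure; rewrite ?inE//.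
    by apply: bigsetU_measurable => i _; exact: measurable_itv.
  apply: (big_ind (fun V => V `<=` U)) => [//|V W hV hW t [/hV//|/hW//]|j Aj].
  exact: JU.
pose L := r / e.
have L0 : 0 < L by rewrite divr_gt0.
have L2 : L <= 1 / 2 * e by rewrite ler_pdivrMr//; lra.
have L3 : 0 < L <= 1 / 2 by rewrite L0/=; lra.
have L1 : 0 < L < 1 by rewrite L0/=; lra.
have sumL : \sum_(j < N | A j) L <= e.
  by rewrite -mulr_suml ler_pdivrMr// -expr2.
pose F x := \prod_(j < N | A j) (1 - peak L (cis (p j)) (zeta x)).
exists (fun x => 1 - F x); split.

have cpk j : cbm (fun x => peak L (cis (p j)) (zeta x)).
  apply: cbmM; first exact: cbm_cst.
  apply: cbm_ker => //; by have /andP[] := pole_in_disc L1 (nc_cis (p j)).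
- apply: cbmB; first exact: cbm_cst.
  by apply: cbm_prod => j _; apply: cbmB => //; exact: cbm_cst.
- pose s := [seq ((1 - L)%:C%C * cis (p j), L%:C%C * cis (p j)) | j : 'I_N <- index_enum _ & A j].
  rewrite -[RHS](@prod_kernel_moment s).
  + apply: eq_IC => x _; congr ((1 - _) * _).
    by rewrite /s big_map big_filter.
  + rewrite -map_comp map_inj_in_uniq ?filter_uniq ?index_enum_uniq//.
    move=> i j; rewrite !mem_filter => /andP[Ai _] /andP[Aj _] /= h.
    have L10 : (1 - L)%:C%C != 0 :> R[i].
      by rewrite -nc_gt0 nc_real normr_gt0 subr_eq0 gt_eqF//; case/andP: L1.
    move/(mulfI L10): h => /cis_inj h.
    have := h (Ppi _ (pP _ Ai)) (Ppi _ (pP _ Aj)) => /(congr1 (cell r)).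
    by rewrite !pc// => /val_inj.
  + by move=> q /mapP[j _ ->]; exact: (pole_in_disc L1 (nc_cis (p j))).
- move=> x Dx; rewrite (le_trans (ler_ncB _ _))// nc1 lerD2l /F nc_prod.
  apply: (@le_trans _ _ (\prod_(j < N | A j) (1 + L))).
    apply: ler_prod => j Aj; rewrite nc_ge0/=; apply: sub1_peak_le => //.
      exact: uzeta.
    exact: nc_cis.
  rewrite (le_trans (prod_1D_le_expR _ _))//; first by move=> *; exact: ltW.
  by rewrite ler_expR (le_trans sumL)//; lra.
- move=> x s Dx Ps zs.
  have s4 := P4 _ Ps.
  pose j0 : 'I_N := Ordinal (cell_lt r0 s4).
  have Aj0 : A j0 by apply/asboolP; exists s.
  rewrite (_ : 1 - F x - 1 = - F x) ?ncN /F; last by ring.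
  (* The factor of the home cell is at most |z - w| / L <= r / L = e, and the others multiply to at
     most exp 1. *)
  rewrite (bigD1 j0)//= ncM mulrC; apply: ler_pM; rewrite ?nc_ge0//.
    rewrite nc_prod; apply: (@le_trans _ _ (\prod_(j < N | A j && (j != j0)) (1 + L))).
      apply: ler_prod => j Aj; rewrite nc_ge0/=; apply: sub1_peak_le => //.
        exact: uzeta.
      exact: nc_cis.
    rewrite (le_trans (prod_1D_le_expR _ _))//; first by move=> *; exact: ltW.
    rewrite ler_expR (le_trans _ (_ : e <= 1))//; last by lra.
    apply: le_trans sumL; rewrite [leRHS](bigD1 j0)//= lerDr; exact: ltW.
  rewrite ncB (le_trans (peak_near L1 (uzeta Dx) (nc_cis _)))// zs.
  rewrite ler_pdivrMr// (_ : e * L = r); last by rewrite /L mulrC mulfVK// gt_eqF.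
  rewrite (le_trans (chord_le _ _))// ltW//; apply: cell_near => //.
    by have /andP[] := s4.
    exact: p4.
  by rewrite (pc _ Aj0).
- move=> x c Dx c0 hc; rewrite ncB.
  rewrite (le_trans (nc_prod_sub1 _ _ _))// lerD2r.
  rewrite (le_trans (prod_1D_le_expR _ _))//; first by move=> *; exact: nc_ge0.
  rewrite ler_expR.
  apply: (@le_trans _ _ (\sum_(j < N | A j) (2 / c * L))).
    apply: ler_sum => j Aj.
    have lc : 0 <= 2 / c * L by apply: mulr_ge0; [apply: divr_ge0 => //; exact: ltW|exact: ltW].
    rewrite -(@ler_pXn2r _ 2)// ?nnegrE ?nc_ge0//.
    have := peak_far L3 (uzeta Dx) (nc_cis (p j)) c0 (hc _ (pP _ Aj)).
    move=> /le_trans; apply.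
    rewrite (_ : (2 / c * L) ^+ 2 = 2 * (2 * L ^+ 2 / c ^+ 2)); last by field; rewrite gt_eqF.
    have : 0 <= 2 * L ^+ 2 / c ^+ 2 by rewrite divr_ge0 ?sqr_ge0// mulr_ge0 ?sqr_ge0.
    lra.
  by rewrite -mulr_sumr ler_wpM2l// divr_ge0// ltW.
Qed.

End NullSets.

(** Semicontinuity is asked relative to [P], since one application has [g] built from [psi], which
    is controlled on [P] alone. *)
Lemma compact_inf_gt0 (R : realType) (P : set R) (g : R -> R) : compact P ->
  (forall s, P s -> 0 < g s) ->
  (forall s e, P s -> 0 < e -> exists2 d : R, 0 < d &
    forall t, P t -> `|s - t| < d -> g s - e <= g t) ->
  exists2 b : R, 0 < b & forall s, P s -> b <= g s.
Proof.
move=> /compact_near_coveringP H gp lsc.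
have hP : forall s, P s -> \forall t \near s & b \near (0 : R)^'+, P t -> b <= g t.
  move=> s Ps; have g2 : 0 < g s / 2 by rewrite divr_gt0// gp.
  have [d d0 hd] := lsc s _ Ps g2.
  exists (ball s d, [set b : R | b <= g s / 2]); first split => /=.
  - exact: nbhsx_ballx.
  - exact: nbhs_right_le.
  - move=> [t b] /= [st bg] Pt; have := hd t Pt st; move: bg; rewrite /=; lra.
have h := H R ((0 : R)^'+) (fun b s => P s -> b <= g s) _ hP.
near ((0 : R)^'+) => b; exists b => // s Ps.
by move: s Ps (Ps); near: b; exact: h.
Unshelve. all: by end_near. Qed.

Section NullSetMoments.
Context d (T : measurableType d) (R : realType).
Variables (mu1 mu2 : {finite_measure set T -> \bar R}) (D : set T).
Hypothesis mD : measurable D.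
Local Notation IC := (IC mu1 mu2 D).
Local Notation cbm := (cbm D).
Local Notation lambda := (@lebesgue_measure R).
Variables (zeta : T -> R[i]) (X : T -> R).
Hypothesis czeta : cbm zeta.
Hypothesis mX : measurable_fun setT X.
Hypothesis Xpi : forall x, D x -> - pi < X x <= pi.
Hypothesis zetaX : forall x, D x -> zeta x = cis (X x).

Lemma bmf_preimage_indic (A : set R) : measurable A ->
  bmf D (fun x => \1_A (X x) : R).
Proof.
move=> mA; have h : measurable_fun D (fun x => \1_A (X x) : R).
  apply: measurable_funTS.
  have mi : measurable_fun setT (\1_A : R -> R) by exact: measurable_indic.
  exact: measurableT_comp mi mX.
by split => //; exists 1 => x _; rewrite indicE; case: (_ \in _); rewrite ?normr0 ?normr1.
Qed.

Lemma le_IC_preimage (A : set R) (k : T -> R[i]) (M : R) : measurable A -> cbm k ->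
  (forall x, D x -> nc (k x) <= M) -> 0 <= M ->
  nc (IC (fun x => (\1_A (X x))%:C%C * k x)) <=
    M * (fine (mu1 (X @^-1` A)) + fine (mu2 (X @^-1` A))) *+ 2.
Proof.
move=> mA ck hM M0.
have mXA : measurable (X @^-1` A) by rewrite -[X in measurable X]setTI; exact: mX.
have H (mu : {finite_measure set T -> \bar R}) (f : T -> R) : bmf D f ->
    (forall x, D x -> `|f x| <= M) ->
    `|Rintegral mu D (fun x => \1_A (X x) * f x)| <= M * fine (mu (X @^-1` A)).
  move=> bf hf.
  have -> : (fun x => \1_A (X x) * f x) = (f \_ (X @^-1` A)).
    apply/funext => x; rewrite patchE indicE.
    have -> : (x \in X @^-1` A) = (X x \in A) by apply/idP/idP; rewrite !inE.
    by case: ifP => _; rewrite ?mul1r ?mul0r.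
  rewrite -Rintegral_mkcondr.
  have mDA : measurable (D `&` X @^-1` A) by exact: measurableI.
  have bf' : bmf (D `&` X @^-1` A) f.
    split; last by exists M => x [Dx _]; exact: hf.
    exact: measurable_funS mD _ bf.1.
  apply: (@le_trans _ _ (M * fine (mu (D `&` X @^-1` A)))).
    by apply: le_Rintegral_bound => // x [Dx _]; exact: hf.
  rewrite ler_wpM2l// fine_le ?fin_num_measure//.
  by apply: le_measure; rewrite ?inE//; exact: subIsetr.
have HJ (f : T -> R) : bmf D f -> (forall x, D x -> `|f x| <= M) ->
    `|Jint mu1 mu2 D (fun x => \1_A (X x) * f x)| <=
    M * (fine (mu1 (X @^-1` A)) + fine (mu2 (X @^-1` A))).
  by move=> bf hf; rewrite /Jint (le_trans (ler_normB _ _))// mulrDr lerD// H.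
rewrite (le_trans (nc_le _))// mulr2n lerD//=.
  rewrite (_ : (fun x => _) = (fun x => \1_A (X x) * cRe (k x))).
    by apply: HJ; [exact: ck.1|move=> x Dx; exact: le_trans (le_Re_nc _) (hM x Dx)].
  by apply/funext => x; rewrite ReE /= mul0r subr0.
rewrite (_ : (fun x => _) = (fun x => \1_A (X x) * cIm (k x))).
  by apply: HJ; [exact: ck.2|move=> x Dx; exact: le_trans (le_Im_nc _) (hM x Dx)].
by apply/funext => x; rewrite ImE /= mul0r addr0.
Qed.

Section Kernel.
Variable k : T -> R[i].
Hypothesis ck : cbm k.
Hypothesis kernel0 : forall z, 0 < nc z < 1 -> IC (fun x => (zeta x - z)^-1 * k x) = 0.

Let uzeta x : D x -> nc (zeta x) = 1.
Proof. by move=> Dx; rewrite zetaX// nc_cis. Qed.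

(** The functions of [peak_null_approx] tend boundedly to the indicator of [P] at the angle: to 1
    over [P], and to 0 elsewhere because a point outside a compact set has positive distance to
    it. *)
Lemma compact_null_moment (P : set R) : compact P ->
  (forall s, P s -> - pi < s <= pi) -> (forall s, P s -> -4 <= s <= 4) ->
  lambda P = 0%E -> IC (fun x => (\1_P (X x))%:C%C * k x) = 0.
Proof.
move=> cP Ppi P4 P0.
have /choice [f hf] := fun n => peak_null_approx mD czeta uzeta ck kernel0 n cP Ppi P4 P0.
have [M M0 hM] := cbm_bound ck.
have e1 : 0 <= 1 + expR 1 :> R by rewrite addr_ge0// expR_ge0.
have inv0 : (n.+2%:R^-1 : R) @[n --> \oo] --> 0.
  by move: (@cvg_harmonic R); rewrite -cvg_shiftS.
have inv0c (c : R) : c / n.+2%:R @[n --> \oo] --> 0.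
  by rewrite -(mulr0 c); apply: cvgMr.
have [||||_ //] := @IC_lim0 _ _ _ mu1 mu2 D mD (fun n x => f n x * k x)
  (fun x => (\1_P (X x))%:C%C * k x) ((1 + expR 1) * M).
- by move=> n; apply: cbmM => //; have [] := hf n.
- move=> n x Dx; rewrite ncM; apply: ler_pM; rewrite ?nc_ge0 ?hM//.
  by have [_ _ + _ _] := hf n; apply.
- move=> x Dx.
  suff h : nc (f n x - (\1_P (X x))%:C%C) @[n --> \oo] --> 0.
    rewrite (_ : (fun n => _) = (fun n => nc (f n x - (\1_P (X x))%:C%C) * nc (k x))).
      by rewrite -(mul0r (nc (k x))); apply: cvgMl.
    by apply/funext => n; rewrite -mulrBl ncM.
  rewrite indicE; case: (boolP (X x \in P)) => [/set_mem PX|/negP PX].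
    apply: (squeeze_cvgr _ (cvg_cst 0) (inv0c (expR 1))).
    apply: nearW => n; rewrite nc_ge0/=; have [_ _ _ + _] := hf n.
    by move=> /(_ x (X x)); apply => //; exact: zetaX.
  have [b b0 hb] : exists2 b : R, 0 < b & forall s, P s -> b <= nc (zeta x - cis s).
    apply: compact_inf_gt0 => //.
      (* Both angles lie in ]-pi, pi], so equal points of the circle have equal angles. *)
      move=> s Ps; rewrite nc_gt0 subr_eq0 zetaX//; apply/eqP => /cis_inj h.
      by apply: PX; rewrite h ?Xpi ?Ppi//; exact/mem_set.
    move=> s e Ps e0; exists e => // t Pt st.
    rewrite lerBlDr -lerBlDl.
    have := ler_nc_dist (zeta x - cis s) (zeta x - cis t).
    rewrite (_ : zeta x - cis s - (zeta x - cis t) = cis t - cis s); last by ring.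
    move=> /le_trans; apply; rewrite (le_trans (chord_le _ _))// distrC; exact: ltW.
  have cexp : expR (2 / b / n.+2%:R) - 1 @[n --> \oo] --> (0 : R).
    have h0 : expR (2 / b / n.+2%:R) @[n --> \oo] --> expR (0 : R).
      by apply: continuous_cvg; [exact: continuous_expR|exact: inv0c].
    have := cvgB h0 (cvg_cst (1 : R)); rewrite expR0 subrr; exact.
  apply: (squeeze_cvgr _ (cvg_cst 0) cexp).
  apply: nearW => n; rewrite nc_ge0/= rmorph0 subr0; have [_ _ _ _ +] := hf n.
  by apply.
- by move=> n; have [] := hf n.
Qed.

Lemma null_moment (P : set R) : measurable P ->
  (forall s, P s -> - pi < s <= pi) ->
  lambda P = 0%E -> IC (fun x => (\1_P (X x))%:C%C * k x) = 0.
Proof.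
move=> mP Ppi P0.
have P4 s : P s -> -4 <= s <= 4.
  by move=> /Ppi /andP[h1 h2]; have p2 := pihalf_lt2 R; apply/andP; split; lra.
have [M M0 hM] := cbm_bound ck.
apply: Normc.eq0_normc; apply/eqP; rewrite eq_le nc_ge0 andbT.

rewrite -[leRHS]addr0; apply/ler_addgt0Pl => e e0; rewrite addr0.
have M1 : 0 < M + 1 by lra.
(* Each of the two measures loses e' outside the compact set and [le_IC_preimage] doubles, for a
   total of at most 4 (M + 1) e' = e; [M + 1] avoids dividing by 0. *)
pose e' := e / 4 / (M + 1); have e'0 : 0 < e' by rewrite !divr_gt0.
have [F1 [cF1 F1P hF1]] := regular_preimage mu1 mX mP e'0.
have [F2 [cF2 F2P hF2]] := regular_preimage mu2 mX mP e'0.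
pose F := F1 `|` F2.
have cF : closed F by exact: closedU.
have FP : F `<=` P by move=> s [/F1P|/F2P].
have mF : measurable F by exact: closed_measurable.
have cptF : compact F.
  apply: (@subclosed_compact _ F `[(-4 : R), 4]%classic) => //; first exact: segment_compact.
  by move=> s /FP /P4; rewrite /= in_itv.
have F0 : lambda F = 0%E.
  by apply/eqP; rewrite eq_le measure_ge0 andbT -P0; apply: le_measure; rewrite ?inE.
have cPF (A : set R) : measurable A -> cbm (fun x => (\1_A (X x))%:C%C * k x).
  by move=> mA; apply: cbmM => //; apply: cbm_real; exact: bmf_preimage_indic.
have mPF : measurable (P `\` F) by exact: measurableD.
have -> : IC (fun x => (\1_P (X x))%:C%C * k x) =
    IC (fun x => (\1_F (X x))%:C%C * k x + (\1_(P `\` F) (X x))%:C%C * k x).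
  apply: eq_IC => x _; rewrite -mulrDl -rmorphD; congr (_%:C%C * _).
  rewrite !indicE; case: (boolP (X x \in F)) => hF.
    rewrite mem_set; last by apply: FP; exact/set_mem.
    by rewrite memNset ?addr0// => -[_]; apply; exact/set_mem.
  rewrite add0r; congr (nat_of_bool _)%:R; apply/idP/idP => h; last first.
    by apply/mem_set; case: (set_mem h).
  by apply/mem_set; split; [exact/set_mem|move=> /mem_set; exact/negP].
rewrite ICD; [|exact: mD|exact: cPF|exact: cPF].
rewrite compact_null_moment// ?add0r; [|by move=> s /FP /Ppi|by move=> s /FP /P4].
have := @le_IC_preimage (P `\` F) k M mPF ck hM M0.
move=> /le_trans; apply.
have hm (mu : {finite_measure set T -> \bar R}) (F' : set R) : measurable F' -> F' `<=` F ->
    (mu (X @^-1` (P `\` F')) < e'%:E)%E -> fine (mu (X @^-1` (P `\` F))) <= e'.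
  move=> mF' F'F h; have mp (B : set R) : measurable B -> measurable (X @^-1` B).
    by move=> mB; rewrite -[X in measurable X]setTI; exact: mX.
  rewrite -lee_fin fineK ?fin_num_measure//; last exact: mp.
  apply: le_trans (ltW h); apply: le_measure; rewrite ?inE.
  - exact: mp.
  - by apply: mp; exact: measurableD.
  - by apply: preimage_subset; exact: setDS.
have h1 := hm mu1 F1 (closed_measurable cF1) (@subsetUl _ _ _) hF1.
have h2 := hm mu2 F2 (closed_measurable cF2) (@subsetUr _ _ _) hF2.
have h3 : M * (fine (mu1 (X @^-1` (P `\` F))) + fine (mu2 (X @^-1` (P `\` F)))) <=
    (M + 1) * (e' + e').
  by apply: ler_pM => //; rewrite ?addr_ge0 ?fine_ge0//; lra.
rewrite -mulr_natr; apply: (@le_trans _ _ ((M + 1) * (e' + e') * 2)); first by rewrite ler_wpM2r.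
rewrite le_eqVlt; apply/orP; left; apply/eqP; rewrite /e'; field.
by rewrite gt_eqF.
Qed.

End Kernel.
End NullSetMoments.

Section GraphOverNullSet.
Context d (T : measurableType d) (R : realType).
Variables (mu1 mu2 : {finite_measure set T -> \bar R}) (D : set T).
Hypothesis mD : measurable D.
Local Notation IC := (IC mu1 mu2 D).
Local Notation Jint := (Jint mu1 mu2 D).
Local Notation cbm := (cbm D).
Local Notation lambda := (@lebesgue_measure R).
Variables (zeta1 zeta2 : T -> R[i]) (X : T -> R).
Hypothesis czeta1 : cbm zeta1.
Hypothesis czeta2 : cbm zeta2.
Hypothesis mX : measurable_fun setT X.
Hypothesis Xpi : forall x, D x -> - pi < X x <= pi.
Hypothesis zetaX : forall x, D x -> zeta1 x = cis (X x).
Hypothesis uzeta2 : forall x, D x -> nc (zeta2 x) = 1.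
Hypothesis kernel_moment0 : forall z w, 0 < nc z < 1 -> 0 < nc w < 1 ->
  IC (fun x => (zeta1 x - z)^-1 * ((zeta2 x - w)^-1)^*%C) = 0.

Lemma Jint_indic (B : set T) : measurable B ->
  Jint (\1_B) = fine (mu1 (B `&` D)) - fine (mu2 (B `&` D)).
Proof. by move=> mB; rewrite /Jint /Rintegral !integral_indic. Qed.

Lemma null_moment_peak (P : set R) (r : R) (w : R[i]) : measurable P ->
  (forall s, P s -> - pi < s <= pi) -> lambda P = 0%E -> 0 < r < 1 -> nc w = 1 ->
  cbm (fun x => (\1_P (X x))%:C%C * (peak r w (zeta2 x))^*%C) /\
  IC (fun x => (\1_P (X x))%:C%C * (peak r w (zeta2 x))^*%C) = 0.
Proof.
move=> mP Ppi P0 r01 w1; have pd := pole_in_disc r01 w1; have /andP[_ pd1] := pd.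
pose k x := ((zeta2 x - (1 - r)%:C%C * w)^-1)^*%C.
have ck : cbm k by apply: cbm_conj; exact: (cbm_ker czeta2 uzeta2 pd1).
have c1 : cbm (fun x => (\1_P (X x))%:C%C * k x).
  by apply: cbmM => //; apply: cbm_real; exact: bmf_preimage_indic.
have e x : (\1_P (X x))%:C%C * (peak r w (zeta2 x))^*%C =
    (r%:C%C * w)^*%C * ((\1_P (X x))%:C%C * k x).
  by rewrite /peak rmorphM /=; ring.
split.
  by apply: (eq_cbm (fun x _ => esym (e x))); apply: cbmM => //; exact: cbm_cst.
rewrite (eq_IC mu1 mu2 (fun x _ => e x)) ICZ// (@null_moment _ _ _ mu1 mu2 D mD zeta1)//.
  by rewrite mulr0.
by move=> z z1; exact: kernel_moment0.
Qed.

Variable psi : R -> R.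
Hypothesis mpsi : measurable_fun setT psi.

(* Replacing psi by step functions with error r^2, the kernels [peak r (cis (psi (X x)))]
   at [zeta2 x] tend boundedly to the indicator of the graph as r tends to 0. *)
Lemma graph_null_moment (P : set R) (K : R) : measurable P ->
  (forall s, P s -> - pi < s <= pi) -> lambda P = 0%E ->
  (forall s, P s -> `|psi s| <= K) ->
  let Th := fun x => (\1_P (X x))%:C%C *
     (if zeta2 x == cis (psi (X x)) then 1 else 0) : R[i] in
  cbm Th /\ IC Th = 0.
Proof.
move=> mP Ppi P0 hK Th.
pose q (n : nat) : R := n.+3%:R.
have q0 n : 0 < q n by rewrite ltr0n.
have q3 n : 3 <= q n by rewrite ler_nat.
pose r n := (q n)^-1.
have r0 n : 0 < r n by rewrite invr_gt0.
have r3 n : r n <= 1 / 3 by rewrite div1r lef_pV2 ?posrE.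
have r01 n : 0 < r n < 1 by rewrite r0/=; have := r3 n; lra.
have r2 n : 0 < r n <= 1 / 2 by rewrite r0/=; have := r3 n; lra.
pose g n s := (psi s + K) * q n ^+ 2.
pose c n (j : nat) : R := j%:R * r n ^+ 2 - K.
pose tr n s := Num.truncn (g n s).
have g0 n s : P s -> 0 <= g n s.
  move=> /hK; rewrite ler_norml => /andP[h _].
  by rewrite mulr_ge0 ?sqr_ge0//; lra.
have trP n s : P s -> `|psi s - c n (tr n s)| <= r n ^+ 2.
  move=> /(g0 n) /truncn_itv; rewrite -/(tr n s) => /andP[h1 h2].
  have rq : r n ^+ 2 * q n ^+ 2 = 1 by rewrite -exprMn mulVf ?gt_eqF// expr1n.
  have rp : 0 < r n ^+ 2 by rewrite exprn_gt0.
  have e : r n ^+ 2 * g n s = psi s + K.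
    by rewrite /g mulrCA rq mulr1.
  have := ler_wpM2l (ltW rp) h1; rewrite e => h3.
  have := ler_wpM2l (ltW rp) (ltW h2); rewrite e -(natr1 (tr n s)) mulrDr mulr1 => h4.
  by rewrite /c ler_norml; apply/andP; split; lra.
pose N n := (Num.truncn (2 * K * q n ^+ 2)).+1.
have trN n s : P s -> (tr n s < N n)%N.
  move=> /hK; rewrite ler_norml => /andP[_ h]; rewrite ltnS; apply: le_truncn.
  by rewrite /g ler_wpM2r ?sqr_ge0//; lra.
pose Q n j : set R := P `&` (g n @^-1` `[j%:R, j.+1%:R[%classic).
have mQ n j : measurable (Q n j).
  apply: measurableI => //; rewrite -[X in measurable X]setTI.
  have mg : measurable_fun setT (g n).
    by apply: measurable_funM; [apply: measurable_funD|]; rewrite //; exact: measurable_cst.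
  by apply: mg => //; exact: measurable_itv.
have Qtr n j s : P s -> (s \in Q n j) = (tr n s == j).
  move=> Ps; apply/idP/eqP => [/set_mem[_]|<-].
    by rewrite /= in_itv/= => h; apply: truncn_def.
  by apply/mem_set; split => //; rewrite /= in_itv/= truncn_itv// g0.
(* In [F] the centre of the peak moves with [x]. Splitting [P] into the level sets [Q n j] of the
   rounded [psi] gives the finite sum [G], whose terms have fixed centres over null sets. *)
pose F n x := (\1_P (X x))%:C%C * (peak (r n) (cis (c n (tr n (X x)))) (zeta2 x))^*%C.
pose G n x := \sum_(j < N n) (\1_(Q n j) (X x))%:C%C * (peak (r n) (cis (c n j)) (zeta2 x))^*%C.
have FG n x : F n x = G n x.
  rewrite /F /G indicE; case: (boolP (X x \in P)) => [/set_mem XP|XP].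
    rewrite (bigD1 (Ordinal (trN n _ XP)))//= indicE Qtr// eqxx big1 ?addr0// => j jn.
    rewrite indicE Qtr// (_ : (_ == _) = false) ?mul0r//.
    by apply/negbTE; apply: contra jn => /eqP e; apply/eqP/val_inj.
  rewrite mul0r big1// => j _.
  have nQ : ~ Q n j (X x) by move=> [/mem_set h _]; move/negP: XP.
  by rewrite indicE memNset// mul0r.
have Q0 n j : lambda (Q n j) = 0%E.
  apply/eqP; rewrite eq_le measure_ge0 andbT -P0; apply: le_measure; rewrite ?inE//.
    exact: mQ.
  exact: subIsetl.
have QP n j s : Q n j s -> - pi < s <= pi by move=> [/Ppi].
have hG n (j : 'I_(N n)) := null_moment_peak (mQ n j) (@QP n j) (Q0 n j) (r01 n) (nc_cis (c n j)).
apply: (@IC_lim0 _ _ _ mu1 mu2 D mD F Th 1).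
- move=> n; rewrite (_ : F n = G n); last exact/funext/FG.
  by apply: cbm_sum => j _; have [] := hG n j.
- move=> n x Dx; rewrite /F ncM nc_conj nc_real indicE.
  have := peak_le1 (r01 n) (uzeta2 Dx) (nc_cis (c n (tr n (X x)))).
  by case: (_ \in _); rewrite ?normr1 ?normr0 ?mul1r ?mul0r.
- move=> x Dx; rewrite /F /Th indicE; case: (boolP (X x \in P)) => [/set_mem XP|XP]; last first.
    rewrite (_ : (fun n => _) = fun=> 0); first exact: cvg_cst.
    by apply/funext => n; rewrite !mul0r subr0 nc0.
  have rc : r n @[n --> \oo] --> 0.
    have h2 : (fun n => n.+2%:R^-1 : R) @ \oo --> 0.
      by move: (@cvg_harmonic R); rewrite -cvg_shiftS.
    by move: h2; rewrite -cvg_shiftS.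
  case: eqP => e.
    apply: (squeeze_cvgr _ (cvg_cst 0) rc); apply: nearW => n; rewrite nc_ge0/=.
    rewrite !mul1r -[in X in _ - X]conjc1 -rmorphB nc_conj.
    rewrite (le_trans (peak_near (r01 n) (uzeta2 Dx) (nc_cis _)))// e.
    rewrite ler_pdivrMr// -expr2 (le_trans (chord_le _ _))//; exact: trP.
  pose b := nc (zeta2 x - cis (psi (X x))).
  have b0 : 0 < b by rewrite nc_gt0 subr_eq0; exact/eqP.
  have lim0 : 4 / b * r n @[n --> \oo] --> 0.
    by rewrite -(mulr0 (4 / b)); apply: cvgMr.
  apply: (squeeze_cvgr _ (cvg_cst 0) lim0).
  have b2 : 0 < b / 2 by rewrite divr_gt0.
  apply: filterS (cvgr_le _ rc _ b2) => n rb; rewrite nc_ge0/=.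
  rewrite mul1r mulr0 subr0 nc_conj.
  have hb : b / 2 <= nc (zeta2 x - cis (c n (tr n (X x)))).
    have h1 : nc (cis (psi (X x)) - cis (c n (tr n (X x)))) <= r n ^+ 2.
      by rewrite (le_trans (chord_le _ _))//; exact: trP.
    have h2 : r n ^+ 2 <= r n.
      by rewrite expr2 ler_piMr ?(ltW (r0 n))//; have := r3 n; lra.
    have := ler_ncD (zeta2 x - cis (c n (tr n (X x)))) (cis (c n (tr n (X x))) - cis (psi (X x))).
    rewrite addrA subrK -/b (ncB (cis (c n _))); move: h1 h2 rb; lra.
  have := peak_far (r2 n) (uzeta2 Dx) (nc_cis _) b2 hb.
  have l0 : 0 <= 4 / b * r n by rewrite mulr_ge0 ?divr_ge0// ltW.
  move=> hp; rewrite -(@ler_pXn2r _ 2)// ?nnegrE ?nc_ge0//; apply: (le_trans hp).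
  rewrite (_ : 2 * r n ^+ 2 / (b / 2) ^+ 2 = 8 * (r n / b) ^+ 2); last by field; rewrite gt_eqF.
  rewrite (_ : (4 / b * r n) ^+ 2 = 16 * (r n / b) ^+ 2); last by field; rewrite gt_eqF.
  by have := sqr_ge0 (r n / b); lra.
- move=> n; rewrite (_ : F n = G n); last exact/funext/FG.
  rewrite IC_sum//; last by move=> j _; have [] := hG n j.
  by rewrite big1// => j _; have [] := hG n j.
Qed.

Hypothesis recover : forall B : set T, measurable B -> exists2 Q : set R, measurable Q &
  forall x, D x -> zeta2 x = cis (psi (X x)) -> (B x <-> Q (X x)).

(** By [recover], [B] is cut out of the graph by a Borel set [Q] of angles; [P] met with [Q] is
    again null, and its limit function [Th] is the indicator of [B] on [D]. *)
Lemma graph_over_null (P : set R) (K : R) (B : set T) : measurable P ->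
  (forall s, P s -> - pi < s <= pi) -> lambda P = 0%E ->
  (forall s, P s -> `|psi s| <= K) ->
  measurable B -> (forall x, B x -> [/\ D x, P (X x) & zeta2 x = cis (psi (X x))]) ->
  mu1 B = mu2 B.
Proof.
move=> mP Ppi P0 hK mB hB.
have [Q mQ hQ] := recover mB.
have mPQ : measurable (P `&` Q) by exact: measurableI.
have PQ0 : lambda (P `&` Q) = 0%E.
  by apply/eqP; rewrite eq_le measure_ge0 andbT -P0; apply: le_measure; rewrite ?inE.
have [] := graph_null_moment mPQ (fun s h => Ppi s h.1) PQ0 (fun s h => hK s h.1).
set Th := (fun x => _) => cTh ITh.
have : Jint (\1_B) = 0.
  rewrite -[RHS]/(cRe (0 : R[i])) -ITh /IC /=; apply: eq_Jint => x Dx.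
  rewrite !indicE /Th; case: eqP => e.
    rewrite mulr1 /=; congr (nat_of_bool _)%:R; apply/idP/idP => [/set_mem Bx|/set_mem[_ Qx]].
      by have [_ Px _] := hB _ Bx; apply/mem_set; split => //; exact/(hQ x Dx e).
    by apply/mem_set/(hQ x Dx e).
  rewrite mulr0 /= memNset// => Bx; by have [] := hB _ Bx.
rewrite Jint_indic//.
have -> : B `&` D = B by apply/setIidPl => x /hB [].
move=> /eqP; rewrite subr_eq0 => /eqP h.
by rewrite -(fineK (fin_num_measure mu1 _ mB)) h fineK ?fin_num_measure.
Qed.

End GraphOverNullSet.

(** * Vanishing of positive mass on bi-Lipschitz increasing graphs *)

Section PeakPairs.
Variable R : realType.
Implicit Types r s t x : R.

Lemma peak_cis r s x : peak r (cis s) (cis x) =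
  r%:C%C / Complex (cos (x - s) - 1 + r) (sin (x - s)).
Proof.
have cs0 : cis s != 0 :> R[i] by rewrite -nc_gt0 nc_cis.
have -> : Complex (cos (x - s) - 1 + r) (sin (x - s)) =
    (cis x - (1 - r)%:C%C * cis s) / cis s.
  apply: (canRL (mulfK cs0)); apply: eq_ReIm; rewrite /= cosB sinB.
    apply/eqP; rewrite -subr_eq0 (_ : _ - _ = cos x * (cos s ^+ 2 + sin s ^+ 2 - 1)).
      by rewrite cos2Dsin2 subrr mulr0.
    by ring.
  apply/eqP; rewrite -subr_eq0 (_ : _ - _ = sin x * (cos s ^+ 2 + sin s ^+ 2 - 1)).
    by rewrite cos2Dsin2 subrr mulr0.
  by ring.
by rewrite /peak invfM invrK mulrA mulrAC.
Qed.

(** Expanding leaves r^2 + (1 - u) (1 - v) + p q - r ((1 - u) + (1 - v)) with u, v the cosines and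
    p, q the sines. Since 1 - u <= p^2 <= 2 L p q, and likewise for v, the negative term is at most
    4 L r p q <= p q. *)
Lemma Re_pole_pair r (L t1 t2 : R) : 0 < r -> 1 <= L -> 4 * L * r <= 1 ->
  0 <= t1 <= 1 -> 0 <= t2 <= 1 -> t1 <= L * t2 -> t2 <= L * t1 ->
  r ^+ 2 <= (cos t1 - 1 + r) * (cos t2 - 1 + r) + sin t1 * sin t2.
Proof.
move=> r0 L1 Lr h1 h2 h12 h21; have /andP[t10 t11] := h1; have /andP[t20 t21] := h2.
have s1 := sin_ge_half h1; have s2 := sin_ge_half h2.
have s1' := sin_le_id t10; have s2' := sin_le_id t20.
have c1 : 1 / 2 <= cos t1 by apply: cos_ge_half; rewrite ger0_norm.
have c2 : 1 / 2 <= cos t2 by apply: cos_ge_half; rewrite ger0_norm.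
have e1 := cos2Dsin2 t1; have e2 := cos2Dsin2 t2.
have c1' := cos_le1 t1; have c2' := cos_le1 t2.
move: (cos t1) (cos t2) (sin t1) (sin t2) => u v p q in s1 s2 s1' s2' c1 c2 e1 e2 c1' c2' *.
have p0 : 0 <= p by lra.
have q0 : 0 <= q by lra.
have pq : p <= 2 * L * q.
  have : L * t2 <= L * (2 * q) by rewrite ler_wpM2l//; lra.
  lra.
have qp : q <= 2 * L * p.
  have : L * t1 <= L * (2 * p) by rewrite ler_wpM2l//; lra.
  lra.
have a1 : 1 - u <= p ^+ 2.
  have : (1 - u) * 1 <= (1 - u) * (1 + u) by rewrite ler_wpM2l//; lra.
  lra.
have a2 : 1 - v <= q ^+ 2.
  have : (1 - v) * 1 <= (1 - v) * (1 + v) by rewrite ler_wpM2l//; lra.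
  lra.
have b1 : p ^+ 2 <= 2 * L * q * p by rewrite expr2 ler_wpM2r.
have b2 : q ^+ 2 <= 2 * L * p * q by rewrite expr2 ler_wpM2r.
have k1 : r * ((1 - u) + (1 - v)) <= r * (4 * L * (p * q)).
  by rewrite ler_wpM2l ?(ltW r0)//; lra.
have k2 : (4 * L * r) * (p * q) <= 1 * (p * q) by rewrite ler_wpM2r// mulr_ge0.
have k3 : 0 <= (1 - u) * (1 - v) by rewrite mulr_ge0//; lra.
lra.
Qed.

(** Both sides have denominator |E|^2 |F|^2, and [Re_pole_pair] compares the numerators. The sign
    condition on the two differences is the place where monotonicity of the graph enters. *)
Lemma Re_peak_pair r (L x s y t : R) : 0 < r -> 1 <= L -> 4 * L * r <= 1 ->
  0 <= (x - s) * (y - t) -> `|x - s| <= 1 -> `|y - t| <= 1 ->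
  `|x - s| <= L * `|y - t| -> `|y - t| <= L * `|x - s| ->
  (nc (peak r (cis s) (cis x)) * nc (peak r (cis t) (cis y))) ^+ 2 <=
  cRe (peak r (cis s) (cis x) * (peak r (cis t) (cis y))^*%C).
Proof.
move=> r0 L1 Lr sg; rewrite !peak_cis; move: (x - s) (y - t) sg => a b sg a1 b1 ab ba.
have key : r ^+ 2 <= (cos a - 1 + r) * (cos b - 1 + r) + sin a * sin b.
  rewrite -(cos_norm a) -(cos_norm b).
  (* If the signs differ, the nonnegative product [a * b] is 0 and both sides vanish. *)
  have -> : sin a * sin b = sin `|a| * sin `|b|.
    case/orP: (le_total 0 a) => ha; case/orP: (le_total 0 b) => hb;
      rewrite ?(ger0_norm ha) ?(ler0_norm ha) ?(ger0_norm hb) ?(ler0_norm hb) ?sinN//.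
    - have : a * b <= 0 by exact: mulr_ge0_le0.
      move=> h; have /eqP : a * b = 0 by apply/eqP; rewrite eq_le h.
      by rewrite mulf_eq0 => /orP[/eqP->|/eqP->]; rewrite ?sin0; ring.
    - have : a * b <= 0 by exact: mulr_le0_ge0.
      move=> h; have /eqP : a * b = 0 by apply/eqP; rewrite eq_le h.
      by rewrite mulf_eq0 => /orP[/eqP->|/eqP->]; rewrite ?sin0; ring.
    - ring.
  by apply: (@Re_pole_pair r L) => //; rewrite normr_ge0.
set E := Complex _ _; set F := Complex (_ b - _ + _) _.
have rF : (r%:C%C / F)^*%C = r%:C%C / F^*%C.
  by rewrite rmorphM fmorphV /= oppr0.
have hE : sqmod E = (cos a - 1 + r) ^+ 2 + sin a ^+ 2 by [].
have sE : 0 <= sqmod E by rewrite /sqmod addr_ge0// sqr_ge0.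
have sF : 0 <= sqmod F by rewrite /sqmod addr_ge0// sqr_ge0.
have lhs : (nc (r%:C%C / E) * nc (r%:C%C / F)) ^+ 2 = r ^+ 2 * (r ^+ 2 / (sqmod E * sqmod F)).
  rewrite exprMn !sqr_nc -!sqr_nc !ncM !exprMn !ncV !exprVn nc_real real_normK ?num_real// !sqr_nc.
  by rewrite invfM; ring.
have rhs : cRe (r%:C%C / E * (r%:C%C / F)^*%C) =
   r ^+ 2 * (((cos a - 1 + r) * (cos b - 1 + r) + sin a * sin b) / (sqmod E * sqmod F)).
  rewrite rF !(ReE, ImE, Re_inv, Im_inv) /= !mul0r !subr0 !addr0.
  have -> : sqmod F^*%C = sqmod F by rewrite /sqmod /= sqrrN.
  rewrite invfM; ring.
rewrite lhs rhs ler_wpM2l ?sqr_ge0// ler_wpM2r// invr_ge0 mulr_ge0//.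
Qed.

Lemma peak_close r (c : R) (w z : R[i]) : 0 < r < 1 -> nc z = 1 -> nc w = 1 -> 0 <= c ->
  nc (z - w) <= c * r -> (1 + c ^+ 2)^-1 <= nc (peak r w z) ^+ 2.
Proof.
move=> r01 z1 w1 c0 h; have hp := pole_ge r01 z1 w1; case/andP: r01 => r0 r1.
have c2 : 0 < 1 + c ^+ 2 by rewrite ltr_wpDr// sqr_ge0.
have n0 : 0 < nc (z - (1 - r)%:C%C * w) by exact: lt_le_trans hp.
rewrite nc_peak// expr_div_n ler_pdivlMr ?exprn_gt0// mulrC ler_pdivrMr// pole_norm//.
have h2 : nc (z - w) ^+ 2 <= (c * r) ^+ 2.
  by rewrite lerXn2r ?nnegrE ?nc_ge0// mulr_ge0// ltW.
have h3 : (1 - r) * nc (z - w) ^+ 2 <= 1 * nc (z - w) ^+ 2 by rewrite ler_wpM2r ?sqr_ge0//; lra.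
lra.
Qed.

End PeakPairs.

Section PositiveSets.
Context d (T : measurableType d) (R : realType).
Variables (mu1 mu2 : {finite_measure set T -> \bar R}) (D : set T).
Hypothesis mD : measurable D.
Local Notation IC := (IC mu1 mu2 D).
Local Notation Jint := (Jint mu1 mu2 D).
Local Notation cbm := (cbm D).
Local Notation bmf := (bmf D).

Section Monotone.
Variable C : set T.
Hypothesis mC : measurable C.
Hypothesis CD : C `<=` D.
Hypothesis posC : forall B, measurable B -> B `<=` C -> (mu2 B <= mu1 B)%E.

Lemma Jint_indic_ge0 (B : set T) : measurable B -> B `<=` C -> 0 <= Jint (\1_B).
Proof.
move=> mB BC; rewrite Jint_indic// subr_ge0.
have -> : B `&` D = B by apply/setIidPl; exact: subset_trans CD.
by rewrite fine_le ?fin_num_measure//; exact: posC.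
Qed.

(** Rounding [g] on [C] down to multiples of 1 / q gives a nonnegative combination of indicators of
    subsets of [C], where [posC] applies; the error is at most mass / q <= e. *)
Lemma Jint_ge0 (g : T -> R) : bmf g -> (forall x, D x -> 0 <= g x) ->
  (forall x, D x -> ~ C x -> g x = 0) -> 0 <= Jint g.
Proof.
move=> bg g0 gC; have [M hM] := bg.2.
rewrite -[leRHS]addr0 -lerBlDl sub0r.
apply/ler_addgt0Pl => e e0; rewrite addr0.
have ms0 := mass_ge0 mu1 mu2 D.
pose q : R := (mass mu1 mu2 D + 1) / e.
have q0 : 0 < q by rewrite divr_gt0// ltr_wpDl.
pose N := (Num.truncn (q * M)).+1.
pose B (j : nat) : set T := (D `&` (g @^-1` `[j%:R / q, j.+1%:R / q[%classic)) `&` C.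
have mB j : measurable (B j).
  by apply: measurableI => //; apply: (bg.1 mD); exact: measurable_itv.
pose h x := \sum_(j < N) (j%:R / q) * \1_(B j) x : R.
have bB j : bmf (fun x => (j%:R / q) * \1_(B j) x).
  by apply: bmfM; [exact: bmf_cst|exact: bmf_indic].
have bsum (n : nat) : bmf (fun x => \sum_(j < n) (j%:R / q) * \1_(B j) x).
  elim: n => [|n ih].
    rewrite (_ : (fun x => _) = fun=> 0); first exact: bmf_cst.
    by apply/funext => x; rewrite big_ord0.
  rewrite (_ : (fun x => _) = (fun x => (\sum_(j < n) (j%:R / q) * \1_(B j) x) +
      (n%:R / q) * \1_(B n) x)); first exact: bmfD.
  by apply/funext => x; rewrite big_ord_recr.
have Jh (n : nat) : 0 <= Jint (fun x => \sum_(j < n) (j%:R / q) * \1_(B j) x).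
  elim: n => [|n ih].
    rewrite (@eq_Jint _ _ _ _ _ _ _ (fun=> 0 * 0)) => [|x _]; last by rewrite big_ord0 mulr0.
    by rewrite JintZ ?mul0r//; exact: bmf_cst.
  rewrite (@eq_Jint _ _ _ _ _ _ _ (fun x => (\sum_(j < n) (j%:R / q) * \1_(B j) x) +
      (n%:R / q) * \1_(B n) x)) => [|x _]; last by rewrite big_ord_recr.
  rewrite JintD// JintZ//; last exact: bmf_indic.
  have nq : 0 <= n%:R / q by apply: divr_ge0; [exact: ler0n|exact: ltW].
  rewrite addr_ge0// mulr_ge0//.
  by apply: Jint_indic_ge0 => // x [].
have gh x : D x -> `|g x - h x| <= q^-1.
  move=> Dx; rewrite /h; case: (pselect (C x)) => Cx; last first.
    rewrite gC// big1 ?subrr ?normr0 ?invr_ge0 ?(ltW q0)// => j _.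
    by rewrite indicE memNset ?mulr0// => -[].
  have qg : 0 <= q * g x by rewrite mulr_ge0 ?(ltW q0)// g0.
  pose j0 := Num.truncn (q * g x).
  have j0N : (j0 < N)%N.
    rewrite ltnS; apply: le_truncn; rewrite ler_wpM2l ?(ltW q0)//.
    by rewrite (le_trans (ler_norm _))// hM.
  have /andP[t1 t2] := truncn_itv qg.
  have Bj (j : nat) : (x \in B j) = (j == j0).
    apply/idP/eqP => [/set_mem[[_ /=]]|->].
      rewrite in_itv/= ler_pdivrMr// ltr_pdivlMr// (mulrC (g x)) => hj _.
      by apply/esym/truncn_def.
    apply/mem_set; split => //; split => //=.
    by rewrite in_itv/= ler_pdivrMr// ltr_pdivlMr// (mulrC (g x)) t1.
  rewrite (bigD1 (Ordinal j0N))//= indicE Bj eqxx mulr1 big1 ?addr0; last first.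
    move=> j jn; rewrite indicE Bj (_ : (_ == _) = false) ?mulr0//.
    by apply/negbTE; apply: contra jn => /eqP e'; apply/eqP/val_inj.
  have -> : g x - j0%:R / q = (q * g x - j0%:R) / q.
    by rewrite mulrBl (mulrC q) mulfK// gt_eqF.
  rewrite normrM ger0_norm ?subr_ge0// gtr0_norm ?invr_gt0//.
  by rewrite ler_piMl ?invr_ge0 ?(ltW q0)// lerBlDr addrC natr1 ltW.
have bgh : bmf (fun x => g x + - h x) by apply: bmfD => //; apply: bmfN; exact: bsum.
have := le_Jint mu1 mu2 mD bgh gh.
rewrite JintD//; last by apply: bmfN; exact: bsum.
rewrite JintN//; last exact: bsum.
rewrite ler_norml => /andP[h1 _].
have h2 : q^-1 * mass mu1 mu2 D <= e.
  rewrite /q invf_div -mulrA ler_piMr ?(ltW e0)// ler_pdivrMl ?mulr1; lra.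
by have := Jh N; rewrite -/h; lra.
Qed.

End Monotone.

Variables (zeta1 zeta2 : T -> R[i]) (X : T -> R).
Hypothesis czeta1 : cbm zeta1.
Hypothesis czeta2 : cbm zeta2.
Hypothesis mX : measurable_fun setT X.
Hypothesis Xpi : forall x, D x -> - pi < X x <= pi.
Hypothesis zetaX : forall x, D x -> zeta1 x = cis (X x).
Hypothesis uzeta2 : forall x, D x -> nc (zeta2 x) = 1.
Hypothesis kernel_moment0 : forall z w, 0 < nc z < 1 -> 0 < nc w < 1 ->
  IC (fun x => (zeta1 x - z)^-1 * ((zeta2 x - w)^-1)^*%C) = 0.

Let uzeta1 x : D x -> nc (zeta1 x) = 1.
Proof. by move=> Dx; rewrite zetaX// nc_cis. Qed.

Lemma peak_pair_moment (r : R) (v w : R[i]) : 0 < r < 1 -> nc v = 1 -> nc w = 1 ->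
  cbm (fun x => peak r v (zeta1 x) * (peak r w (zeta2 x))^*%C) /\
  IC (fun x => peak r v (zeta1 x) * (peak r w (zeta2 x))^*%C) = 0.
Proof.
move=> r01 v1 w1.
have pv := pole_in_disc r01 v1; have pw := pole_in_disc r01 w1.
have /andP[_ pv1] := pv; have /andP[_ pw1] := pw.
have c1 : cbm (fun x => (zeta1 x - (1 - r)%:C%C * v)^-1 *
    ((zeta2 x - (1 - r)%:C%C * w)^-1)^*%C).
  apply: cbmM; first exact: (cbm_ker czeta1 uzeta1 pv1).
  by apply: cbm_conj; exact: (cbm_ker czeta2 uzeta2 pw1).
have e x : peak r v (zeta1 x) * (peak r w (zeta2 x))^*%C =
   (r%:C%C * v * (r%:C%C * w)^*%C) * ((zeta1 x - (1 - r)%:C%C * v)^-1 *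
    ((zeta2 x - (1 - r)%:C%C * w)^-1)^*%C).
  by rewrite /peak (rmorphM _ (_ * w)); ring.
split.
  by apply: (eq_cbm (fun x _ => esym (e x))); apply: cbmM => //; exact: cbm_cst.
by rewrite (eq_IC mu1 mu2 (fun x _ => e x)) ICZ// kernel_moment0// mulr0.
Qed.

Variables (psi : R -> R) (P : set R) (L : R).
Hypothesis cP : compact P.
Hypothesis Ppi : forall s, P s -> - pi < s <= pi.
Hypothesis L1 : 1 <= L.
Hypothesis Pdiam : forall s t, P s -> P t -> `|s - t| <= 1 /\ `|psi s - psi t| <= 1.
Hypothesis Pmono : forall s t, P s -> P t -> 0 <= (s - t) * (psi s - psi t).
Hypothesis Plip : forall s t, P s -> P t ->
  `|psi s - psi t| <= L * `|s - t| /\ `|s - t| <= L * `|psi s - psi t|.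

Let P4 s : P s -> -4 <= s <= 4.
Proof.
by move=> /Ppi /andP[h1 h2]; have p2 := pihalf_lt2 R; apply/andP; split; lra.
Qed.

Let C : set T := [set x | D x /\ P (X x) /\ zeta2 x = cis (psi (X x))].

(* f is the real part of the sum over the occupied cells of [peak r (cis s)] at [zeta1] times the
   conjugate of [peak r (cis (psi s))] at [zeta2], with one s in P per cell of length r.
   On the graph every summand has nonnegative real part because psi is increasing, and the
   summand of the home cell is bounded below; Cauchy-Schwarz and the separation of the
   points bound the sum. *)
Lemma peak_sums_on_graph (n : nat) : exists f : T -> R,
  [/\ bmf f, Jint f = 0, (forall x, D x -> `|f x| <= 1152 * L ^+ 2),
    (forall x, C x -> (4 * L ^+ 2)^-1 <= f x) &
    (forall x (b : R), D x -> 0 < b ->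
      (forall s, P s -> b <= nc (zeta1 x - cis s) \/ b <= nc (zeta2 x - cis (psi s))) ->
      `|f x| <= (9 / b ^+ 2 + 1152 * L ^+ 2) / n.+3%:R)].
Proof.
pose q : R := n.+3%:R.
have q3 : 3 <= q by rewrite ler_nat.
have q0 : 0 < q by lra.
have L0 : 0 < L by exact: lt_le_trans ltr01 L1.
have LL : 1 <= L ^+ 2 by rewrite exprn_ege1.
have den0 : 0 < 4 * L * q ^+ 2 by rewrite !mulr_gt0 ?exprn_gt0.
(* Then 4 L r <= 1 / 9, as [Re_peak_pair] requires, and r q^2 <= 1, so that in the far estimate at
   most 9 / r terms q r^2 / c^2 add up to at most 9 / (c^2 q). *)
pose r : R := (4 * L * q ^+ 2)^-1.
have r0 : 0 < r by rewrite invr_gt0.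
have rq : 4 * L * r * q ^+ 2 = 1 by rewrite /r; field; rewrite !gt_eqF.
have q9 : 9 <= q ^+ 2 by have := ler_pM (ler0n _ _) (ler0n _ _) q3 q3; rewrite -expr2; lra.
have Lr : 4 * L * r <= 1 / 9.
  have := ler_wpM2l (_ : 0 <= 4 * L * r) q9; rewrite rq.
  by rewrite !mulr_ge0 ?(ltW L0) ?(ltW r0)// => /(_ isT); lra.
have rL : r <= L * r by rewrite ler_peMl// ltW.
have r2 : 0 < r <= 1 / 2 by rewrite r0/=; lra.
have r01 : 0 < r < 1 by rewrite r0/=; lra.
pose N := ncells r; pose A := occupied P r.
have [p hp] := occupied_pick P r.
have pP j : A j -> P (p j) by move=> /hp [].
have pc j : A j -> cell r (p j) = j by move=> /hp [].
have p4 j : A j -> -4 <= p j by move=> /pP /P4 /andP[].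
pose a j x := peak r (cis (p j)) (zeta1 x).
pose b j x := peak r (cis (psi (p j))) (zeta2 x).
pose F x := \sum_(j < N | A j) a j x * (b j x)^*%C.
have hF (j : 'I_N) := peak_pair_moment r01 (nc_cis (p j)) (nc_cis (psi (p j))).
have cF : cbm F by apply: cbm_sum => j _; have [] := hF j.
have suma x : D x -> \sum_(j < N | A j) nc (a j x) ^+ 2 <= 1152 * L ^+ 2.
  move=> Dx; apply: (@le_trans _ _ (1152 * 1 ^+ 2)); last by rewrite expr1n; lra.
  apply: (@sum_peak_bound R A N p 1 r) => //; first exact: uzeta1.
    by move=> j l /pP Pj /pP Pl; have [] := Pdiam Pj Pl.
  by move=> j l Aj Al; rewrite mul1r -{1}(pc _ Aj) -{1}(pc _ Al) cell_far ?p4.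
have sumb x : D x -> \sum_(j < N | A j) nc (b j x) ^+ 2 <= 1152 * L ^+ 2.
  move=> Dx; apply: (@sum_peak_bound R A N (psi \o p) L r) => //; first exact: uzeta2.
    by move=> j l /pP Pj /pP Pl; have [] := Pdiam Pj Pl.
  move=> j l Aj Al; have [_ h] := Plip (pP _ Aj) (pP _ Al).
  by apply: le_trans h; rewrite -{1}(pc _ Aj) -{1}(pc _ Al) cell_far ?p4.
exists (fun x => cRe (F x)); split.
- exact: cF.1.
- have : IC F = 0 by rewrite IC_sum ?big1// => j _; have [] := hF j.
  by move=> /(congr1 (@complex.Re R)).
- move=> x Dx; rewrite (le_trans (le_Re_nc _))// (le_trans (nc_sum _ _ _))//.
  apply: (@le_trans _ _ (\sum_(j < N | A j) (nc (a j x) ^+ 2 / 2 + nc (b j x) ^+ 2 / 2))).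
    apply: ler_sum => j _; rewrite ncM nc_conj.
    have := sqr_ge0 (nc (a j x) - nc (b j x)); lra.
  rewrite big_split /= -!mulr_suml; have := suma x Dx; have := sumb x Dx; lra.
- move=> x [Dx [Px zx]]; rewrite Re_sum.
  have pos j : A j -> (nc (a j x) * nc (b j x)) ^+ 2 <= cRe (a j x * (b j x)^*%C).
    move=> Aj; rewrite /a /b zetaX// zx; have Pj := pP _ Aj.
    have [d1 d2] := Pdiam Px Pj; have [l1 l2] := Plip Px Pj.
    by apply: (@Re_peak_pair R r L) => //; [lra|exact: Pmono].
  pose j0 : 'I_N := Ordinal (cell_lt r0 (P4 Px)).
  have Aj0 : A j0 by apply/asboolP; exists (X x).
  rewrite (bigD1 j0)//=.
  have rest : 0 <= \sum_(j < N | A j && (j != j0)) cRe (a j x * (b j x)^*%C).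
    apply: sumr_ge0 => j /andP[Aj _]; apply: le_trans (pos _ Aj); exact: sqr_ge0.
  apply: (@le_trans _ _ ((nc (a j0 x) * nc (b j0 x)) ^+ 2)); last first.
    by have := pos _ Aj0; lra.
  have near0 : `|X x - p j0| <= r.
    apply/ltW/cell_near => //; [by have /andP[] := P4 Px|exact: p4|by rewrite pc].
  have h1 : (1 + 1 ^+ 2)^-1 <= nc (a j0 x) ^+ 2.
    apply: peak_close => //; [exact: uzeta1|exact: nc_cis|].
    by rewrite zetaX// mul1r (le_trans (chord_le _ _)).
  have h2 : (1 + L ^+ 2)^-1 <= nc (b j0 x) ^+ 2.
    apply: peak_close => //; [exact: uzeta2|exact: nc_cis|exact: ltW|].
    rewrite zx (le_trans (chord_le _ _))//; have [h _] := Plip Px (pP _ Aj0).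
    by rewrite (le_trans h)// ler_wpM2l// ltW.
  rewrite exprMn; apply: (@le_trans _ _ ((1 + 1 ^+ 2)^-1 * (1 + L ^+ 2)^-1)); last first.
    by apply: ler_pM => //; rewrite invr_ge0 addr_ge0 ?sqr_ge0.
  rewrite -invfM lef_pV2 ?posrE ?mulr_gt0 ?ltr_wpDr ?sqr_ge0 ?exprn_gt0// expr1n; lra.
- move=> x c Dx c0 hc; have c2 : 0 < c ^+ 2 by rewrite exprn_gt0.
  rewrite (le_trans (le_Re_nc _))// (le_trans (nc_sum _ _ _))//.
  apply: (@le_trans _ _ (\sum_(j < N | A j) (q * (r ^+ 2 / c ^+ 2) +
      (nc (a j x) ^+ 2 + nc (b j x) ^+ 2) / (2 * q)))).
    apply: ler_sum => j Aj; rewrite ncM nc_conj.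
    have u0 := nc_ge0 (a j x); have v0 := nc_ge0 (b j x).
    (* Weighted inequality u v <= q u^2 / 2 + v^2 / (2 q), where [u] is the peak whose centre is
       far. The weight q leaves a factor 1 / q on the square sums, which are merely bounded. *)
    have am (u v : R) : u ^+ 2 <= 2 * r ^+ 2 / c ^+ 2 ->
        u * v <= q * (r ^+ 2 / c ^+ 2) + (u ^+ 2 + v ^+ 2) / (2 * q).
      move=> hu; have k1 : q * u ^+ 2 <= q * (2 * r ^+ 2 / c ^+ 2) by rewrite ler_wpM2l// ltW.
      have k2 : 0 <= u ^+ 2 / (2 * q) by rewrite divr_ge0 ?sqr_ge0// mulr_ge0// ltW.
      have k3 : 0 <= (q * u - v) ^+ 2 / (2 * q) by rewrite divr_ge0 ?sqr_ge0// mulr_ge0// ltW.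
      have k4 : (q * u - v) ^+ 2 / (2 * q) = q * u ^+ 2 / 2 - u * v + v ^+ 2 / (2 * q).
        by field; rewrite gt_eqF.
      rewrite k4 in k3; have k5 : q * u ^+ 2 <= 2 * (q * (r ^+ 2 / c ^+ 2)).
        by rewrite (le_trans k1)// le_eqVlt; apply/orP; left; apply/eqP; ring.
      rewrite [(u ^+ 2 + _) / _]mulrDl.
      move: k2 k3 k5; move: (u ^+ 2 / _) (v ^+ 2 / _) (q * (r ^+ 2 / _)) (q * u ^+ 2) (u * v).
      move=> ? ? ? ? ?; lra.
    have [h|h] := hc _ (pP _ Aj).
      by apply: am; exact: (peak_far r2 (uzeta1 Dx) (nc_cis _) c0 h).
    rewrite mulrC (addrC (nc (a j x) ^+ 2)).
    by apply: am; exact: (peak_far r2 (uzeta2 Dx) (nc_cis _) c0 h).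
  rewrite big_split /= -[X in _ + X <= _]mulr_suml [X in _ + X / _ <= _]big_split /=.
  have s1 := suma x Dx; have s2 := sumb x Dx.
  have q2 : 0 < 2 * q by rewrite mulr_gt0.
  have e1 : (\sum_(j < N | A j) nc (a j x) ^+ 2 + \sum_(j < N | A j) nc (b j x) ^+ 2) / (2 * q)
      <= 1152 * L ^+ 2 / q.
    rewrite ler_pdivrMr// (_ : 1152 * L ^+ 2 / q * (2 * q) = 2 * (1152 * L ^+ 2)); last by field; rewrite gt_eqF.
    lra.
  have e2 : \sum_(j < N | A j) q * (r ^+ 2 / c ^+ 2) <= 9 / c ^+ 2 / q.
    have qr0 : 0 <= q * (r ^+ 2 / c ^+ 2) by apply: mulr_ge0; [exact: ltW|apply: divr_ge0; exact: sqr_ge0].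
    apply: (@le_trans _ _ (\sum_(j < N) q * (r ^+ 2 / c ^+ 2))).
      by rewrite big_mkcond /=; apply: ler_sum => j _; case: ifP.
    rewrite sumr_const card_ord -[_ *+ N]mulr_natl.
    have Nr : N%:R * r <= 9 by have := ncells_le r0; rewrite -/N; lra.
    have -> : N%:R * (q * (r ^+ 2 / c ^+ 2)) = (N%:R * r) * (r * q ^+ 2) / c ^+ 2 / q.
      by field; rewrite !gt_eqF.
    rewrite ler_wpM2r ?invr_ge0 ?(ltW q0)// ler_wpM2r ?invr_ge0 ?(ltW c2)//.
    have rq1 : r * q ^+ 2 <= 1.
      have : r * q ^+ 2 <= (4 * L * r) * q ^+ 2.
        by rewrite ler_wpM2r ?sqr_ge0//; lra.
      by rewrite rq.
    rewrite -[leRHS]mulr1; apply: ler_pM => //; rewrite ?mulr_ge0 ?ler0n ?sqr_ge0 ?(ltW r0)//.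
  by rewrite -/q [leRHS]mulrDl; apply: lerD.
Qed.

(** Split f n into [v n] on the graph and [u n] off it. By positivity a fixed multiple of the mass
    of [C] is at most Jint (v n) = - Jint (u n), and this tends to 0. *)
Lemma positive_graph_null : measurable C ->
  (forall B, measurable B -> B `<=` C -> (mu2 B <= mu1 B)%E) -> mu1 C = mu2 C.
Proof.
move=> mC posC.
have CD : C `<=` D by move=> x [].
have [K [f hf]] : exists K : R, exists f : nat -> T -> R, forall n,
    [/\ bmf (f n), Jint (f n) = 0, (forall x, D x -> `|f n x| <= K),
    (forall x, C x -> (4 * L ^+ 2)^-1 <= f n x) &
    (forall x (b : R), D x -> 0 < b ->
      (forall s, P s -> b <= nc (zeta1 x - cis s) \/ b <= nc (zeta2 x - cis (psi s))) ->
      `|f n x| <= (9 / b ^+ 2 + K) / n.+3%:R)].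
  have /choice [f hf] := peak_sums_on_graph; exists (1152 * L ^+ 2), f; exact: hf.
pose u n x := f n x * \1_(~` C) x : R; pose v n x := f n x * \1_C x : R.
have bi (B : set T) : measurable B -> bmf (\1_B : T -> R) by move=> mB; exact: bmf_indic.
have bf n : bmf (f n) by have [] := hf n.
have bu n : bmf (u n) by apply: bmfM => //; apply: bi; exact: measurableC.
have bv n : bmf (v n) by apply: bmfM => //; exact: bi.
have uv n : Jint (u n) + Jint (v n) = 0.
  rewrite -JintD//; have [_ <- _ _ _] := hf n; apply: eq_Jint => x _.
  rewrite /u /v -mulrDr !indicE in_setC; case: (x \in C) => /=; ring.
have c0 : 0 < (4 * L ^+ 2)^-1.
  by rewrite invr_gt0 mulr_gt0// exprn_gt0// (lt_le_trans ltr01 L1).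
have Jv n : (4 * L ^+ 2)^-1 * Jint (\1_C) <= Jint (v n).
  rewrite -JintZ//; last exact: bi.
  have bc : bmf (fun x => (4 * L ^+ 2)^-1 * \1_C x).
    by apply: bmfM; [exact: bmf_cst|exact: bi].
  rewrite -subr_ge0 -JintN// -JintD//; last exact: bmfN.
  apply: (Jint_ge0 mC CD posC); first by apply: bmfD => //; exact: bmfN.
    move=> x Dx; rewrite /v -mulrBl indicE; case: (boolP (x \in C)) => [/set_mem Cx|_].
      by rewrite mulr1 subr_ge0; have [_ _ _ + _] := hf n; apply.
    by rewrite mulr0.
  by move=> x Dx Cx; rewrite /v indicE memNset// !mulr0 subrr.
have limu : Jint (u n) @[n --> \oo] --> Jint (fun=> 0).
  apply: (@Jint_cvg _ _ _ mu1 mu2 D mD u (fun=> 0) K).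
  - by move=> n; have [] := bu n.
  - move=> n x Dx; rewrite /u normrM indicE.
    have [_ _ + _ _] := hf n; move=> /(_ x Dx) h.
    by case: (_ \in _); rewrite ?normr1 ?normr0 ?mulr1 ?mulr0 ?h// (le_trans _ h).
  - move=> x Dx; rewrite /u indicE; case: (boolP (x \in ~` C)) => [/set_mem nC|_]; last first.
      by rewrite (_ : (fun n => _) = fun=> 0); [exact: cvg_cst|apply/funext => n; rewrite mulr0].
    (* Off [C] the point differs from each graph point over [P] in some coordinate; the Lipschitz
       bound makes [g] continuous on the compact [P], which yields one distance [b] for all of
       them. *)
    pose g s := Num.max (nc (zeta1 x - cis s)) (nc (zeta2 x - cis (psi s))).
    have [b b0 hb] : exists2 b : R, 0 < b & forall s, P s -> b <= g s.
      apply: compact_inf_gt0 => //.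
        move=> s Ps; rewrite /g lt_max !nc_gt0 !subr_eq0 -negb_and; apply/negP => /andP[/eqP e1 /eqP e2].
        have Xs : X x = s by apply: cis_inj; [exact: Xpi|exact: Ppi|rewrite -zetaX].
        by apply: nC; split => //; rewrite Xs.
      move=> s e Ps e0; have L0 : 0 < L by exact: lt_le_trans ltr01 L1.
      exists (e / L); first by rewrite divr_gt0.
      move=> t Pt; rewrite ltr_pdivlMr// mulrC => st.
      have [h1 _] := Plip Ps Pt.
      have lip (z : R[i]) (a c : R) : `|a - c| <= e -> nc (z - cis a) - e <= nc (z - cis c).
        move=> h; have := ler_nc_dist (z - cis a) (z - cis c).
        rewrite (_ : z - cis a - (z - cis c) = cis c - cis a); last by ring.
        have := chord_le c a; rewrite distrC; lra.
      rewrite /g le_max; case/orP: (le_total (nc (zeta1 x - cis s)) (nc (zeta2 x - cis (psi s)))) => h.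
        by rewrite max_r//; apply/orP; right; apply: lip; apply: le_trans h1 (ltW st).
      rewrite max_l//; apply/orP; left; apply: lip; apply: le_trans (ltW st).
      by rewrite ler_peMl.
    have lim0 : (9 / b ^+ 2 + K) / n.+3%:R @[n --> \oo] --> 0.
      have h2 : (fun n => n.+2%:R^-1 : R) @ \oo --> 0.
        by move: (@cvg_harmonic R); rewrite -cvg_shiftS.
      have h3 : (fun n => n.+3%:R^-1 : R) @ \oo --> 0 by move: h2; rewrite -cvg_shiftS.
      by rewrite -(mulr0 (9 / b ^+ 2 + K)); apply: cvgMr.
    apply/norm_cvg0P.
    apply: (squeeze_cvgr _ (cvg_cst 0) lim0); apply: nearW => n; rewrite normr_ge0/= mulr1.
    have [_ _ _ _ h] := hf n; apply: h => // s Ps.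
    by have := hb s Ps; rewrite /g le_max => /orP.
have J0 : Jint (fun=> 0) = 0.
  rewrite (@eq_Jint _ _ _ _ _ _ _ (fun=> 0 * 0)) => [|x _]; last by rewrite mulr0.
  by rewrite JintZ ?mul0r//; exact: bmf_cst.
rewrite J0 in limu.
have le0 : (4 * L ^+ 2)^-1 * Jint (\1_C) <= 0.
  rewrite -oppr0; apply: (ler_cvg_to (cvg_cst _) (cvgN limu)).
  apply: nearW => n; rewrite -[leRHS]/(- Jint (u n)).
  have /eqP := uv n; rewrite addrC addr_eq0 => /eqP <-; exact: Jv.
have ge0 := Jint_indic_ge0 CD posC mC (@subset_refl _ C).
have e0 : Jint (\1_C) = 0.
  by apply/eqP; rewrite eq_le ge0 andbT -(ler_pM2l c0) mulr0.
move: e0; rewrite Jint_indic//.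
have -> : C `&` D = C by apply/setIidPl.
move=> /eqP; rewrite subr_eq0 => /eqP h.
by rewrite -(fineK (fin_num_measure mu1 _ mC)) h fineK ?fin_num_measure.
Qed.

End PositiveSets.

(** * Sets on which the two measures agree *)

Section Balanced.
Context d (T : measurableType d) (R : realType).
Variables mu1 mu2 : {finite_measure set T -> \bar R}.

(** Nullity for mu1 - mu2. Testing measurable subsets only, it makes sense for [PhiGraph psi]
    without proving that set measurable, and it passes to subsets. *)
Definition balanced (S : set T) :=
  forall B, measurable B -> B `<=` S -> mu1 B = mu2 B.

Lemma balanced_sub (S S' : set T) : S' `<=` S -> balanced S -> balanced S'.
Proof. by move=> SS' h B mB BS'; apply: h => //; exact: subset_trans SS'. Qed.

Lemma balanced_bigcup_nat (S : nat -> set T) : (forall n, measurable (S n)) ->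
  (forall n, balanced (S n)) -> balanced (\bigcup_n S n).
Proof.
move=> mS hS B mB BS.
pose F := seqDU (fun n => B `&` S n).
have mF n : measurable (F n) by apply: seqDU_measurable => k; exact: measurableI.
have BF : B = \bigcup_n F n.
  by rewrite -seqDU_bigcup_eq -setI_bigcupr; apply/esym/setIidPl.
rewrite BF !measure_bigcup//; try exact: trivIset_seqDU.
apply: eq_eseriesr => n _; apply: (hS n) => // x Fx; by have [] := subset_seqDU Fx.
Qed.

Lemma balanced0 : balanced set0.
Proof. by move=> B _; rewrite subset0 => ->; rewrite !measure0. Qed.

Lemma balanced_setU (S S' : set T) : measurable S -> measurable S' ->
  balanced S -> balanced S' -> balanced (S `|` S').
Proof.
move=> mS mS' hS hS'; rewrite -bigcup2E.
by apply: balanced_bigcup_nat => -[|[|n]] //=; exact: balanced0.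
Qed.

Lemma balanced_bigcup (I : countType) (S : I -> set T) : (forall i, measurable (S i)) ->
  (forall i, balanced (S i)) -> balanced (\bigcup_i S i).
Proof.
move=> mS hS; pose F n := if unpickle n is Some i then S i else set0.
apply: (@balanced_sub (\bigcup_n F n)).
  by move=> x [i _ Six]; exists (pickle i) => //; rewrite /F pickleK.
apply: balanced_bigcup_nat => n; rewrite /F; case: (unpickle n) => [i|].
- exact: mS.
- exact: measurable0.
- exact: hS.
- exact: balanced0.
Qed.

Lemma hahn_split : exists P N : set T, [/\ measurable P, measurable N, P `|` N = setT &
  (forall B, measurable B -> B `<=` P -> (mu2 B <= mu1 B)%E) /\
  (forall B, measurable B -> B `<=` N -> (mu1 B <= mu2 B)%E)].
Proof.
pose nu := cadd (charge_of_finite_measure mu1) (copp (charge_of_finite_measure mu2)).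
have [P [N [[mP hP] [mN hN] PN _]]] := Hahn_decomposition nu.
exists P, N; split => //; split=> B mB BP.
  by have := hP B mB BP; rewrite /nu /cadd /copp/= sube_ge0// fin_num_measure.
by have := hN B mB BP; rewrite /nu /cadd /copp/= sube_le0.
Qed.

End Balanced.

(** * Reduction to compact sets of angles and measures of one sign *)

Section CompactReduction.
Context d (T : measurableType d) (R : realType).
Variables (X : T -> R) (G : set T) (E : set R).
Hypothesis mX : measurable_fun setT X.
Hypothesis mG : measurable G.
Hypothesis mE : measurable E.
Hypothesis EX : forall x, G x -> E (X x).
Hypothesis bE : exists a b, E `<=` `[a, b].
Hypothesis recover : forall B, measurable B -> exists2 Q : set R, measurable Q &
  forall x, G x -> (B x <-> Q (X x)).

(** One inequality is positivity. For the other, exhaust the angles of [B] from inside by a compact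
    [F] up to e in [nu1]: over [F] the measures agree, and that part lies in [B]. *)
Lemma eq_measure_of_positive (nu1 nu2 : {finite_measure set T -> \bar R}) (B : set T) :
  (forall F, compact F -> F `<=` E ->
    (forall B, measurable B -> B `<=` G `&` X @^-1` F -> (nu2 B <= nu1 B)%E) ->
    nu1 (G `&` X @^-1` F) = nu2 (G `&` X @^-1` F)) ->
  measurable B -> B `<=` G ->
  (forall B', measurable B' -> B' `<=` B -> (nu2 B' <= nu1 B')%E) -> nu1 B = nu2 B.
Proof.
move=> H mB BG pos.
have [Q mQ hQ] := recover mB.
have mp (F : set R) : measurable F -> measurable (X @^-1` F).
  by move=> mF; rewrite -[X in measurable X]setTI; exact: mX.
apply/eqP; rewrite eq_le (pos _ mB)// andbT.
apply/lee_addgt0Pr => e e0.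
have mQE : measurable (Q `&` E) by exact: measurableI.
have [F [cF FQ hF]] := regular_preimage nu1 mX mQE e0.
have mF : measurable F by exact: closed_measurable.
have FE : F `<=` E by move=> x /FQ[].
have kF : compact F.
  by have [a [b hab]] := bE; apply: (subclosed_compact cF (@segment_compact _ a b));
    exact: subset_trans hab.
have CB : G `&` X @^-1` F `<=` B by move=> x [Gx /FQ[Qx _]]; apply/hQ.
have mC : measurable (G `&` X @^-1` F) by apply: measurableI => //; exact: mp.
have mQF : measurable (X @^-1` ((Q `&` E) `\` F)) by apply: mp; exact: measurableD.
apply: (@le_trans _ _ (nu1 (G `&` X @^-1` F) + nu1 (X @^-1` ((Q `&` E) `\` F)))%E).
  apply: (le_trans _ (measureU2 _ _ _)) => //.
  apply: le_measure; rewrite ?inE//; first exact: measurableU.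
  move=> x Bx; have Gx := BG _ Bx; case: (pselect (F (X x))) => Fx; [by left|right].
  by split => //; split; [exact/(hQ x Gx)|exact: EX].
apply: leeD; last exact: ltW.
rewrite (H F kF FE); first by apply: le_measure; rewrite ?inE.
by move=> B' mB' B'C; apply: pos => //; exact: subset_trans CB.
Qed.

(** The two hypotheses are the same principle for mu1 - mu2 and for its negative, applied on the two
    halves of a Hahn decomposition. *)
Lemma balanced_of_compact (mu1 mu2 : {finite_measure set T -> \bar R}) :
  (forall F, compact F -> F `<=` E ->
    (forall B, measurable B -> B `<=` G `&` X @^-1` F -> (mu2 B <= mu1 B)%E) ->
    mu1 (G `&` X @^-1` F) = mu2 (G `&` X @^-1` F)) ->
  (forall F, compact F -> F `<=` E ->
    (forall B, measurable B -> B `<=` G `&` X @^-1` F -> (mu1 B <= mu2 B)%E) ->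
    mu2 (G `&` X @^-1` F) = mu1 (G `&` X @^-1` F)) ->
  balanced mu1 mu2 G.
Proof.
move=> H1 H2; have [P [N [mP mN PN [hP hN]]]] := hahn_split mu1 mu2.
apply: (@balanced_sub _ _ _ _ _ ((G `&` P) `|` (G `&` N))).
  by rewrite -setIUr PN setIT.
apply: balanced_setU.
- exact: measurableI.
- exact: measurableI.
- move=> B mB BG; apply: (eq_measure_of_positive H1) => //.
    by move=> x /BG[].
  by move=> B' mB' B'B; apply: hP => // x /B'B/BG[].
- move=> B mB BG; apply/esym; apply: (eq_measure_of_positive H2) => //.
    by move=> x /BG[].
  by move=> B' mB' B'B; apply: hN => // x /B'B/BG[].
Qed.

End CompactReduction.

(** * Angular coordinates *)

Section Angles.
Variable R : realType.

(* The clamping is vacuous on the circle; it makes the function monotone in [p.1], hence measurable. *)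
Definition angle (p : R * R) : R :=
  let a := acos (Num.max (-1) (Num.min 1 p.1)) in if 0 <= p.2 then a else - a.

Lemma acos_ni (x y : R) : -1 <= x -> y <= 1 -> x <= y -> acos y <= acos x.
Proof.
move=> x1 y1 xy; have xI : x \in `[(-1), 1] by rewrite in_itv/= x1 (le_trans xy).
have yI : y \in `[(-1), 1] by rewrite in_itv/= y1 (le_trans x1).
have pI (z : R) : z \in `[(-1), 1] -> acos z \in `[0, pi].
  by rewrite !in_itv/= => h; rewrite acos_ge0 ?acos_lepi.
by rewrite leNgt -(ltr_cos (pI _ xI) (pI _ yI)) !acosK// -leNgt.
Qed.

Lemma measurable_angle : measurable_fun setT angle.
Proof.
have mc : measurable_fun setT (fun x : R => acos (Num.max (-1) (Num.min 1 x))).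
  apply: nonincreasing_measurable => // x y xy.
  have h : -1 <= 1 :> R by lra.
  apply: acos_ni; first by rewrite le_max lexx.
    by rewrite ge_max ge_min lexx h.
  have hm : Num.min 1 x <= Num.min 1 y by rewrite le_min ge_min lexx/= ge_min xy orbT.
  by rewrite ge_max le_max lexx/= le_max hm orbT.
have m1 : measurable_fun setT (fun p : R * R => acos (Num.max (-1) (Num.min 1 p.1))).
  exact: measurableT_comp mc measurable_fst.
apply: measurable_fun_ifT => //; last exact: measurable_funN.
by apply: measurable_fun_ler => //; exact: measurable_snd.
Qed.

Lemma angleP (p : R * R) : p.1 ^+ 2 + p.2 ^+ 2 = 1 ->
  [/\ - pi < angle p <= pi, cos (angle p) = p.1 & sin (angle p) = p.2].
Proof.
move=> h; have p2 : p.1 ^+ 2 <= 1 by rewrite -h lerDl sqr_ge0.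
have /andP[p3 p4] : -1 <= p.1 <= 1 by apply/andP; split; nra.
have sI : sin (acos p.1) = `|p.2|.
  by rewrite sin_acos ?p3// (_ : 1 - _ = p.2 ^+ 2) ?sqrtr_sqr//; lra.
have cI : cos (acos p.1) = p.1 by rewrite acosK// in_itv/= p3.
have a0 : 0 <= acos p.1 by rewrite acos_ge0 ?p3.
have api : acos p.1 <= pi by rewrite acos_lepi ?p3.
have pi0 := pi_gt0 R.
rewrite /angle min_r// max_r//; case: ifPn => q.
  by rewrite sI ger0_norm// cI; split => //; rewrite api andbT; lra.
rewrite -ltNge in q; rewrite cosN sinN sI cI ltr0_norm// opprK; split => //.
have : acos p.1 < pi.
  apply: acos_ltpi; rewrite p4 andbT lt_neqAle p3 andbT.
  apply/eqP => e; move: h; rewrite -e sqrrN expr1n => h.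
  by have := exprn_even_gt0 p.2 (isT : ~~ odd 2); rewrite /= lt_eqF// => h'; lra.
lra.
Qed.

Definition angle1 (p : R4 R) := angle p.1.
Definition angle2 (p : R4 R) := angle p.2.

Lemma measurable_angle1 : measurable_fun setT angle1.
Proof. exact: measurableT_comp measurable_angle measurable_fst. Qed.
Lemma measurable_angle2 : measurable_fun setT angle2.
Proof. exact: measurableT_comp measurable_angle measurable_snd. Qed.

Lemma angle1_pi p : torus2 p -> - pi < angle1 p <= pi.
Proof. by case=> /angleP[]. Qed.
Lemma angle2_pi p : torus2 p -> - pi < angle2 p <= pi.
Proof. by case=> _ /angleP[]. Qed.
Lemma zc1_angle p : torus2 p -> zc1 p = cis (angle1 p).
Proof. by case=> /angleP[_ h1 h2] _; rewrite /zc1 /cis h1 h2. Qed.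
Lemma zc2_angle p : torus2 p -> zc2 p = cis (angle2 p).
Proof. by case=> _ /angleP[_ h1 h2]; rewrite /zc2 /cis h1 h2. Qed.

Lemma Phi_angle p : torus2 p -> Phi (angle1 p, angle2 p) = p.
Proof.
case=> /angleP[_ h1 h2] /angleP[_ h3 h4].
by rewrite /Phi /= h1 h2 h3 h4; case: p {h1 h2 h3 h4} => -[? ?] [? ?].
Qed.

Lemma torus2_Phi x : torus2 (Phi x : R4 R).
Proof. by split; rewrite /= cos2Dsin2. Qed.

Lemma cisD2pi (x : R) (j : int) : cis (x + 2 * pi * j%:~R) = cis x.
Proof.
have nat_case (y : R) (n : nat) : cis (y + 2 * pi * n%:R) = cis y.
  have -> : 2 * pi * n%:R = (pi *+ 2) *+ n :> R by rewrite mulr_natr mulr_natl.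
  by rewrite /cis (periodicn (@cosD2pi R)) (periodicn (@sinD2pi R)).
case: j => n; first exact: nat_case.
rewrite -(nat_case (x + _) n.+1); congr cis.
by rewrite NegzE mulrNz -pmulrn; ring.
Qed.

Lemma angle_reduce (x : R) : exists j : int, - pi < x - 2 * pi * j%:~R <= pi.
Proof.
(* The ceiling rather than the floor, because ]-pi, pi] is closed on the right. *)
have pi0 := pi_gt0 R; exists (Num.ceil ((x - pi) / (2 * pi))).
have := ceil_itv ((x - pi) / (2 * pi)).
rewrite rmorphB /=; set j := (Num.ceil _)%:~R => /andP[h1 h2].
have e : (x - pi) / (2 * pi) * (2 * pi) = x - pi by rewrite divfK// gt_eqF// mulr_gt0.
have p2 : 0 < 2 * pi :> R by rewrite mulr_gt0.
rewrite -(ltr_pM2r p2) e in h1; rewrite -(ler_pM2r p2) e in h2.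
apply/andP; split; lra.
Qed.

Lemma angle_Phi (x : R * R) : exists j k : int,
  x.1 = angle1 (Phi x) + 2 * pi * j%:~R /\ x.2 = angle2 (Phi x) + 2 * pi * k%:~R.
Proof.
have [j hj] := angle_reduce x.1; have [k hk] := angle_reduce x.2.
have t := torus2_Phi x; exists j, k; split.
  have -> : angle1 (Phi x) = x.1 - 2 * pi * j%:~R; last by rewrite subrK.
  apply: cis_inj => //; first exact: angle1_pi.
  by rewrite -zc1_angle// -(cisD2pi _ j) subrK.
have -> : angle2 (Phi x) = x.2 - 2 * pi * k%:~R; last by rewrite subrK.
apply: cis_inj => //; first exact: angle2_pi.
by rewrite -zc2_angle// -(cisD2pi _ k) subrK.
Qed.

End Angles.

Lemma IC_swap d (T : measurableType d) (R : realType)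
    (mu1 mu2 : {finite_measure set T -> \bar R}) (D : set T) (f : T -> R[i]) :
  IC mu2 mu1 D f = - IC mu1 mu2 D f.
Proof. by rewrite /IC /Jint; apply: eq_ReIm; rewrite /= opprB. Qed.

(** * Graphs of monotone functions in the angular coordinates *)

Section MonotoneGraphs.
Variable R : realType.
Local Notation lambda := (@lebesgue_measure R).

Lemma measurable_Phi (f g : R -> R) : measurable_fun setT f -> measurable_fun setT g ->
  measurable_fun setT (fun x => Phi (f x, g x)).
Proof.
move=> mf mg.
have mc h : measurable_fun setT h -> measurable_fun setT (fun x : R => cos (h x)).
  by move=> mh; apply: measurableT_comp => //; apply: continuous_measurable_fun; exact: continuous_cos.
have ms h : measurable_fun setT h -> measurable_fun setT (fun x : R => sin (h x)).
  by move=> mh; apply: measurableT_comp => //; apply: continuous_measurable_fun; exact: continuous_sin.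
by apply: measurable_fun_pair; apply: measurable_fun_pair; [exact: mc|exact: ms|exact: mc|exact: ms].
Qed.

Lemma Phi_cis (p : R4 R) (x y : R) : zc1 p = cis x -> zc2 p = cis y -> p = Phi (x, y).
Proof. by case: p => -[a b] [c e]; rewrite /zc1 /zc2 /cis /Phi /= => -[-> ->] [-> ->]. Qed.

Lemma preimage_Phi (f g : R -> R) (B : set (R4 R)) : measurable_fun setT f ->
  measurable_fun setT g -> measurable B -> measurable [set x | B (Phi (f x, g x))].
Proof.
move=> mf mg mB; rewrite -[X in measurable X]setTI.
exact: (measurable_Phi mf mg) measurableT _ mB.
Qed.

Definition angle_graph (psi : R -> R) : set (R4 R) :=
  [set p | torus2 p /\ angle2 p = psi (angle1 p)].

Lemma measurable_preimage (X : R4 R -> R) (E : set R) : measurable_fun setT X ->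
  measurable E -> measurable (X @^-1` E).
Proof. by move=> mX mE; rewrite -[X in measurable X]setTI; exact: mX. Qed.

Lemma measurable_torus_graph (X Y : R4 R -> R) (psi : R -> R) : measurable_fun setT X ->
  measurable_fun setT Y -> measurable_fun setT psi ->
  measurable [set p | torus2 p /\ Y p = psi (X p)].
Proof.
move=> mX mY mpsi; apply: measurableI; first exact: measurable_torus2.
rewrite [X in measurable X](_ : _ = (fun p => Y p - psi (X p)) @^-1` [set 0]).
  apply: measurable_preimage; last exact: measurable_set1.
  by apply: measurable_funB => //; exact: measurableT_comp.
by apply/seteqP; split => p /=; [move=> ->; rewrite subrr|move=> /eqP; rewrite subr_eq0 => /eqP].
Qed.

Lemma nondecreasing_bounded (f : R -> R) : (forall x y, x <= y -> f x <= f y) ->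
  forall s, - pi < s <= pi -> `|f s| <= Num.max `|f (- pi)| `|f pi|.
Proof.
move=> ndf s /andP[h1 h2]; rewrite le_max.
have := ndf _ _ (ltW h1); have := ndf _ _ h2.
case/orP: (le_total 0 (f s)) => h.
  by rewrite (ger0_norm h) => h3 _; rewrite [X in _ || X](le_trans h3) ?orbT// ler_norm.
rewrite (ler0_norm h) => _ h3; have := ler_norm (- f (- pi)); rewrite normrN => h4.
by apply/orP; left; lra.
Qed.

Lemma measurable_angle_graph psi : measurable_fun setT psi -> measurable (angle_graph psi).
Proof.
exact: (measurable_torus_graph (@measurable_angle1 R) (@measurable_angle2 R)).
Qed.

Section Moments.
Variables mu1 mu2 : {finite_measure set (R4 R) -> \bar R}.
Hypothesis kernel_moment0 : forall z w, 0 < nc z < 1 -> 0 < nc w < 1 ->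
  IC mu1 mu2 torus2 (fun p => (zc1 p - z)^-1 * ((zc2 p - w)^-1)^*%C) = 0.

Lemma balanced_graph_null1 (psi : R -> R) (N : set R) : (forall x y, x <= y -> psi x <= psi y) ->
  measurable N -> lambda N = 0%E -> balanced mu1 mu2 (angle_graph psi `&` @angle1 R @^-1` N).
Proof.
move=> ndpsi mN N0 B mB hB.
have mpsi : measurable_fun setT psi by apply: nondecreasing_measurable.
pose P := N `&` `]-pi, pi]%classic.
apply: (@graph_over_null _ _ _ mu1 mu2 _ (@measurable_torus2 R) (@zc1 R) (@zc2 R) (@angle1 R)
  (@cbm_zc1 R) (@cbm_zc2 R) (@measurable_angle1 R) (@angle1_pi R) (@zc1_angle R) (@zc2_unit R)
  kernel_moment0 psi mpsi _ P (Num.max `|psi (- pi)| `|psi pi|) B) => //.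
- move=> C mC; exists [set x | C (Phi (x, psi x))]; first exact: preimage_Phi.
  by move=> p /zc1_angle e1 e2; rewrite {1}(Phi_cis e1 e2).
- exact: measurableI.
- by move=> s [_]; rewrite /= in_itv.
- by apply: (subset_measure0 _ _ _ N0) => // [|s []//]; exact: measurableI.
- by move=> s [_]; rewrite /= in_itv/= => hs; exact: nondecreasing_bounded.
- move=> p /hB [[tp e] Np]; split => //; last by rewrite -e zc2_angle.
  by split => //; rewrite /= in_itv/= angle1_pi.
Qed.

Lemma balanced_graph_null2 (phi : R -> R) (N : set R) : (forall x y, x <= y -> phi x <= phi y) ->
  measurable N -> lambda N = 0%E ->
  balanced mu1 mu2 ([set p | torus2 p /\ angle1 p = phi (angle2 p)] `&` @angle2 R @^-1` N).
Proof.
move=> ndphi mN N0 B mB hB.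
have mphi : measurable_fun setT phi by apply: nondecreasing_measurable.
pose P := N `&` `]-pi, pi]%classic.
apply: (@graph_over_null _ _ _ mu1 mu2 _ (@measurable_torus2 R) (@zc2 R) (@zc1 R) (@angle2 R)
  (@cbm_zc2 R) (@cbm_zc1 R) (@measurable_angle2 R) (@angle2_pi R) (@zc2_angle R) (@zc1_unit R)
  _ phi mphi _ P (Num.max `|phi (- pi)| `|phi pi|) B) => //.
(* Exchanging the coordinates conjugates the kernel; the measure is real, so the moment is
   conjugated as well and stays 0. *)
- move=> z w z1 w1; have h := kernel_moment0 w1 z1.
  rewrite -[RHS](conjc0 R) -[in RHS]h -IC_conj; last first.
    apply: cbmM; first exact: (cbm_ker (@cbm_zc1 R) (@zc1_unit R) (proj2 (andP w1))).
    by apply: cbm_conj; exact: (cbm_ker (@cbm_zc2 R) (@zc2_unit R) (proj2 (andP z1))).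
    exact: measurable_torus2.
  by apply: eq_IC => p _; rewrite rmorphM /= conjcK mulrC.
- move=> C mC; exists [set x | C (Phi (phi x, x))]; first exact: preimage_Phi.
  by move=> p /zc2_angle e2 e1; rewrite {1}(Phi_cis e1 e2).
- exact: measurableI.
- by move=> s [_]; rewrite /= in_itv.
- by apply: (subset_measure0 _ _ _ N0) => // [|s []//]; exact: measurableI.
- by move=> s [_]; rewrite /= in_itv/= => hs; exact: nondecreasing_bounded.
- move=> p /hB [[tp e] Np]; split => //; last by rewrite -e zc1_angle.
  by split => //; rewrite /= in_itv/= angle2_pi.
Qed.

End Moments.

(** [n.+1] is both the Lipschitz constant and the inverse of the radius, so one index exhausts all
    locally bi-Lipschitz points. The test points stay in [-4, 4], the window where the generalised
    inverse recovers them. *)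
Definition bilip_points (psi : R -> R) (n : nat) : set R :=
  [set x | forall s, -4 <= s <= 4 -> `|s - x| < n.+1%:R^-1 ->
    `|s - x| <= n.+1%:R * `|psi s - psi x| /\ `|psi s - psi x| <= n.+1%:R * `|s - x|].

(* The third condition makes the diameter at most 1 / (2 (n + 1)), so that psi varies by less
   than 1 on the cell; the last one makes [psi (angle1 p)] the angle of [cis (psi (angle1 p))]. *)
Definition bilip_cell (psi : R -> R) (n : nat) (j : int) : set R :=
  bilip_points psi n `&` `]-pi, pi]%classic `&` [set s | j%:~R <= 2 * n.+1%:R * s < j%:~R + 1]
  `&` psi @^-1` `]-pi, pi]%classic.

Section MonotoneFunction.
Variable psi : R -> R.
Hypothesis inpsi : forall x y, x < y -> psi x < psi y.

Let ndpsi x y : x <= y -> psi x <= psi y.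
Proof. by apply: ltW_homo. Qed.

Let mpsi : measurable_fun setT psi.
Proof. by apply: nondecreasing_measurable. Qed.

(** This makes the cells measurable. A nearby good point [y] has the limit [x] among its test
    points, which bounds [psi x - psi y] although [psi] may jump, and then the bounds at [y] pass to
    [x]. That [x] lies in [-4, 4] is what makes it a test point. *)
Lemma closed_bilip_points n : closed (bilip_points psi n `&` `[(-4), 4]%classic).
Proof.
set q : R := n.+1%:R; have q0 : 0 < q by rewrite ltr0n.
move=> x /= cx.
have near_pt (e : R) : 0 < e ->
    exists2 y, bilip_points psi n y /\ -4 <= y <= 4 & `|x - y| < e.
  move=> e0; have := cx (ball x e) (nbhsx_ballx x e e0).
  by move=> [y [[h1]]]; rewrite /= in_itv/= => h2 h3; exists y.
have x4 : -4 <= x <= 4.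
  apply/andP; split; apply/ler_addgt0Pr => e e0; have [y [_ /andP[y1 y2]]] := near_pt e e0;
    by rewrite ltr_norml => /andP[h1 h2]; lra.
split; last by rewrite /= in_itv.
move=> s s4 sx.
have key (e : R) : 0 < e -> `|s - x| <= q * `|psi s - psi x| + e /\
    `|psi s - psi x| <= q * `|s - x| + e.
  move=> e0.
  (* With u = |x - y|, the first bound absorbs the error q^2 u + 2 q u + u of replacing [x] by [y];
     the second keeps [s] within 1 / q of [y]. *)
  pose d := Num.min (e / (q ^+ 2 + 2 * q + 1)) (q^-1 - `|s - x|).
  have D0 : 0 < q ^+ 2 + 2 * q + 1 by rewrite addr_gt0// addr_gt0// ?exprn_gt0// mulr_gt0.
  have d0 : 0 < d by rewrite lt_min divr_gt0//= subr_gt0.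
  have [y [hy y4] xy] := near_pt d d0.
  have [xy1 xy2] : `|x - y| < e / (q ^+ 2 + 2 * q + 1) /\ `|x - y| < q^-1 - `|s - x|.
    by move: xy; rewrite lt_min => /andP[].
  rewrite ltr_pdivlMr// in xy1.
  have sy : `|s - y| <= `|s - x| + `|x - y| by rewrite -[s - y](subrKA x) ler_normD.
  have sy' : `|s - x| <= `|s - y| + `|x - y|.
    by rewrite (distrC x y) -[s - x](subrKA y) ler_normD.
  have [_ k2] : `|x - y| <= q * `|psi x - psi y| /\ `|psi x - psi y| <= q * `|x - y|.
    by apply: hy => //; apply: (lt_le_trans xy2); rewrite gerBl.
  have [k3 k4] : `|s - y| <= q * `|psi s - psi y| /\ `|psi s - psi y| <= q * `|s - y|.
    by apply: hy => //; apply: (le_lt_trans sy); rewrite -ltrBrDl.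
  have py : `|psi s - psi y| <= `|psi s - psi x| + `|psi x - psi y|.
    by rewrite -[psi s - psi y](subrKA (psi x)) ler_normD.
  have py' : `|psi s - psi x| <= `|psi s - psi y| + `|psi x - psi y|.
    by rewrite (distrC (psi x) (psi y)) -[psi s - psi x](subrKA (psi y)) ler_normD.
  have u0 := normr_ge0 (x - y).
  move: xy1 sy sy' k2 k3 k4 py py' u0.
  move: `|s - y| `|s - x| `|x - y| `|psi x - psi y| `|psi s - psi y| `|psi s - psi x|.
  move=> a b u v w t xy1 sy sy' k2 k3 k4 py py' u0.
  have m1 : q * w <= q * t + q * v by rewrite -mulrDr ler_wpM2l// ltW.
  have m2 : q * v <= q * (q * u) by rewrite ler_wpM2l// ltW.
  have m3 : q * a <= q * b + q * u by rewrite -mulrDr ler_wpM2l// ltW.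
  have m4 : u * (q ^+ 2 + 2 * q + 1) = q * (q * u) + 2 * (q * u) + u by ring.
  rewrite m4 in xy1; have qu : 0 <= q * u by rewrite mulr_ge0// ltW.
  have qqu : 0 <= q * (q * u) by rewrite mulr_ge0// ltW.
  by split; lra.
by split; apply/ler_addgt0Pr => e /key[].
Qed.

Lemma measurable_bilip_cell n j : measurable (bilip_cell psi n j).
Proof.
rewrite /bilip_cell; apply: measurableI; last first.
  by rewrite -[X in measurable X]setTI; exact: mpsi.
apply: measurableI; last first.
  have -> : [set s : R | j%:~R <= 2 * n.+1%:R * s < j%:~R + 1] =
      (fun s : R => 2 * n.+1%:R * s) @^-1` `[j%:~R, j%:~R + 1[%classic.
    by apply/seteqP; split => s /=; rewrite in_itv.
  rewrite -[X in measurable X]setTI.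
  have : measurable_fun setT (fun s : R => 2 * n.+1%:R * s) by apply: measurable_funM.
  by apply => //; exact: measurable_itv.
have -> : bilip_points psi n `&` `]-pi, pi]%classic =
    (bilip_points psi n `&` `[(-4), 4]%classic) `&` `]-pi, pi]%classic.
  rewrite -setIA; congr (_ `&` _); apply/seteqP; split => s /=; rewrite !in_itv/=; last by case.
  by have p2 := pihalf_lt2 R; move=> /andP[h1 h2]; split; apply/andP; split; lra.
by apply: measurableI => //; apply: closed_measurable; exact: closed_bilip_points.
Qed.

Variables mu1 mu2 : {finite_measure set (R4 R) -> \bar R}.
Hypothesis kernel_moment0 : forall z w, 0 < nc z < 1 -> 0 < nc w < 1 ->
  IC mu1 mu2 torus2 (fun p => (zc1 p - z)^-1 * ((zc2 p - w)^-1)^*%C) = 0.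

Lemma bilip_cell_lip n j s t : bilip_cell psi n j s -> bilip_cell psi n j t ->
  `|s - t| < n.+1%:R^-1 /\
  (`|s - t| <= n.+1%:R * `|psi s - psi t| /\ `|psi s - psi t| <= n.+1%:R * `|s - t|).
Proof.
move=> [[[_ /= + ] hs] _] [[[ht /= + ] ht'] _]; rewrite !in_itv/= => /andP[a1 a2] _.
have q0 : 0 < n.+1%:R :> R by rewrite ltr0n.
have st : `|s - t| < n.+1%:R^-1.
  rewrite -[X in _ < X]mul1r ltr_pdivlMr//.
  move: hs ht' => /= /andP[h1 h2] /andP[h3 h4].
  rewrite -(gtr0_norm q0) -normrM ltr_norml; rewrite mulrBl -!(mulrC n.+1%:R).
  rewrite -!mulrA in h1 h2 h3 h4.
  by move: (n.+1%:R * s) (n.+1%:R * t) h1 h2 h3 h4 => u v h1 h2 h3 h4; apply/andP; split; lra.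
split => //; apply: ht => //; have p2 := pihalf_lt2 R; apply/andP; split; lra.
Qed.

Lemma balanced_bilip_cell n j :
  balanced mu1 mu2 (angle_graph psi `&` @angle1 R @^-1` bilip_cell psi n j).
Proof.
have mE := measurable_bilip_cell n j; set E := bilip_cell psi n j in mE *.
have mG : measurable (angle_graph psi `&` @angle1 R @^-1` E).
  apply: measurableI; first exact: measurable_angle_graph.
  by apply: measurable_preimage => //; exact: measurable_angle1.
have q1 : 1 <= n.+1%:R :> R by rewrite ler1n.
(* Stated for an arbitrary pair, since it is used also with the two measures exchanged, where
   [IC_swap] supplies the moments. *)
have positive (nu1 nu2 : {finite_measure set (R4 R) -> \bar R}) (F : set R) :
    (forall z w, 0 < nc z < 1 -> 0 < nc w < 1 ->
      IC nu1 nu2 torus2 (fun p => (zc1 p - z)^-1 * ((zc2 p - w)^-1)^*%C) = 0) ->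
    compact F -> F `<=` E ->
    (forall B, measurable B -> B `<=` angle_graph psi `&` @angle1 R @^-1` E `&` @angle1 R @^-1` F ->
      (nu2 B <= nu1 B)%E) ->
    nu1 (angle_graph psi `&` @angle1 R @^-1` E `&` @angle1 R @^-1` F) =
    nu2 (angle_graph psi `&` @angle1 R @^-1` E `&` @angle1 R @^-1` F).
  move=> km cF FE.
  have : measurable (angle_graph psi `&` @angle1 R @^-1` E `&` @angle1 R @^-1` F).
    apply: measurableI => //; apply: measurable_preimage; first exact: measurable_angle1.
    by apply: closed_measurable; exact: compact_closed.
  have -> : angle_graph psi `&` @angle1 R @^-1` E `&` @angle1 R @^-1` F =
      [set p | torus2 p /\ F (angle1 p) /\ zc2 p = cis (psi (angle1 p))].
    apply/seteqP; split => p /=.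
      by move=> [[[tp e] _] Fp]; rewrite -e zc2_angle.
    move=> [tp [Fp e]]; split => //; split; last exact: FE.
    split => //; apply: cis_inj; first exact: angle2_pi.
      by have [_] := FE _ Fp; rewrite /= in_itv.
    by rewrite -zc2_angle.
  move=> mS; apply: (@positive_graph_null _ _ _ nu1 nu2 _ (@measurable_torus2 R) (@zc1 R) (@zc2 R) (@angle1 R)
    (@cbm_zc1 R) (@cbm_zc2 R) (@angle1_pi R) (@zc1_angle R) (@zc2_unit R) km psi F n.+1%:R) => //.
  - by move=> s /FE [[[_ h] _] _]; move: h; rewrite /= in_itv.
  - move=> s t /FE Es /FE Et; have [h1 [_ h2]] := bilip_cell_lip Es Et.
    have q0 : 0 < n.+1%:R :> R by rewrite ltr0n.
    rewrite (le_trans (ltW h1)) ?invf_le1//; split => //.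
    by rewrite (le_trans h2)// -ler_pdivlMl// mulr1 ltW.
  - move=> s t _ _; case/orP: (le_total s t) => st.
      by rewrite -mulrNN mulr_ge0// opprB subr_ge0// ndpsi.
    by rewrite mulr_ge0// subr_ge0// ndpsi.
  - by move=> s t /FE Es /FE Et; have [_ [h1 h2]] := bilip_cell_lip Es Et.
apply: (@balanced_of_compact _ _ _ (@angle1 R) _ E) => //.
- exact: measurable_angle1.
- by move=> p [_].
- exists (- pi), pi => s [[[_ + ] _] _]; rewrite /= !in_itv/= => /andP[h1 h2].
  by rewrite h2 ltW.
- move=> B mB; exists [set x | B (Phi (x, psi x))]; first exact: preimage_Phi.
  by move=> p [[tp e] _]; rewrite -{1}(Phi_angle tp) e.
- by move=> F cF FE; exact: positive.
- move=> F cF FE; apply: positive => // z w z1 w1.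
  by rewrite IC_swap kernel_moment0// oppr0.
Qed.

End MonotoneFunction.
End MonotoneGraphs.

Lemma sup_eq_max (R : realType) (A : set R) (x : R) : A x -> ubound A x -> sup A = x.
Proof.
move=> Ax ub; apply/eqP; rewrite eq_le ge_sup//=; last by exists x.
by apply: ub_le_sup => //; exists x.
Qed.

(** The generalised inverse is the supremum of the x in [a, b] with psi x <= y; adjoining [a] keeps
    the set nonempty for small y. It is monotone on the whole line, as [steep_points_null] demands,
    even across the jumps of [psi]. *)
Lemma monotone_left_inverse (R : realType) (psi : R -> R) (a b : R) :
  (forall x y, x < y -> psi x < psi y) -> a <= b ->
  exists phi : R -> R, (forall y z, y <= z -> phi y <= phi z) /\
    forall x, a <= x <= b -> phi (psi x) = x.
Proof.
move=> inpsi ab; pose A y := [set a] `|` [set x | a <= x <= b /\ psi x <= y].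
have Ab y : ubound (A y) b by move=> x [->//|[/andP[]]].
exists (fun y => sup (A y)); split=> [y z yz|x /andP[ax xb]].
  apply: le_sup; [|by exists a; left|by split; [exists a; left|exists b]].
  move=> x Ax; apply: (@le_down _ _ x) => //; case: Ax => [->|[xi h]]; first by left.
  by right; split => //; exact: le_trans yz.
apply: sup_eq_max; first by right; split => //; rewrite ax.
move=> z [->//|[_ h]]; rewrite leNgt; apply/negP => /inpsi; lra.
Qed.

(** * Angle graphs of strictly increasing functions *)

Section Cover.
Variables (R : realType) (psi : R -> R).
Hypothesis inpsi : forall x y, x < y -> psi x < psi y.
Local Notation lambda := (@lebesgue_measure R).

Let ndpsi x y : x <= y -> psi x <= psi y.
Proof. by apply: ltW_homo. Qed.

Lemma not_steep (f : R -> R) (N : set R) (x : R) :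
  ((forall M d : R, 0 < M -> 0 < d ->
      exists2 s, 0 < `|s - x| < d & M * `|s - x| < `|f s - f x|) -> N x) -> ~ N x ->
  exists M d : R, [/\ 0 < M, 0 < d & forall s, `|s - x| < d -> `|f s - f x| <= M * `|s - x|].
Proof.
move=> h Nx; apply: contrapT => H; apply: Nx; apply: h => M d M0 d0.
apply: contrapT => H2; apply: H; exists M, d; split => // s sd.
rewrite leNgt; apply/negP => lt; apply: H2; exists s => //.
rewrite sd andbT normr_gt0 subr_eq0; apply/eqP => e.
by move: lt; rewrite e !subrr normr0 mulr0 ltxx.
Qed.

Lemma bilip_cells_cover (phi : R -> R) : (forall x, -4 <= x <= 4 -> phi (psi x) = x) ->
  (forall y z, y <= z -> phi y <= phi z) ->
  exists N1 N2 : set R, [/\ measurable N1 /\ lambda N1 = 0%E, measurable N2 /\ lambda N2 = 0%E &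
  forall x, - pi < x <= pi -> - pi < psi x <= pi ->
    [\/ N1 x, N2 (psi x) | exists n j, bilip_cell psi n j x]].
Proof.
move=> phiK ndphi; have le44 : -4 <= 4 :> R by lra.
have [N1 [mN1 N10 h1]] := steep_points_null ndpsi le44.
have [N2 [mN2 N20 h2]] := steep_points_null ndphi le44.
exists N1, N2; split => // x xpi ypi.
have pi2 := pihalf_lt2 R.
have x4 : -4 <= x <= 4 by move: xpi => /andP[a b]; apply/andP; split; lra.
have y4 : -4 <= psi x <= 4 by move: ypi => /andP[a b]; apply/andP; split; lra.
case: (pselect (N1 x)) => [|n1]; first by constructor 1.
case: (pselect (N2 (psi x))) => [|n2]; first by constructor 2.
constructor 3.
have [M1 [d1 [M10 d10 H1]]] := not_steep (h1 x x4) n1.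
have [M2 [d2 [M20 d20 H2]]] := not_steep (h2 _ y4) n2.
(* [M1] and [M2] are the local Lipschitz constants of [psi] and of [phi]; 1 / d1 brings [s] within
   d1 of [x], and M1 / d2 then brings [psi s] within d2 of [psi x]. *)
pose n := Num.truncn (M1 + M2 + d1^-1 + M1 / d2).
have nb : M1 + M2 + d1^-1 + M1 / d2 < n.+1%:R by exact: truncnS_gt.
have i1 : 0 < d1^-1 by rewrite invr_gt0.
have i2 : 0 < M1 / d2 by rewrite divr_gt0.
exists n, (Num.floor (2 * n.+1%:R * x)).
split; last by rewrite /= in_itv.
split; last by have := floor_itv (2 * n.+1%:R * x); rewrite rmorphD /=.
split; last by rewrite /= in_itv.
move=> s s4 sx; have q0 : 0 < n.+1%:R :> R by rewrite ltr0n.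
have sx' : n.+1%:R * `|s - x| < 1 by rewrite -ltr_pdivlMl// mulr1.
have s0 := normr_ge0 (s - x).
have lt1 : `|s - x| < d1.
  rewrite -[X in _ < X]invrK -[X in _ < X]mul1r ltr_pdivlMr//.
  by rewrite (le_lt_trans _ sx')// mulrC ler_wpM2r//; lra.
have p1 := H1 s lt1.
have lt2 : `|psi s - psi x| < d2.
  rewrite (le_lt_trans p1)// -(ltr_pM2r (_ : 0 < d2^-1)) ?invr_gt0// mulfV ?gt_eqF//.
  by rewrite mulrAC (le_lt_trans _ sx')// ler_wpM2r//; lra.
have p2 := H2 (psi s) lt2; rewrite !phiK// in p2.
split; first by rewrite (le_trans p2)// ler_wpM2r//; lra.
by rewrite (le_trans p1)// ler_wpM2r//; lra.
Qed.

Variables mu1 mu2 : {finite_measure set (R4 R) -> \bar R}.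
Hypothesis kernel_moment0 : forall z w, 0 < nc z < 1 -> 0 < nc w < 1 ->
  IC mu1 mu2 torus2 (fun p => (zc1 p - z)^-1 * ((zc2 p - w)^-1)^*%C) = 0.

Lemma balanced_angle_graph : balanced mu1 mu2 (angle_graph psi).
Proof.
have mpsi : measurable_fun setT psi by apply: nondecreasing_measurable.
have le44 : -4 <= 4 :> R by lra.
have [phi [ndphi phiK]] := monotone_left_inverse inpsi le44.
have mphi : measurable_fun setT phi by apply: nondecreasing_measurable.
have [N1 [N2 [[mN1 N10] [mN2 N20] cover]]] := bilip_cells_cover phiK ndphi.
pose G2 := [set p : R4 R | torus2 p /\ angle1 p = phi (angle2 p)].
have mX (E : set R) : measurable E -> measurable (@angle1 R @^-1` E).
  by apply: measurable_preimage; exact: measurable_angle1.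
have mY (E : set R) : measurable E -> measurable (@angle2 R @^-1` E).
  by apply: measurable_preimage; exact: measurable_angle2.
have mG := measurable_angle_graph mpsi.
have mG2 : measurable G2.
  exact: (measurable_torus_graph (@measurable_angle2 R) (@measurable_angle1 R)).
pose C (i : nat * int) := angle_graph psi `&` @angle1 R @^-1` bilip_cell psi i.1 i.2.
have mC i : measurable (C i).
  by apply: measurableI => //; apply: mX; exact: measurable_bilip_cell.
apply: (@balanced_sub _ _ _ _ _ ((angle_graph psi `&` @angle1 R @^-1` N1) `|`
    (G2 `&` @angle2 R @^-1` N2) `|` \bigcup_i C i)).
  move=> p [tp e]; have := cover _ (angle1_pi tp); rewrite -e => /(_ (angle2_pi tp)).
  have p2 := pihalf_lt2 R; have /andP[a1 a2] := angle1_pi tp.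
  case=> [h|h|[n [j h]]]; [by left; left| |by right; exists (n, j)].
  (* Points whose second angle is in [N2] lie on the inverse graph [G2], because phi (psi x) = x. *)
  by left; right; split => //; split => //; rewrite e phiK//; apply/andP; split; lra.
apply: balanced_setU.
- by apply: measurableU; apply: measurableI => //; [exact: mX|exact: mY].
- by apply: countable_bigcupT_measurable.
- apply: balanced_setU.
  + by apply: measurableI => //; exact: mX.
  + by apply: measurableI => //; exact: mY.
  + exact: balanced_graph_null1.
  + exact: balanced_graph_null2.
- apply: balanced_bigcup => // i; exact: balanced_bilip_cell.
Qed.

End Cover.

(* Lifting the angles from (-pi, pi] to R decomposes the image of the graph into
   countably many translates of it. *)
Section PhiGraph.
Variables (R : realType) (psi : R -> R).
Hypothesis inpsi : forall x y, x < y -> psi x < psi y.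
Variables mu1 mu2 : {finite_measure set (R4 R) -> \bar R}.

Definition branch (jk : int * int) (x : R) : R :=
  psi (x + 2 * pi * jk.1%:~R) - 2 * pi * jk.2%:~R.

Lemma branch_increasing jk x y : x < y -> branch jk x < branch jk y.
Proof. by move=> xy; rewrite ltrD2r inpsi// ltrD2r. Qed.

Lemma PhiGraph_sub_branches : PhiGraph psi `<=` \bigcup_jk angle_graph (branch jk).
Proof.
move=> _ [x /= e <-]; have [j [k [h1 h2]]] := angle_Phi x; exists (j, k) => //.
split; first exact: torus2_Phi.
by rewrite /branch /= -h1 -e h2 addrK.
Qed.

Lemma measurable_branch jk : measurable (angle_graph (branch jk)).
Proof.
apply: measurable_angle_graph; apply: nondecreasing_measurable => // x y.
exact/ltW_homo/branch_increasing.
Qed.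

Hypothesis RPmu : RP mu1 mu2.

Lemma balanced_branch jk : balanced mu1 mu2 (angle_graph (branch jk)).
Proof.
by apply: balanced_angle_graph; [exact: branch_increasing|exact: RP_kernel_moment].
Qed.

Lemma balanced_PhiGraph : balanced mu1 mu2 (PhiGraph psi).
Proof.
apply: (balanced_sub PhiGraph_sub_branches).
by apply: balanced_bigcup; [exact: measurable_branch|exact: balanced_branch].
Qed.

Lemma totvar0_balanced (A : set (R4 R)) : balanced mu1 mu2 A -> totvar mu1 mu2 A = 0%E.
Proof.
move=> h; rewrite /totvar [X in ereal_sup X](_ : _ = [set 0%E]) ?ereal_sup1//.
apply/seteqP; split => s /=.
  move=> [n [B [mB [BA [_ ->]]]]]; rewrite big1// => i _.
  by rewrite (h _ (mB i) (BA i)) subee ?fin_num_measure// abse0.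
move=> ->; exists 0%N, (fun=> set0); split => //; split; [by case|split; [by case|by rewrite big_ord0]].
Qed.

Lemma balanced_totvar0 (A : set (R4 R)) : totvar mu1 mu2 A = 0%E -> balanced mu1 mu2 A.
Proof.
move=> h B mB BA.
have : (`|mu1 B - mu2 B| <= totvar mu1 mu2 A)%E.
  apply: ereal_sup_ubound; exists 1%N, (fun=> B); split; [|split; [|split]] => //.
    by move=> i j; rewrite !ord1 eqxx.
  by rewrite big_ord1.
rewrite h => h0; have /eqP : `|mu1 B - mu2 B|%E = 0%E by apply/eqP; rewrite eq_le h0 abse_ge0.
by rewrite abse_eq0 sube_eq ?fin_num_measure ?fin_num_adde_defl ?fin_num_measure// add0e => /eqP.
Qed.

End PhiGraph.

(** * Measures supported in the graph *)

Section RationalBoxes.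
Variable R : realType.

Definition rat_box (i : (rat * rat) * (rat * rat) * nat) : set (R4 R) :=
  let I (q : rat) := ball (ratr q : R) i.2.+1%:R^-1 in
  (I i.1.1.1 `*` I i.1.1.2) `*` (I i.1.2.1 `*` I i.1.2.2).

Lemma measurable_rat_box i : measurable (rat_box i).
Proof. by apply: measurableX; apply: measurableX; exact: measurable_ball. Qed.

Lemma rat_box_nbhs (p : R4 R) (U : set (R4 R)) : open U -> U p ->
  exists2 i, rat_box i p & rat_box i `<=` U.
Proof.
move=> oU Up; have : nbhs p U by exact: open_nbhs_nbhs.
rewrite -nbhs_ballE => -[e /= e0 hU].
pose n := Num.truncn (2 / e).
have nb : 2 / e < n.+1%:R by exact: truncnS_gt.
have n0 : 0 < n.+1%:R^-1 :> R by rewrite invr_gt0.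
have ne : n.+1%:R^-1 + n.+1%:R^-1 < e.
  rewrite ltr_pdivrMr// in nb.
  by rewrite -(ltr_pM2l (_ : 0 < n.+1%:R)) ?ltr0n// mulrDr mulfV ?pnatr_eq0.
have q (x : R) : exists r : rat, ball (ratr r : R) n.+1%:R^-1 x.
  move: n.+1%:R^-1 n0 => d d0; have xx : x - d < x + d by lra.
  have [r] := rat_in_itvoo xx.
    rewrite in_itv/= => /andP[h1 h2]; exists r; rewrite /ball /= ltr_norml.
    by apply/andP; split; lra.
have [q1 h1] := q p.1.1; have [q2 h2] := q p.1.2.
have [q3 h3] := q p.2.1; have [q4 h4] := q p.2.2.
exists (((q1, q2), (q3, q4)), n); first by [].
have tri (x y : R) (r : rat) : ball (ratr r : R) n.+1%:R^-1 x ->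
    ball (ratr r : R) n.+1%:R^-1 y -> ball x e y.
  by move=> hx hy; apply: (le_ball (ltW ne)); apply: ball_triangle hy; exact: ball_sym.
move=> [[a b] [c d]] [[/= k1 k2] [/= k3 k4]]; apply: hU.
by split; split; [exact: tri h1 k1|exact: tri h2 k2|exact: tri h3 k3|exact: tri h4 k4].
Qed.

End RationalBoxes.

Lemma balanced_of_support (R : realType) (psi : R -> R)
    (mu1 mu2 : {finite_measure set (R4 R) -> \bar R}) :
  (forall x y, x < y -> psi x < psi y) -> on_torus mu1 mu2 -> RP mu1 mu2 ->
  support_in mu1 mu2 (PhiGraph psi) -> balanced mu1 mu2 setT.
Proof.
move=> inpsi [mu1T mu2T] RPmu supp.
have mT := @measurable_torus2 R.
(* [V i] is the box when the box is balanced and empty otherwise, so the union over all indices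
   picks out the balanced boxes. *)
pose V i : set (R4 R) := [set p | rat_box i p /\ balanced mu1 mu2 (rat_box i)].
have mV i : measurable (V i).
  have [h|h] := pselect (balanced mu1 mu2 (rat_box i)).
    rewrite (_ : V i = rat_box i); last by apply/seteqP; split => // p [].
    exact: measurable_rat_box.
  by rewrite (_ : V i = set0)//; apply/seteqP; split => // p [].
have bV i : balanced mu1 mu2 (V i).
  move=> B mB BV; have [->|/set0P[p Bp]] := eqVneq B set0; first by rewrite !measure0.
  by have [_ h] := BV _ Bp; apply: h => // q /BV[].
(* A measurable balanced set containing [PhiGraph psi], as [balanced_setU] asks for measurable
   pieces. *)
pose W := \bigcup_jk angle_graph (branch psi jk).
have mW : measurable W.
  by apply: countable_bigcupT_measurable => // jk; exact: measurable_branch.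
have bW : balanced mu1 mu2 W.
  by apply: balanced_bigcup => jk; [exact: measurable_branch|exact: balanced_branch].
have mUV : measurable (\bigcup_i V i) by exact: countable_bigcupT_measurable.
apply: (@balanced_sub _ _ _ _ _ (~` torus2 `|` W `|` \bigcup_i V i)).
  move=> p _; have [tp|] := pselect (torus2 p); last by left; left.
  have [Wp|nWp] := pselect (W p); first by left; right.
  have [|U [oU [Up U0]]] := supp p tp; first by move=> /(PhiGraph_sub_branches); exact: nWp.
  have [i ip iU] := rat_box_nbhs oU Up; right; exists i => //; split => //.
  by apply: (balanced_sub iU); exact: balanced_totvar0.
apply: balanced_setU => //; last exact: balanced_bigcup.
- by apply: measurableU => //; exact: measurableC.
- apply: balanced_setU => //; first exact: measurableC.
  move=> B mB BT; have mC := measurableC mT.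
  by rewrite (subset_measure0 mB mC BT mu1T) (subset_measure0 mB mC BT mu2T).
Qed.

Theorem mainTheorem9 (R : realType) (psi : R -> R) :
  (forall x y : R, x < y -> psi x < psi y) ->
  (forall (K : set (R4 R)) (mu1 mu2 : {finite_measure set (R4 R) -> \bar R}),
      compact K -> K `<=` PhiGraph psi ->
      on_torus mu1 mu2 -> RP mu1 mu2 ->
      totvar mu1 mu2 K = 0%E) /\
  (forall mu1 mu2 : {finite_measure set (R4 R) -> \bar R},
      on_torus mu1 mu2 -> RP mu1 mu2 -> support_in mu1 mu2 (PhiGraph psi) ->
      forall A : set (R4 R), measurable A -> mu1 A = mu2 A).
Proof.
  move=> inpsi; split=> [K mu1 mu2 _ KF _ RPmu|mu1 mu2 tor RPmu supp A mA].
  - exact: totvar0_balanced (balanced_sub KF (balanced_PhiGraph inpsi RPmu)).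
  - exact: (balanced_of_support inpsi tor RPmu supp).
Qed.
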